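(* Let $m\ge3$ be an integer and $0<\gamma\le1$. Let $(H_j)_{j\ge1}$ be the intertwining sequence of any two Leja sequences $(\eta_j)_{j\ge0}$, $(\theta_i)_{i\ge0}$ for the closed unit disk (with $|\eta_0|=|\theta_0|=1$). Then for all $f\in Lip^m_\gamma(\overline{\mathbb{D}}^2)$, $$\sup_{(z,w)\in\overline{\mathbb{D}}^2}\left|f(z,w)-L^{(N)}[f](z,w)\right|=O\!\left(\frac1{N^{(m+\gamma-3)/2}}\right),$$ where $L^{(N)}[f]=\sum_{p=1}^Nf(H_p)\,l^{(N)}_{H_p}$ is the Lagrange interpolation polynomial of $f$ at $H_1,\ldots,H_N$.
   Context: A Leja sequence for a compact set $E\subset\mathbb{C}$, indexed from $0$, is a sequence $(\eta_j)_{j\ge0}$ of points of $E$ with $\eta_0\in\partial E$ and, for all $k\ge1$, $\sup_{z\in E}\prod_{j=0}^{k-1}|z-\eta_j|=\prod_{j=0}^{k-1}|\eta_k-\eta_j|$. Order $\mathbb{N}^2$ ($0\in\mathbb{N}$) by $(k_1,l_1)\le(k_2,l_2)$ iff $k_1+l_1<k_2+l_2$, or $k_1+l_1=k_2+l_2$ and $k_1\ge k_2$; this enumerates $\mathbb{N}^2$ as $(k(1),l(1)),(k(2),l(2)),\ldots=(0,0),(1,0),(0,1),(2,0),(1,1),\ldots$. Put $e_j(z,w)=z^{k(j)}w^{l(j)}$. The intertwining sequence of $(\eta_k)_{k\ge0}$ and $(\theta_l)_{l\ge0}$ is $H_j=(\eta_{k(j)},\theta_{l(j)})$, $j\ge1$.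 With $VDM(x_1,\ldots,x_N)=\det[e_i(x_j)]_{1\le i,j\le N}$ (nonzero at $(H_1,\ldots,H_N)$), set $l^{(N)}_{H_p}(z,w)=\frac{VDM(H_1,\ldots,H_{p-1},(z,w),H_{p+1},\ldots,H_N)}{VDM(H_1,\ldots,H_N)}$. $Lip_\gamma(\overline{\mathbb{D}}^2)$ is the set of functions $g$ holomorphic on $\mathbb{D}^2$ and continuous on $\overline{\mathbb{D}}^2$ for which there is $L>0$ with $|g(e^{ih}\zeta)-g(\zeta)|\le L|h|^\gamma$ for all $\zeta\in\mathbb{T}^2$ (the unit torus $\{|\zeta_1|=|\zeta_2|=1\}$) and $h\in\mathbb{R}$, where $e^{ih}\zeta=(e^{ih}\zeta_1,e^{ih}\zeta_2)$. $Lip^m_\gamma(\overline{\mathbb{D}}^2)$ is the set of $f$ holomorphic on $\mathbb{D}^2$ and continuous on $\overline{\mathbb{D}}^2$ such that $\frac{\partial^\alpha f}{\partial z^\alpha}\in Lip_\gamma(\overline{\mathbb{D}}^2)$ for every multi-index $\alpha=(\alpha_1,\alpha_2)$ with $\alpha_1+\alpha_2\le m$. The $O$ is as $N\to\infty$. *)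

(* Defs.v *)
From HB Require Import structures.
From mathcomp Require Import all_boot all_order all_algebra.
From mathcomp Require Import zify.
From mathcomp Require Import complex.
From mathcomp Require Import all_classical all_reals all_analysis.

Set Implicit Arguments.
Unset Strict Implicit.
Unset Printing Implicit Defensive.

Import Order.TTheory GRing.Theory Num.Theory.
Import numFieldNormedType.Exports.
Local Open Scope classical_set_scope.
Local Open Scope ring_scope.

(* R[i] packaged as a numFieldType: this is what gives it the metric topology
   and the normed-module-over-itself structure attached to every numFieldType,
   so that differentiability below is complex differentiability. *)
Definition Cplx (R : realType) : numFieldType := R[i]%C.

(* The real-valued modulus; the norm `|z| of the library lives in Cplx R. *)
Definition cabs (R : realType) (z : Cplx R) : R := ComplexField.Normc.normc z.

Lemma cabsE (R : realType) (z : Cplx R) : `|z| = ((cabs z)%:C%C : Cplx R).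
Proof. by []. Qed.

Definition expi (R : realType) (h : R) : Cplx R := (cos h +i* sin h)%C.

Section Domains.
Variable R : realType.
Local Notation C := (Cplx R).

Definition closed_disk : set C := [set z | cabs z <= 1].

Definition bidisk : set (C * C) := [set p | cabs p.1 < 1 /\ cabs p.2 < 1].

Definition closed_bidisk : set (C * C) :=
  [set p | cabs p.1 <= 1 /\ cabs p.2 <= 1].

Definition torus : set (C * C) := [set p | cabs p.1 = 1 /\ cabs p.2 = 1].

End Domains.
Arguments closed_disk : clear implicits.
Arguments bidisk : clear implicits.
Arguments closed_bidisk : clear implicits.
Arguments torus : clear implicits.

(* Intended for compact E; the second condition says that eta 0 lies on the
   topological boundary of E.  The supremum is taken in the extended reals. *)
Definition leja (R : realType) (E : set (Cplx R)) (eta : nat -> Cplx R) : Prop :=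
  [/\ forall j, E (eta j),
      (closure E `\` interior E) (eta 0%N)
    & forall k, (0 < k)%N ->
        ereal_sup [set (\prod_(j < k) cabs (z - eta j))%:E | z in E]
        = (\prod_(j < k) cabs (eta k - eta j))%:E].

Definition graded_le (p q : nat * nat) : bool :=
  (p.1 + p.2 < q.1 + q.2)%N ||
  ((p.1 + p.2 == q.1 + q.2)%N && (q.1 <= p.1)%N).

Definition graded_next (p : nat * nat) : nat * nat :=
  if p.1 is k.+1 then (k, p.2.+1) else (p.2.+1, 0%N).

(* Enumeration of nat * nat in increasing order for graded_le, indexed from 0:
   (0,0), (1,0), (0,1), (2,0), (1,1), ...; the (j+1)-st pair is graded_enum j.
   See graded_enum_bij and graded_enum_mono. *)
Definition graded_enum (j : nat) : nat * nat := iter j graded_next (0%N, 0%N).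

Lemma graded_leP p q : reflect
  ((p.1 + p.2 < q.1 + q.2)%N \/ (p.1 + p.2 = q.1 + q.2)%N /\ (q.1 <= p.1)%N)
  (graded_le p q).
Proof.
rewrite /graded_le; apply: (iffP orP) => -[lt_pq|].
- by left.
- by case/andP=> /eqP; right.
- by left.
- by case=> /eqP eq_pq le_qp; right; rewrite eq_pq.
Qed.

Lemma graded_le_anti p q : graded_le p q -> graded_le q p -> p = q.
Proof.
case: p q => [a b] [c d] /graded_leP /= h1 /graded_leP /= h2.
by congr (_, _); lia.
Qed.

Lemma graded_le_trans p q r :
  graded_le p q -> graded_le q r -> graded_le p r.
Proof.
case: p q r => [a b] [c d] [e f] /graded_leP /= h1 /graded_leP /= h2.
by apply/graded_leP => /=; lia.
Qed.

Lemma graded_nextP p : graded_le p (graded_next p) /\ p <> graded_next p.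
Proof.
case: p => [[|a] b]; split; try (by apply/graded_leP => /=; lia);
  by case; lia.
Qed.

Lemma graded_enum_lt i j : (i < j)%N ->
  graded_le (graded_enum i) (graded_enum j) /\ graded_enum i <> graded_enum j.
Proof.
elim: j => // j IHj; rewrite ltnS leq_eqVlt => /predU1P[->|/IHj[le_ij ne_ij]].
  exact: graded_nextP.
have [le_j ne_j] := graded_nextP (graded_enum j).
split; first exact: graded_le_trans le_ij le_j.
move=> eq_ij; apply: ne_ij; apply: graded_le_anti le_ij _.
by rewrite eq_ij.
Qed.

Lemma graded_enum_mono i j :
  graded_le (graded_enum i) (graded_enum j) = (i <= j)%N.
Proof.
have [|lt_ji|<-] := ltngtP i j.
- by case/graded_enum_lt.
- have [le_ji ne_ji] := graded_enum_lt lt_ji.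
  by apply/negP => le_ij; apply: ne_ji; apply: graded_le_anti.
- by apply/graded_leP; right.
Qed.

Lemma graded_enum_surj p : exists j, graded_enum j = p.
Proof.
suff H s : forall b a, (a + b = s)%N -> exists j, graded_enum j = (a, b).
  by case: p => a b; exact: (H (a + b)%N b a).
elim: s => [|s IHs]; first by case=> [|b] [|a] // _; exists 0%N.
elim=> [a|b IHb a eq_s].
  rewrite addn0 => ->; have [j Ej] := IHs s 0%N (add0n s).
  by exists j.+1; rewrite /graded_enum iterS -/(graded_enum j) Ej.
have [j Ej] := IHb a.+1 (ltac:(lia)).
by exists j.+1; rewrite /graded_enum iterS -/(graded_enum j) Ej.
Qed.

Lemma graded_enum_bij : bijective graded_enum.
Proof.
have enum_inj : injective graded_enum.
  move=> i j eq_ij; have [/graded_enum_lt[_ /(_ eq_ij)] //| |//] := ltngtP i j.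
  by case/graded_enum_lt=> _ /(_ (esym eq_ij)).
exists (fun p => projT1 (cid (graded_enum_surj p))) => x.
  by case: cid => y /=; apply: enum_inj.
by case: cid.
Qed.

Section Interpolation.
Variable R : realType.
Local Notation C := (Cplx R).

(* Points and monomials are indexed from 0. *)
Definition intertwining (eta theta : nat -> C) (j : nat) : C * C :=
  (eta (graded_enum j).1, theta (graded_enum j).2).

Definition monomial2 (j : nat) (p : C * C) : C :=
  p.1 ^+ (graded_enum j).1 * p.2 ^+ (graded_enum j).2.

Definition vdm (N : nat) (x : 'I_N -> C * C) : C :=
  \det (\matrix_(i < N, j < N) monomial2 i (x j)).

Definition fundamental_lagrange (N : nat) (x : 'I_N -> C * C) (p : 'I_N)
    (z : C * C) : C :=
  vdm (fun j => if j == p then z else x j) / vdm x.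

Definition lagrange_interp (N : nat) (x : 'I_N -> C * C) (f : C * C -> C)
    (z : C * C) : C :=
  \sum_(p < N) f (x p) * fundamental_lagrange x p z.

End Interpolation.

Section Lipschitz.
Variable R : realType.
Local Notation C := (Cplx R).

(* Functions on the closed bidisk are represented by total functions whose
   values outside the closed bidisk are irrelevant. *)
Definition disk_algebra2 (g : C * C -> C) : Prop :=
  (forall p, bidisk R p -> differentiable g p) /\
  {within closed_bidisk R, continuous g}.

Definition Lip (gamma : R) (g : C * C -> C) : Prop :=
  disk_algebra2 g /\
  exists2 L : R, 0 < L & forall (zeta : C * C) (h : R), torus R zeta ->
    cabs (g (expi h * zeta.1, expi h * zeta.2) - g zeta)
      <= L * `|h| `^ gamma.

Definition partial1 (f : C * C -> C) (p : C * C) : C := 'D_((1, 0) : C * C) f p.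
Definition partial2 (f : C * C -> C) (p : C * C) : C := 'D_((0, 1) : C * C) f p.

Definition partial (a : nat * nat) (f : C * C -> C) : C * C -> C :=
  iter a.1 partial1 (iter a.2 partial2 f).

(* A partial derivative of f is a priori defined on the open bidisk only; it
   belongs to Lip when it has an extension to the closed bidisk that does. *)
Definition Lipm (m : nat) (gamma : R) (f : C * C -> C) : Prop :=
  disk_algebra2 f /\
  forall a : nat * nat, (a.1 + a.2 <= m)%N ->
    exists2 g : C * C -> C, Lip gamma g &
      forall p, bidisk R p -> g p = partial a f p.

End Lipschitz.

(* Main.v *)
(* Write [w_k(z)] for the product of the [z - eta_j] with [j < k].  A Leja sequence
   of the disk starting on the circle satisfies [eta_(2j+1) = - eta_(2j)], and the
   squares [eta_(2j)^2] form such a sequence again.  Hence the sum [S_k] of the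
   squared moduli of the Lagrange polynomials obeys the recursions
   [S_(2k) <= S_k] and [S_(2k+1) <= 3/2 S_k + 3 (1 + S_k(eta_(2k)^2))], the
   right-hand sides being computed for the squared sequence, while [1 + S_k(eta_k)] is at most
   [k + 1]; so [S_k] and the Lebesgue constant are [O(k)].  Bivariate interpolation
   at the intertwining nodes is a sum over rows of tensor products of univariate
   interpolations with Newton increments, so its norm is [O(s^3) = O(N^(3/2))],
   where [s] is the total degree reached by the first [N] pairs.

   On the other side, [f] is at distance [O(s^-(m + gamma))] from the polynomials of
   degree less than [s]: along the rotations [(e^ih z, e^ih w)] the differences of
   order [m + 1] of [f] are [O(|h|^(m + gamma))], and a generalized Jackson kernel
   applies.  Everything is discretized on roots of unity: the rotation average is a
   finite mean applied to a polynomial uniformly close to [f], and such polynomials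
   are obtained by interpolating [f] at roots of unity. *)

Require Import Defs.
From HB Require Import structures.
From mathcomp Require Import all_boot all_order all_algebra.
From mathcomp Require Import zify ring lra.
From mathcomp Require Import complex.
From mathcomp Require Import all_classical all_reals all_analysis.

Import Order.TTheory GRing.Theory Num.Theory.
Import numFieldNormedType.Exports.
Local Open Scope classical_set_scope.
Local Open Scope ring_scope.

Set Implicit Arguments.
Unset Strict Implicit.
Unset Printing Implicit Defensive.

(** * The complex modulus *)

(** Squared moduli are summed because doubling then costs nothing. At a pair of nodes [u], [- u] of
    the circle the two-point factors [(z + u) / (2 u)] and [(u - z) / (2 u)] have squared moduli
    adding up to at most 1 on the disk, by the parallelogram law, whereas their moduli may add up to
    [sqrt 2]. The return to moduli through [2 x <= 1 + x ^ 2] keeps the order [k].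

    The obstacle on the approximation side is that derivatives of [f] exist inside the bidisk, while
    the Lipschitz bound concerns their extensions on the torus, along rotations. Estimates are
    therefore made at [r p] with [r < 1], and [r] tends to 1 by uniform continuity. Passing from [f]
    to a polynomial has two purposes: averaging over rotations becomes multiplication of
    coefficients by numbers that depend on the total degree, and bounds on the torus extend to the
    closed bidisk by a maximum principle with an algebraic proof. *)

Section Modulus.
Variable R : realType.
Local Notation C := (Cplx R).
Implicit Types (x y z : C) (h : R).

Lemma cabs_ge0 z : 0 <= cabs z.
Proof. by case: z => a b; exact: sqrtr_ge0. Qed.

Lemma cabs_sqr z : cabs z ^+ 2 = complex.Re z ^+ 2 + complex.Im z ^+ 2.
Proof.
by case: z => a b; rewrite /cabs /= sqr_sqrtr // addr_ge0 ?sqr_ge0.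
Qed.

Lemma cabsM x y : cabs (x * y) = cabs x * cabs y.
Proof. exact: ComplexField.Normc.normcM. Qed.

Lemma cabs0 : cabs (0 : C) = 0.
Proof. exact: ComplexField.Normc.normc0. Qed.

Lemma cabs1 : cabs (1 : C) = 1.
Proof. exact: ComplexField.Normc.normc1. Qed.

Lemma cabs_eq0 z : (cabs z == 0) = (z == 0).
Proof.
apply/eqP/eqP => [|->]; last exact: cabs0.
exact: ComplexField.Normc.eq0_normc.
Qed.

Lemma cabs_gt0 z : (0 < cabs z) = (z != 0).
Proof. by rewrite lt_neqAle cabs_ge0 andbT eq_sym cabs_eq0. Qed.

Lemma cabsN z : cabs (- z) = cabs z.
Proof. by apply: complexI; exact: (@normrN C C). Qed.

Lemma cabsD x y : cabs (x + y) <= cabs x + cabs y.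
Proof. by rewrite -lecR rmorphD; exact: (@ler_normD C C). Qed.

Lemma cabsB x y : cabs (x - y) <= cabs x + cabs y.
Proof. by rewrite -(cabsN y) cabsD. Qed.

Lemma cabs_distC x y : cabs (x - y) = cabs (y - x).
Proof. by rewrite -cabsN opprB. Qed.

Lemma cabs_triangle x y z : cabs (x - z) <= cabs (x - y) + cabs (y - z).
Proof. by have := cabsD (x - y) (y - z); rewrite addrA subrK. Qed.

Lemma cabsV z : cabs z^-1 = (cabs z)^-1.
Proof. exact: ComplexField.Normc.normcV. Qed.

Lemma cabsX z n : cabs (z ^+ n) = cabs z ^+ n.
Proof. by elim: n => [|n IHn]; rewrite ?expr0 ?cabs1 // !exprS cabsM IHn. Qed.

Lemma cabs_prod (I : Type) (r : seq I) (P : pred I) (F : I -> C) :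
  cabs (\prod_(i <- r | P i) F i) = \prod_(i <- r | P i) cabs (F i).
Proof. by apply: (big_morph (@cabs R)); [exact: cabsM | exact: cabs1]. Qed.

Lemma cabs_sum (I : Type) (r : seq I) (P : pred I) (F : I -> C) :
  cabs (\sum_(i <- r | P i) F i) <= \sum_(i <- r | P i) cabs (F i).
Proof.
elim/big_ind2: _ => [|x1 x2 y1 y2 h1 h2|//]; first by rewrite cabs0.
by apply: le_trans (cabsD _ _) _; exact: lerD.
Qed.

Lemma cabs_sum_ord n (F : 'I_n -> C) (a : R) :
  (forall i, cabs (F i) <= a) -> cabs (\sum_i F i) <= n%:R * a.
Proof.
move=> hF; apply: le_trans (cabs_sum _ _ _) _.
apply: le_trans (ler_sum _ (fun i _ => hF i)) _.
by rewrite sumr_const card_ord mulr_natl.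
Qed.

Lemma cabs_real (a : R) : cabs (a%:C%C : C) = `|a|.
Proof. by rewrite /cabs /= expr0n addr0 sqrtr_sqr. Qed.

Lemma cabs_nat n : cabs (n%:R : C) = n%:R.
Proof.
by apply: complexI; rewrite rmorph_nat; exact: (@normr_nat C n).
Qed.

Lemma Re_le_cabs z : `|complex.Re z| <= cabs z.
Proof.
rewrite -(@ler_pXn2r _ 2) ?nnegrE ?cabs_ge0 // real_normK ?num_real //.
by rewrite cabs_sqr lerDl sqr_ge0.
Qed.

Lemma cabs_le_ReIm z : cabs z <= `|complex.Re z| + `|complex.Im z|.
Proof.
rewrite -(@ler_pXn2r _ 2) ?nnegrE ?cabs_ge0 ?addr_ge0 //.
rewrite cabs_sqr sqrrD !real_normK ?num_real //.
by rewrite -addrA lerD2l lerDr mulrn_wge0 // mulr_ge0.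
Qed.

Lemma cabs_parallelogram x y :
  cabs (x + y) ^+ 2 + cabs (x - y) ^+ 2 = 2 * (cabs x ^+ 2 + cabs y ^+ 2).
Proof. by rewrite !cabs_sqr; case: x => a b; case: y => c d /=; ring. Qed.

Lemma cabs_conj_sqr z : ((cabs z ^+ 2)%:C%C : C) = z * (z^*)%C.
Proof. by rewrite rmorphXn; exact: sqr_normc. Qed.

Lemma expiD h k : expi (h + k) = expi h * expi k :> C.
Proof. by rewrite /expi cosD sinD; congr Complex; ring. Qed.

Lemma expi0 : expi 0 = 1 :> C.
Proof. by rewrite /expi cos0 sin0. Qed.

Lemma cabs_expi h : cabs (expi h) = 1.
Proof. by rewrite /cabs /= cos2Dsin2 sqrtr1. Qed.

Lemma expiX h n : expi h ^+ n = expi (n%:R * h) :> C.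
Proof.
elim: n => [|n IHn]; first by rewrite mul0r expi0 expr0.
by rewrite exprS IHn -expiD -natr1 mulrDl mul1r addrC.
Qed.

Lemma sqrt_surj z : exists y, y ^+ 2 = z.
Proof. by exists (sqrtc z); exact: sqr_sqrtc. Qed.

Lemma cabs_sub_le2 x y : cabs x <= 1 -> cabs y <= 1 -> cabs (x - y) <= 2.
Proof. by move=> hx hy; apply: le_trans (cabsB x y) _; lra. Qed.

Lemma cabs_le1X x n : cabs x <= 1 -> cabs (x ^+ n) <= 1.
Proof. by move=> hx; rewrite cabsX exprn_ile1 ?cabs_ge0. Qed.

(** The weights are [1 + t] and [1 + 1 / t] at [t = 1 / 2]. A first weight below 2 is what closes
    the induction of [lag_sq_le_next]; the weights 2 and 2 would not. *)
Lemma sqr_cabsD_le x y : cabs (x + y) ^+ 2 <= 3 / 2 * cabs x ^+ 2 + 3 * cabs y ^+ 2.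
Proof.
rewrite !cabs_sqr; case: x => a b; case: y => c d /=.
have := sqr_ge0 (a - 2 * c); have := sqr_ge0 (b - 2 * d); nra.
Qed.

End Modulus.

(** * Leja sequences of the unit disk *)

Section LejaDisk.
Variable R : realType.
Local Notation C := (Cplx R).
Implicit Types (eta : nat -> C) (z : C).

Definition node_poly eta n z : C := \prod_(j < n) (z - eta j).

(** The finite horizon allows a strong induction: the squared sequence is known to be Leja only as
    far as antipodality is, and its structure then gives that of the next even index. *)
Definition leja_upto n eta := cabs (eta 0%N) = 1 /\
  forall k, (k <= n)%N -> cabs (eta k) <= 1 /\
    forall z, cabs z <= 1 ->
      cabs (node_poly eta k z) <= cabs (node_poly eta k (eta k)).

Definition sqseq eta j : C := eta j.*2 ^+ 2.

Lemma prod_double n (F : nat -> C) :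
  \prod_(i < n.*2) F i = \prod_(i < n) (F i.*2 * F i.*2.+1).
Proof.
elim: n => [|n IHn]; first by rewrite !big_ord0.
by rewrite doubleS !big_ord_recr /= IHn mulrA.
Qed.

Lemma node_poly_double eta n z :
  (forall j, (j < n)%N -> eta j.*2.+1 = - eta j.*2) ->
  node_poly eta n.*2 z = node_poly (sqseq eta) n (z ^+ 2).
Proof.
move=> anti; rewrite /node_poly (prod_double n (fun i => z - eta i)).
apply: eq_bigr => i _; rewrite anti // /sqseq; ring.
Qed.

Lemma node_polyS eta n z :
  node_poly eta n.+1 z = node_poly eta n z * (z - eta n).
Proof. by rewrite /node_poly big_ord_recr. Qed.

(** Every [z] of the disk is [y ^ 2] with [y] in the disk, and by antipodality the node polynomial
    of degree [2 k] at [y] is that of the squared sequence at [z]; so the maxima correspond. *)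
Lemma leja_upto_sqseq n eta : leja_upto n.*2 eta ->
  (forall j, (j < n)%N -> eta j.*2.+1 = - eta j.*2) ->
  leja_upto n (sqseq eta).
Proof.
move=> [h0 hL] anti; split; first by rewrite /sqseq double0 cabsX h0 expr1n.
move=> k le_kn; have [hk hmax] := hL k.*2 (ltac:(by rewrite leq_double)).
split; first by rewrite cabs_le1X.
move=> z hz; have [y yz] := sqrt_surj z.
have antik j : (j < k)%N -> eta j.*2.+1 = - eta j.*2.
  by move=> lt_jk; apply: anti; exact: leq_trans le_kn.
rewrite -yz -node_poly_double // -node_poly_double //; apply: hmax.
rewrite -(@ler_pXn2r _ 2) ?nnegrE ?cabs_ge0 // expr1n -cabsX yz //.
Qed.

Lemma cabs_double (x : C) : cabs (x + x) = 2 * cabs x.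
Proof. by rewrite -mulr2n -[x *+ 2]mulr_natl cabsM cabs_nat. Qed.

(** The parallelogram law gives [cabs (e + b) ^ 2 <= 4 - cabs (e - b) ^ 2 <= 0]. *)
Lemma antipodal_of_max (b e : C) : cabs b = 1 -> cabs e <= 1 ->
  2 <= cabs (e - b) -> e = - b.
Proof.
move=> hb he heb; apply/eqP; rewrite -addr_eq0 -cabs_eq0.
have := cabs_parallelogram e b; rewrite hb.
have := cabs_ge0 e; have := cabs_ge0 (e + b); rewrite -[_ == 0]sqrf_eq0.
move=> h1 h2 h3; apply/eqP; nra.
Qed.

(* For [k = 2 N] pass to the squared sequence.  For [k = 2 N + 1] both factors
   of [node_poly eta (2 N) z * (z - eta (2 N))] reach their maximal modulus at
   [- eta (2 N)], and the second one reaches it only there. *)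
Lemma leja_upto_structure n eta : leja_upto n eta ->
  [/\ forall k, (k <= n)%N -> cabs (eta k) = 1,
      forall k, (k <= n)%N -> node_poly eta k (eta k) != 0
    & forall j, (j.*2.+1 <= n)%N -> eta j.*2.+1 = - eta j.*2].
Proof.
elim/ltn_ind: n eta => -[|n] IH eta hL.
  split=> [k|k|//]; rewrite leqn0 => /eqP ->; first by case: hL.
  by rewrite /node_poly big_ord0 oner_eq0.
have hLn : leja_upto n eta.
  by case: hL => h0 h; split=> // k hk; apply: h; exact: leqW.
have [IH1 IH2 IH3] := IH n (ltnSn n) eta hLn.
suff [h1 h2 h3] : [/\ cabs (eta n.+1) = 1, node_poly eta n.+1 (eta n.+1) != 0
    & forall j, j.*2.+1 = n.+1 -> eta j.*2.+1 = - eta j.*2].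
  split=> k; rewrite leq_eqVlt ltnS => /predU1P[|hk].
  - by move->.
  - exact: IH1.
  - by move->.
  - exact: IH2.
  - exact: h3.
  - exact: IH3.
have [N [nE|nE]] : exists N, n.+1 = N.*2 \/ n.+1 = N.*2.+1.
  exists n.+1./2; rewrite -{1 3}(odd_double_half n.+1).
  by case: (odd n.+1); [right|left].
  have anti j : (j < N)%N -> eta j.*2.+1 = - eta j.*2.
    by move=> jN; apply: IH3; lia.
  have hsq : leja_upto N (sqseq eta) by apply: leja_upto_sqseq; rewrite -?nE.
  have [J1 J2 _] := IH N (ltac:(lia)) _ hsq.
  split=> [||j]; last by lia.
    apply/eqP; rewrite -(@eqrXn2 _ 2) ?cabs_ge0 // expr1n -cabsX nE.
    by apply/eqP; exact: J1.
  by rewrite nE node_poly_double //; exact: J2.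
have anti j : (j < N)%N -> eta j.*2.+1 = - eta j.*2.
  by move=> jN; apply: IH3; lia.
have [eN] : n = N.*2 by case: nE.
have [hb hv] : cabs (eta N.*2) = 1 /\ node_poly eta N.*2 (eta N.*2) != 0.
  by split; [apply: IH1 | apply: IH2]; lia.
have [_ hmax] := (hL.2 N.*2 (ltac:(lia))).
have [he hmax'] := (hL.2 n.+1 (leqnn _)).
have E : eta n.+1 = - eta N.*2.
  apply: antipodal_of_max => //.
  have := hmax' (- eta N.*2); rewrite cabsN hb => /(_ (lexx _)).
  rewrite nE !node_polyS !cabsM -nE node_poly_double // sqrrN.
  rewrite -node_poly_double //.
  have -> : cabs (- eta N.*2 - eta N.*2) = 2.
    by rewrite -opprD cabsN cabs_double hb mulr1.
  have := hmax _ he; have := cabs_ge0 (eta n.+1 - eta N.*2).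
  move: hv; rewrite -cabs_gt0; nra.
split=> [||j jE]; first by rewrite E cabsN.
  rewrite E nE node_polyS node_poly_double // sqrrN -node_poly_double //.
  by rewrite mulf_neq0 // -opprD oppr_eq0 -cabs_eq0 cabs_double hb mulr1 pnatr_eq0.
by rewrite jE E; congr (- eta _); lia.
Qed.

Definition leja_disk eta := forall n, leja_upto n eta.

Section Structure.
Variable eta : nat -> C.
Hypothesis hL : leja_disk eta.

Lemma leja_disk_cabs k : cabs (eta k) = 1.
Proof. by have [+ _ _] := leja_upto_structure (hL k); apply. Qed.

Lemma leja_disk_neq0 k : node_poly eta k (eta k) != 0.
Proof. by have [_ + _] := leja_upto_structure (hL k); apply. Qed.

Lemma leja_disk_anti j : eta j.*2.+1 = - eta j.*2.
Proof. by have [_ _] := leja_upto_structure (hL j.*2.+1); apply. Qed.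

Lemma leja_disk_max k z : cabs z <= 1 ->
  cabs (node_poly eta k z) <= cabs (node_poly eta k (eta k)).
Proof. by have [_ /(_ k (leqnn k))[_]] := hL k; apply. Qed.

Lemma leja_disk_sqseq : leja_disk (sqseq eta).
Proof. by move=> n; apply: leja_upto_sqseq => // j _; exact: leja_disk_anti. Qed.

Lemma leja_disk_neq i j : i != j -> eta i != eta j.
Proof.
wlog lt_ij : i j / (i < j)%N.
  move=> H; rewrite neq_ltn => /orP[] h; first by apply: H; rewrite ?ltn_eqF.
  by rewrite eq_sym; apply: H; rewrite ?ltn_eqF.
move=> _; have := leja_disk_neq0 j; rewrite /node_poly => /prodf_neq0.
by move=> /(_ (Ordinal lt_ij) isT); rewrite subr_eq0 eq_sym.
Qed.

Lemma leja_disk_node_ratio k z : cabs z <= 1 ->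
  cabs (node_poly eta k z / node_poly eta k (eta k)) <= 1.
Proof.
move=> hz; rewrite cabsM cabsV ler_pdivrMr ?cabs_gt0 ?leja_disk_neq0 //.
by rewrite mul1r leja_disk_max.
Qed.

End Structure.

(** The factor of index [j] is 1 rather than omitted, so that the product runs over all [i < n] and
    its factors can be paired by [prod_double]. *)
Definition lag eta n j z : C :=
  \prod_(i < n) (if i == j :> nat then 1 else (z - eta i) / (eta j - eta i)).

Definition lag_sq eta n z : R := \sum_(j < n) cabs (lag eta n j z) ^+ 2.

Lemma prod_if1 n j (F : nat -> C) x : (j < n)%N ->
  \prod_(i < n) (if i == j :> nat then x else F i) =
  x * \prod_(i < n) (if i == j :> nat then 1 else F i).
Proof.
move=> lt_jn; rewrite (bigD1 (Ordinal lt_jn)) //= eqxx; congr (_ * _).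
rewrite [RHS](bigD1 (Ordinal lt_jn)) //= eqxx mul1r.
apply: eq_bigr => i; rewrite -val_eqE /= => /negPf -> //.
Qed.

Section Lagrange.
Variable eta : nat -> C.
Hypothesis hL : leja_disk eta.

(** Pairing the factors of [eta (2 i)] and [- eta (2 i)] produces those of the squared nodes; the
    pair of index [j] leaves the two-point Lagrange factor of [u], [- u]. *)
Lemma lag_double0 n j z : (j < n)%N -> lag eta n.*2 j.*2 z =
  lag (sqseq eta) n j (z ^+ 2) * ((z + eta j.*2) / (2%:R * eta j.*2)).
Proof.
move=> lt_jn; rewrite /lag; pose F i := if i == j.*2 then 1 else (z - eta i) / (eta j.*2 - eta i).
rewrite (prod_double n F) {}/F.
rewrite mulrC -(prod_if1 (fun i => (z ^+ 2 - sqseq eta i) / (sqseq eta j - sqseq eta i))) //.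
apply: eq_bigr => i _; rewrite !(inj_eq double_inj).
have -> : ((i.*2.+1 == j.*2) = false)%N by lia.
rewrite leja_disk_anti // opprK; case: eqVneq => [->|ne]; first by rewrite mul1r mulr_natl mulr2n.
have ne1 := leja_disk_neq hL ne; have ne2 : i.*2.+1 != j.*2 by lia.
have := leja_disk_neq hL ne2; rewrite leja_disk_anti // => {}ne2.
rewrite mulf_div /sqseq; congr (_ / _); ring.
Qed.

Lemma lag_double1 n j z : (j < n)%N -> lag eta n.*2 j.*2.+1 z =
  lag (sqseq eta) n j (z ^+ 2) * ((eta j.*2 - z) / (2%:R * eta j.*2)).
Proof.
move=> lt_jn; rewrite /lag; pose F i := if i == j.*2.+1 then 1 else (z - eta i) / (eta j.*2.+1 - eta i).
rewrite (prod_double n F) {}/F.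
rewrite mulrC -(prod_if1 (fun i => (z ^+ 2 - sqseq eta i) / (sqseq eta j - sqseq eta i))) //.
apply: eq_bigr => i _; rewrite eqSS !(inj_eq double_inj).
have -> : ((i.*2 == j.*2.+1) = false)%N by lia.
rewrite !leja_disk_anti // !opprK; case: eqVneq => [->|ne].
  by rewrite mulr1 -opprD -mulr2n mulr_natl invrN mulrN -mulNr opprB.
rewrite mulf_div /sqseq; congr (_ / _); ring.
Qed.

Lemma cabs_half_sq (u x : C) : cabs u = 1 ->
  cabs (x / (2%:R * u)) ^+ 2 = cabs x ^+ 2 / 4.
Proof.
by move=> hu; rewrite cabsM cabsV cabsM hu cabs_nat exprMn mulr1; congr (_ * _); field.
Qed.

Lemma sum_double n (F : nat -> R) :
  \sum_(i < n.*2) F i = \sum_(i < n) (F i.*2 + F i.*2.+1).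
Proof.
elim: n => [|n IHn]; first by rewrite !big_ord0.
by rewrite doubleS !big_ord_recr /= IHn addrA.
Qed.

(** The last factor is at most 1 on the disk and exactly 1 on the circle, in particular at the
    nodes. *)
Lemma lag_sq_double n z :
  lag_sq eta n.*2 z = lag_sq (sqseq eta) n (z ^+ 2) * ((1 + cabs z ^+ 2) / 2).
Proof.
rewrite /lag_sq (sum_double n (fun j => cabs (lag eta n.*2 j z) ^+ 2)) mulr_suml.
apply: eq_bigr => j _; have hu := leja_disk_cabs hL j.*2.
rewrite lag_double0 // lag_double1 // ![cabs (_ * (_ / _))]cabsM !exprMn !cabs_half_sq //.
have := cabs_parallelogram z (eta j.*2); rewrite hu (cabs_distC z) expr1n => h.
rewrite -mulrDr; congr (_ * _); lra.
Qed.

(** By [hw], [node_poly eta n] is [x - eta j] times a constant times [lag eta n j]; the factor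
    brought by the new node and the Newton correction then agree by a rational identity. *)
Lemma lag_recr n j z : (j < n)%N -> lag eta n.+1 j z =
  lag eta n j z -
  lag eta n j (eta n) * (node_poly eta n z / node_poly eta n (eta n)).
Proof.
move=> lt_jn; have hw x : node_poly eta n x = (x - eta j) *
    (lag eta n j x * \prod_(i < n) (if i == j :> nat then 1 else eta j - eta i)).
  rewrite /lag -big_split /= (eq_bigr (fun i : 'I_n =>
    if i == j :> nat then 1 else x - eta i)) => [|i _]; last first.
    case: eqVneq => [_|ne]; first by rewrite mulr1.
    by rewrite divfK // subr_eq0 leja_disk_neq // eq_sym.
  rewrite -(prod_if1 (fun i => x - eta i)) //; apply: eq_bigr => i _.
  by case: eqVneq => [->|].
have := leja_disk_neq0 hL n; rewrite !hw !mulf_eq0 !negb_or => /and3P[ne1 ne2 ne3].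
rewrite /lag big_ord_recr /= -!/(lag _ _ _ _).
have -> : (n == j) = false by lia.
have ne : eta j - eta n != 0 by rewrite subr_eq0 eq_sym -subr_eq0.
by field; rewrite ne ne1 ne2 ne3.
Qed.

Lemma lag_last n z :
  lag eta n.+1 n z = node_poly eta n z / node_poly eta n (eta n).
Proof.
rewrite /lag big_ord_recr /= eqxx mulr1 /node_poly -prodf_div.
by apply: eq_bigr => i _; rewrite ltn_eqF.
Qed.

Lemma lag_sq_recr_le n z : cabs z <= 1 -> lag_sq eta n.+1 z <=
  3 / 2 * lag_sq eta n z + 3 * (1 + lag_sq eta n (eta n)).
Proof.
move=> hz; rewrite /lag_sq big_ord_recr /= lag_last.
set q : C := node_poly eta n z / _; have hq : cabs q ^+ 2 <= 1 by rewrite exprn_ile1 ?cabs_ge0 ?leja_disk_node_ratio.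
have : \sum_(j < n) cabs (lag eta n.+1 j z) ^+ 2 <=
   \sum_(j < n) (3 / 2 * cabs (lag eta n j z) ^+ 2 + 3 * cabs (lag eta n j (eta n)) ^+ 2).
  apply: ler_sum => j _; rewrite lag_recr // -/q.
  apply: le_trans (sqr_cabsD_le _ _) _; rewrite cabsN cabsM exprMn lerD2l.
  rewrite ler_pM2l // ler_piMr // sqr_ge0 //.
rewrite big_split /= -!mulr_sumr; lra.
Qed.

(** With [b = eta (2 n)] the new node is [- b], where the even polynomial [node_poly eta (2 n)] has
    the same value as at [b]. By [lag_recr] each old basis polynomial takes at [- b] the difference
    of its former values at [- b] and [b]: the squared part is common, and the two-point factors
    differ by [b / u] up to sign, of modulus 1. *)
Lemma lag_sq_double_anti n : lag_sq eta n.*2.+1 (eta n.*2.+1) =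
  1 + 2 * lag_sq (sqseq eta) n (eta n.*2 ^+ 2).
Proof.
rewrite leja_disk_anti //; set b := eta n.*2.
have hanti j : (j < n)%N -> eta j.*2.+1 = - eta j.*2 by move=> _; exact: leja_disk_anti.
have q1 : node_poly eta n.*2 (- b) / node_poly eta n.*2 b = 1.
  rewrite node_poly_double // sqrrN -node_poly_double // divff //.
  exact: leja_disk_neq0.
rewrite /lag_sq big_ord_recr /= lag_last q1 cabs1 expr1n addrC; congr (_ + _).
rewrite (sum_double n (fun j => cabs (lag eta n.*2.+1 j (- b)) ^+ 2)) mulr_sumr.
apply: eq_bigr => j _; have hu := leja_disk_cabs hL j.*2.
have hb : cabs b = 1 by exact: leja_disk_cabs.
have u0 : eta j.*2 != 0 by rewrite -cabs_gt0 hu.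
have [lt0 lt1] : (j.*2 < n.*2)%N /\ (j.*2.+1 < n.*2)%N by have := ltn_ord j; lia.
rewrite !lag_recr // q1 !mulr1.
rewrite !lag_double0 // !lag_double1 // -/b sqrrN -!mulrBr ![cabs (_ * (_ - _))]cabsM !exprMn -mulrDr.
have two0 : (2%:R : C) != 0 by rewrite pnatr_eq0.
have -> : (- b + eta j.*2) / (2%:R * eta j.*2) - (b + eta j.*2) / (2%:R * eta j.*2) = - (b / eta j.*2).
  by field; rewrite u0.
have -> : (eta j.*2 - - b) / (2%:R * eta j.*2) - (eta j.*2 - b) / (2%:R * eta j.*2) = b / eta j.*2.
  by field; rewrite u0.
rewrite cabsN cabsM cabsV hu hb invr1; ring.
Qed.

Lemma lag_sq_ge0 n z : 0 <= lag_sq eta n z.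
Proof. by apply: sumr_ge0 => i _; rewrite sqr_ge0. Qed.

End Lagrange.

Lemma leja_disk_ind (P : nat -> (nat -> C) -> Prop) :
  (forall eta, leja_disk eta -> P 0%N eta) ->
  (forall n eta, leja_disk eta -> P n (sqseq eta) -> P n.*2 eta) ->
  (forall n eta, leja_disk eta -> P n (sqseq eta) -> P n.*2.+1 eta) ->
  forall n eta, leja_disk eta -> P n eta.
Proof.
move=> P0 Pe Po; elim/ltn_ind=> -[|n] IH eta hL; first exact: P0.
have hsq := leja_disk_sqseq hL.
rewrite -(odd_double_half n.+1); case: (odd n.+1); rewrite ?add1n ?add0n.
  by apply: Po => //; apply: IH => //; lia.
by apply: Pe => //; apply: IH => //; lia.
Qed.

(* In fact [1 + lag_sq eta n (eta n)] is [2] to the number of binary ones of [n]. *)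
Lemma lag_sq_next_le n eta : leja_disk eta -> lag_sq eta n (eta n) <= n%:R.
Proof.
move: n eta; apply: leja_disk_ind => [eta _|n eta hL|n eta hL].
- by rewrite /lag_sq big_ord0.
- rewrite /sqseq lag_sq_double // leja_disk_cabs // => h.
  apply: le_trans (_ : n%:R <= _); first by lra.
  by rewrite ler_nat; lia.
rewrite lag_sq_double_anti // -/(sqseq eta n) => h.
have -> : n.*2.+1%:R = 2 * n%:R + 1 :> R by rewrite -natr1 -mul2n natrM.
by rewrite -/(sqseq eta n) in h *; lra.
Qed.

(** The constant 6 solves [3 / 2 * c + 3 = 2 * c]: the left side is the loss of the odd step by
    [lag_sq_recr_le], and the 2 is the exact doubling of [1 + lag_sq] at the next node by
    [lag_sq_double_anti]. *)
Lemma lag_sq_le_next n eta : leja_disk eta -> forall z, cabs z <= 1 ->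
  lag_sq eta n z <= 6 * (1 + lag_sq eta n (eta n)).
Proof.
move: n eta; apply: leja_disk_ind => [eta hL z _|n eta hL IH z hz|n eta hL IH z hz].
- by rewrite /lag_sq !big_ord0; lra.
- have /IH : cabs (z ^+ 2) <= 1 by rewrite cabs_le1X.
  have hz2 : cabs z ^+ 2 <= 1 by rewrite exprn_ile1 ?cabs_ge0.
  have := lag_sq_ge0 (sqseq eta) n (z ^+ 2).
  rewrite /sqseq !lag_sq_double // (leja_disk_cabs hL) -/(sqseq eta); nra.
have /IH : cabs (z ^+ 2) <= 1 by rewrite cabs_le1X.
have hz2 : cabs z ^+ 2 <= 1 by rewrite exprn_ile1 ?cabs_ge0.
have := lag_sq_ge0 (sqseq eta) n (z ^+ 2).
have := lag_sq_recr_le hL n.*2 hz; rewrite !lag_sq_double // leja_disk_cabs //.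
rewrite lag_sq_double_anti // -/(sqseq eta n); nra.
Qed.

Lemma sum_lag_le_sq eta n z :
  \sum_(j < n) cabs (lag eta n j z) <= (n%:R + lag_sq eta n z) / 2.
Proof.
rewrite -[n in n%:R]card_ord -sum1_card natr_sum -big_split /= mulr_suml.
by apply: ler_sum => j _; have := sqr_ge0 (cabs (lag eta n j z) - 1); nra.
Qed.

Lemma lebesgue_le eta n z : leja_disk eta -> cabs z <= 1 ->
  \sum_(j < n) cabs (lag eta n j z) <= 4 * n.+1%:R.
Proof.
move=> hL hz; apply: le_trans (sum_lag_le_sq _ _ _) _.
have := lag_sq_le_next n hL hz; have := lag_sq_next_le n hL.
by rewrite -addn1 natrD; have := ler0n R n; lra.
Qed.

Lemma lebesgue_next_le eta n : leja_disk eta ->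
  \sum_(j < n) cabs (lag eta n j (eta n)) <= n%:R.
Proof.
move=> hL; apply: le_trans (sum_lag_le_sq _ _ _) _.
by have := lag_sq_next_le n hL; lra.
Qed.

Lemma lag_diag eta n i j : leja_disk eta -> (i < n)%N ->
  lag eta n j (eta i) = (i == j)%:R.
Proof.
move=> hL lt_in; case: eqVneq => [->|ne].
  rewrite /lag big1 // => k _; case: eqVneq => // ne; rewrite divff //.
  by rewrite subr_eq0 leja_disk_neq // eq_sym.
apply/eqP; rewrite /lag prodf_seq_eq0; apply/hasP; exists (Ordinal lt_in).
  exact: mem_index_enum.
by rewrite /= (negPf ne) subrr mul0r.
Qed.

Lemma leja_leja_disk eta : leja (closed_disk R) eta -> cabs (eta 0%N) = 1 ->
  leja_disk eta.
Proof.
move=> [hE _ hsup] h0 n; split=> // k _; split; first exact: hE.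
move=> z hz; rewrite /node_poly !cabs_prod.
case: k => [|k]; first by rewrite !big_ord0.
rewrite -lee_fin -hsup //; apply: ereal_sup_ubound.
by exists z.
Qed.

End LejaDisk.

(** * Interpolation on the staircase of the graded order *)

Section Staircase.

Definition graded_level N : nat := ((graded_enum N).1 + (graded_enum N).2)%N.

(* The first [N] pairs of the graded order form a staircase whose [l]-th row
   has length [graded_row N l]; rows of index at least [graded_level N] are empty. *)
Definition graded_row N l : nat :=
  (graded_level N - l + (l < (graded_enum N).2))%N.

Lemma graded_enum_ltn N i :
  (i < N)%N = ((graded_enum i).1 < graded_row N (graded_enum i).2)%N.
Proof.
rewrite ltnNge -graded_enum_mono /graded_le /graded_row /graded_level.
by case: (graded_enum N) (graded_enum i) => [a b] [k l] /=; case: ltnP; lia.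
Qed.

Lemma graded_row_level N k l : (k < graded_row N l)%N -> (l < graded_level N)%N.
Proof. by rewrite /graded_row /graded_level; case: graded_enum => a b /=; case: ltnP; lia. Qed.

Lemma graded_row_le N l l' : (l <= l')%N -> (graded_row N l' <= graded_row N l)%N.
Proof.
rewrite /graded_row /graded_level; case: graded_enum => a b /=.
by case: ltnP; case: ltnP; lia.
Qed.

Lemma graded_row_bound N l : (graded_row N l <= (graded_level N).+1)%N.
Proof. by rewrite /graded_row; case: ltnP; lia. Qed.

Lemma graded_row_mem N k l : (k < graded_row N l)%N ->
  exists i : 'I_N, graded_enum i = (k, l).
Proof.
have [i Ei] := graded_enum_surj (k, l) => h.
have lt_iN : (i < N)%N by rewrite graded_enum_ltn Ei.
by exists (Ordinal lt_iN).
Qed.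

Lemma graded_row_degree N k l :
  (k + l < graded_level N)%N -> (k < graded_row N l)%N.
Proof. by rewrite /graded_row; lia. Qed.

Lemma graded_level_sqr N : (N <= (graded_level N).+1 ^ 2)%N.
Proof.
set s := graded_level N.
have lt_i (i : 'I_N) : (((graded_enum i).1 < s.+1) && ((graded_enum i).2 < s.+1))%N.
  have := ltn_ord i; rewrite graded_enum_ltn => h.
  have := graded_row_level h; move: h; rewrite /graded_row -/s.
  by case: ltnP; lia.
pose F (i : 'I_N) : 'I_s.+1 * 'I_s.+1 := (inord (graded_enum i).1, inord (graded_enum i).2).
have /leq_card : injective F.
  move=> i j [/(congr1 val) /= + /(congr1 val) /=].
  have /andP[i1 i2] := lt_i i; have /andP[j1 j2] := lt_i j.
  rewrite !inordK // => e1 e2; apply: val_inj => /=.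
  apply: (bij_inj graded_enum_bij).
  by rewrite [LHS]surjective_pairing e1 e2 -surjective_pairing.
by rewrite card_prod !card_ord -mulnn.
Qed.

End Staircase.

(** * Bivariate interpolation at the staircase nodes: exactness and norm *)

Section Interpolation2.
Variable R : realType.
Local Notation C := (Cplx R).

Definition poly2_span N (g : C * C -> C) : Prop :=
  exists c : 'I_N -> C, forall p, g p = \sum_(i < N) c i * monomial2 i p.

Lemma poly2_span0 N : poly2_span N (fun=> 0).
Proof. by exists (fun=> 0) => p; rewrite big1 // => i _; rewrite mul0r. Qed.

Lemma poly2_spanZ N (a : C) g : poly2_span N g -> poly2_span N (fun p => a * g p).
Proof.
move=> [c hc]; exists (fun i => a * c i) => p.
by rewrite hc mulr_sumr; apply: eq_bigr => i _; rewrite mulrA.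
Qed.

Lemma poly2_span_sum N (I : finType) (F : I -> C * C -> C) :
  (forall i, poly2_span N (F i)) -> poly2_span N (fun p => \sum_i F i p).
Proof.
move=> /choice[c hc]; exists (fun j => \sum_i c i j) => p.
under eq_bigr => i _ do rewrite hc.
by rewrite exchange_big; apply: eq_bigr => j _; rewrite mulr_suml.
Qed.

Lemma poly2_span_mono N k l : (k < graded_row N l)%N ->
  poly2_span N (fun p => p.1 ^+ k * p.2 ^+ l).
Proof.
move=> /graded_row_mem[i Ei]; exists (fun j => (j == i)%:R) => p.
rewrite (bigD1 i) //= eqxx mul1r big1 ?addr0 => [|j /negPf->]; last by rewrite mul0r.
by rewrite /monomial2 Ei.
Qed.

(** Rows shorten as their index grows, so a monomial whose first exponent fits in row [l] also fits
    in every row [j <= l]. This is why interpolation along row [l] may be tensored with a polynomial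
    of degree [l]. *)
Lemma poly2_span_tensor N (a b : {poly C}) l :
  (size a <= graded_row N l)%N -> (size b <= l.+1)%N ->
  poly2_span N (fun p => a.[p.1] * b.[p.2]).
Proof.
move=> ha hb; pose F (i : 'I_(size a)) (j : 'I_(size b)) (p : C * C) : C :=
  a`_i * b`_j * (p.1 ^+ i * p.2 ^+ j).
have := @poly2_span_sum N _ (fun i p => \sum_j F i j p).
case=> [i|c hc].
  apply: poly2_span_sum => j; apply: poly2_spanZ; apply: poly2_span_mono.
  apply: leq_trans (leq_trans (ltn_ord i) ha) _; apply: graded_row_le.
  by rewrite -ltnS; exact: leq_trans (ltn_ord j) hb.
exists c => p; rewrite -hc !horner_coef mulr_suml; apply: eq_bigr => i _.
by rewrite mulr_sumr; apply: eq_bigr => j _; rewrite /F; ring.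
Qed.

Lemma lag_poly (eta : nat -> C) n j : (j < n)%N ->
  exists2 a : {poly C}, (size a <= n)%N & forall z, lag eta n j z = a.[z].
Proof.
move=> lt_jn; pose F (i : 'I_n) : {poly C} := if i == j :> nat then 1 else
   (eta j - eta i)^-1 *: ('X - (eta i)%:P).
exists (\prod_i F i) => [|z]; last first.
  rewrite /lag horner_prod; apply: eq_bigr => i _; rewrite /F.
  by case: eqP => _; rewrite ?hornerC // hornerZ hornerXsubC mulrC.
rewrite (bigD1 (Ordinal lt_jn)) //= {1}/F eqxx mul1r.
apply: leq_trans (size_prod_leq _ _) _.
have -> : #|(fun i => i != Ordinal lt_jn)| = n.-1 by rewrite cardC1 card_ord.
have : (\sum_(i < n | i != Ordinal lt_jn) size (F i) <= \sum_(i < n | i != Ordinal lt_jn) 2)%N.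
  apply: leq_sum => i _; rewrite /F; case: eqP => _; first by rewrite size_poly1.
  by apply: leq_trans (size_scale_leq _ _) _; rewrite size_XsubC.
rewrite sum_nat_const cardC1 card_ord; move: (\sum_(i < n | _) _)%N => S; move: lt_jn; clear; lia.
Qed.

Lemma node_poly_poly (eta : nat -> C) n :
  exists2 a : {poly C}, (size a <= n.+1)%N & forall z, node_poly eta n z = a.[z].
Proof.
exists (\prod_(i < n) ('X - (eta i)%:P)) => [|z].
  by rewrite size_prod_XsubC /index_enum -enumT size_enum_ord.
by rewrite horner_prod; apply: eq_bigr => i _; rewrite hornerXsubC.
Qed.

Section Operator.
Variables eta theta : nat -> C.
Hypotheses (hE : leja_disk eta) (hT : leja_disk theta).

(** The defect at [theta l] of the interpolant at the first [l] nodes, that is, the divided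
    difference of order [l] multiplied by [node_poly theta l (theta l)]. *)
Definition newton_coef l (u : nat -> C) : C :=
  u l - \sum_(j < l) u j * lag theta l j (theta l).

Lemma newton_lagrange n u w :
  \sum_(l < n) newton_coef l u * (node_poly theta l w / node_poly theta l (theta l)) =
  \sum_(j < n) u j * lag theta n j w.
Proof.
elim: n => [|n IHn]; first by rewrite !big_ord0.
rewrite !big_ord_recr /= IHn lag_last.
have -> : \sum_(j < n) u j * lag theta n.+1 j w = \sum_(j < n) u j * lag theta n j w -
   (\sum_(j < n) u j * lag theta n j (theta n)) * (node_poly theta n w / node_poly theta n (theta n)).
  rewrite mulr_suml -sumrB; apply: eq_bigr => j _.
  by rewrite lag_recr //; set q := node_poly _ _ _ / _; ring.
by rewrite /newton_coef; set q := node_poly _ _ _ / _; ring.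
Qed.

(* The sum over [l] of the tensor products of the interpolation operator at
   [eta 0, ..., eta (graded_row N l - 1)] with the difference of the
   interpolation operators at [l.+1] and [l] points of [theta]. *)
Definition stair_interp N (v : nat -> nat -> C) (p : C * C) : C :=
  \sum_(l < graded_level N) \sum_(k < graded_row N l)
    lag eta (graded_row N l) k p.1 * newton_coef l (v k) *
    (node_poly theta l p.2 / node_poly theta l (theta l)).

(** Rows [l > b] vanish at [theta b]. Rows [l <= b] are longer than [a], so the first factor selects
    [k = a]; what remains is the Newton form of the interpolant at [b + 1] nodes, evaluated at its
    last node. *)
Lemma stair_interp_node N v a b : (a < graded_row N b)%N ->
  stair_interp N v (eta a, theta b) = v a b.
Proof.
move=> hab; have hb := graded_row_level hab.
transitivity (\sum_(l < b.+1) newton_coef l (v a) *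
    (node_poly theta l (theta b) / node_poly theta l (theta l))).
  rewrite /stair_interp (big_ord_widen _ (fun l => newton_coef l (v a) *
    (node_poly theta l (theta b) / node_poly theta l (theta l))) hb) [RHS]big_mkcond.
  apply: eq_bigr => l _ /=; case: ltnP => hlb; last first.
    apply: big1 => k _; have -> : node_poly theta l (theta b) = 0.
      by apply/eqP/prodf_eq0; exists (Ordinal hlb) => //=; rewrite subrr.
    by rewrite mul0r mulr0.
  have ha : (a < graded_row N l)%N by apply: leq_trans hab _; exact: graded_row_le.
  rewrite (bigD1 (Ordinal ha)) //= lag_diag // eqxx mul1r big1 ?addr0 //.
  move=> k; rewrite -val_eqE /= => ne; rewrite lag_diag // eq_sym (negPf ne).
  by rewrite !mul0r.
rewrite newton_lagrange big_ord_recr /= lag_diag // eqxx mulr1 big1 ?add0r //.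
by move=> j _; rewrite lag_diag // gtn_eqF // mulr0.
Qed.

Lemma stair_interp_span N v : poly2_span N (stair_interp N v).
Proof.
apply: poly2_span_sum => l; apply: poly2_span_sum => k.
have [a ha aE] := lag_poly eta (ltn_ord k).
have [b hb bE] := node_poly_poly theta l.
have [c hc] := poly2_spanZ (newton_coef l (v k) / node_poly theta l (theta l))
  (poly2_span_tensor ha hb).
by exists c => p; rewrite -hc aE bE; ring.
Qed.

Lemma newton_coef_le l u V : (forall j, cabs (u j) <= V) ->
  cabs (newton_coef l u) <= l.+1%:R * V.
Proof.
move=> hu; have V0 : 0 <= V by apply: le_trans (hu 0%N); exact: cabs_ge0.
apply: le_trans (cabsB _ _) _; rewrite -natr1 mulrDl mul1r addrC lerD //.
apply: le_trans (cabs_sum _ _ _) _.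
apply: le_trans (_ : \sum_(j < l) cabs (lag theta l j (theta l)) * V <= _).
  by apply: ler_sum => j _; rewrite cabsM mulrC ler_wpM2l ?cabs_ge0.
by rewrite -mulr_suml ler_wpM2r // lebesgue_next_le.
Qed.

(** With [s] the level: [s] rows, Newton coefficients at most [l + 1 <= s] times the data, and a
    Lebesgue constant at most [4 (s + 2)] for a row of at most [s + 1] nodes. *)
Definition stair_norm N : R :=
  (graded_level N)%:R * ((graded_level N)%:R * (4 * (graded_level N).+2%:R)).

Lemma stair_interp_le N v V p : closed_bidisk R p ->
  (forall k l, cabs (v k l) <= V) -> cabs (stair_interp N v p) <= stair_norm N * V.
Proof.
move=> [hp1 hp2] hv; have V0 : 0 <= V by apply: le_trans (hv 0%N 0%N); exact: cabs_ge0.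
rewrite /stair_norm -mulrA; apply: cabs_sum_ord => l.
apply: le_trans (cabs_sum _ _ _) _.
apply: le_trans (_ : \sum_(k < graded_row N l)
   cabs (lag eta (graded_row N l) k p.1) * ((graded_level N)%:R * V) <= _).
  apply: ler_sum => k _; rewrite !(cabsM (_ * _)) (cabsM (lag _ _ _ _)).
  apply: le_trans (_ : _ * _ * 1 <= _).
    by apply: ler_wpM2l; rewrite ?mulr_ge0 ?cabs_ge0 // leja_disk_node_ratio.
  rewrite mulr1 ler_wpM2l ?cabs_ge0 //.
  apply: le_trans (newton_coef_le l (hv k)) _.
  by rewrite ler_wpM2r // ler_nat.
rewrite -mulr_suml mulrC -!mulrA ler_wpM2l // [V * _]mulrC mulrA ler_wpM2r //.
apply: le_trans (lebesgue_le _ hE hp1) _.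
by rewrite ler_wpM2l // ler_nat ltnS graded_row_bound.
Qed.

Local Notation nodes N := (fun j : 'I_N => intertwining eta theta j).

Definition basis_mx N (x : 'I_N -> C * C) : 'M[C]_N :=
  \matrix_(i < N, j < N) monomial2 i (x j).

(** Cramer's rule: expansion along the replaced column [p] yields row [p] of the adjugate, which is
    the determinant times [B]. *)
Lemma fundamental_lagrange_inv N (x : 'I_N -> C * C) (B : 'M[C]_N) p z :
  B *m basis_mx x = 1%:M ->
  fundamental_lagrange x p z = \sum_(i < N) B p i * monomial2 i z.
Proof.
move=> BA; set A := basis_mx x in BA *.
have AB : A *m B = 1%:M by exact: mulmx1C.
have detA : \det A != 0.
  apply/eqP => d0; have := congr1 determinant BA.
  by rewrite det_mulmx d0 mulr0 det1 => /eqP; rewrite eq_sym oner_eq0.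
have adjE : \adj A = \det A *: B.
  by rewrite -[LHS]mul1mx -BA -mulmxA mul_mx_adj mul_mx_scalar.
rewrite /fundamental_lagrange /vdm -/(basis_mx x) -/A.
rewrite (expand_det_col _ p) mulr_suml; apply: eq_bigr => i _.
rewrite mxE eqxx; have -> : cofactor (\matrix_(i, j) monomial2 i (if j == p then z else x j)) i p
    = \adj A p i.
  rewrite mxE /cofactor; congr (_ * \det _).
  by apply/matrixP => r c; rewrite !mxE eq_sym (negPf (neq_lift p c)).
by rewrite adjE mxE; field.
Qed.

Lemma lagrange_interp_span N (x : 'I_N -> C * C) (B : 'M[C]_N) g z :
  B *m basis_mx x = 1%:M -> poly2_span N g -> lagrange_interp x g z = g z.
Proof.
move=> BA [c hc]; have AB := mulmx1C BA.
rewrite /lagrange_interp hc.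
under eq_bigr => p _ do rewrite (fundamental_lagrange_inv _ _ BA) hc mulr_suml.
rewrite exchange_big /=; apply: eq_bigr => s _.
under eq_bigr => p _ do rewrite mulr_sumr.
rewrite exchange_big /= (bigD1 s) //= [X in _ + X]big1 ?addr0 => [|i ne].
  transitivity (c s * monomial2 s z * (basis_mx x *m B) s s); last first.
    by rewrite AB mxE eqxx mulr1.
  by rewrite mxE mulr_sumr; apply: eq_bigr => j _; rewrite !mxE; ring.
transitivity (c s * monomial2 i z * (basis_mx x *m B) s i); last first.
  by rewrite AB mxE eq_sym (negPf ne) mulr0.
by rewrite mxE mulr_sumr; apply: eq_bigr => j _; rewrite !mxE; ring.
Qed.

(** Unisolvence without evaluating the determinant: [stair_interp] applied to the indicator of the
    [p]-th node lies in the span, and its coefficients form row [p] of a left inverse. *)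
Lemma basis_mx_inv N : exists B : 'M[C]_N, B *m basis_mx (nodes N) = 1%:M.
Proof.
pose v (p : 'I_N) k l : C := (graded_enum p == (k, l))%:R.
have [c hc] := choice (fun p => stair_interp_span N (v p)).
exists (\matrix_(p, i) c p i); apply/matrixP => p q; rewrite !mxE.
transitivity (stair_interp N (v p) (intertwining eta theta q)).
  by rewrite hc; apply: eq_bigr => i _; rewrite !mxE.
rewrite stair_interp_node -?graded_enum_ltn // /v -surjective_pairing.
by rewrite (inj_eq (bij_inj graded_enum_bij)).
Qed.

(** Lagrange interpolation reproduces both [P] and the staircase interpolant of [f - P], and the
    latter has the values of [f - P] at the nodes; so the interpolant of [f - P] is the staircase
    one, to which [stair_interp_le] applies. *)
Lemma interp_error N (f P : C * C -> C) E p : closed_bidisk R p ->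
  poly2_span N P -> (forall p, closed_bidisk R p -> cabs (f p - P p) <= E) ->
  cabs (f p - lagrange_interp (nodes N) f p) <= (1 + stair_norm N) * E.
Proof.
move=> hp hP hE'; have [B BA] := basis_mx_inv N.
pose v k l := f (eta k, theta l) - P (eta k, theta l).
have E1 : lagrange_interp (nodes N) f p - P p = stair_interp N v p.
  rewrite -(lagrange_interp_span _ BA hP) -(lagrange_interp_span _ BA (stair_interp_span N v)).
  rewrite /lagrange_interp -sumrB; apply: eq_bigr => q _; rewrite -mulrBl.
  by rewrite stair_interp_node -?graded_enum_ltn.
have -> : f p - lagrange_interp (nodes N) f p = f p - P p - stair_interp N v p.
  by rewrite -E1; ring.
apply: le_trans (cabsB _ _) _; rewrite mulrDl mul1r lerD ?hE' //.
apply: stair_interp_le => // k l; apply: hE'.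
by split; rewrite /= leja_disk_cabs.
Qed.

End Operator.
End Interpolation2.

(** * Continuity and differentiability on the bidisk *)

Section Topology.
Variable R : realType.
Local Notation C := (Cplx R).
Implicit Types (f g : C * C -> C) (p q : C * C).

Definition near2 (d : R) p q := cabs (q.1 - p.1) < d /\ cabs (q.2 - p.2) < d.

Lemma norm_lt_cabs (x : C) (d : R) : (`|x| < (d%:C)%C) = (cabs x < d).
Proof. exact: ltcR. Qed.

Lemma norm_le_cabs (x : C) (d : R) : (`|x| <= (d%:C)%C) = (cabs x <= d).
Proof. exact: lecR. Qed.

Lemma real_of_gt0 (e : C) : 0 < e -> exists2 d : R, 0 < d & e = (d%:C)%C.
Proof. by case: e => a b; rewrite ltcE /= => /andP[/eqP-> a0]; exists a. Qed.

Lemma nbhs2P p (P : set (C * C)) : nbhs p P <->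
  exists2 d : R, 0 < d & forall q, near2 d p q -> P q.
Proof.
split=> [/nbhs_ballP[e /= e0 hP]|[d d0 hP]]; last apply/nbhs_ballP.
  have [d d0 de] := real_of_gt0 e0; exists d => // q [h1 h2]; apply: hP.
  by split; rewrite -ball_normE /ball_ /= de norm_lt_cabs cabs_distC.
exists (d%:C)%C => /=; first by rewrite ltcR.
move=> q [h1 h2]; apply: hP; move: h1 h2; rewrite -!ball_normE /ball_ /=.
by rewrite !norm_lt_cabs /near2 !(cabs_distC q.1) !(cabs_distC q.2).
Qed.

Lemma nbhs_bidisk p : bidisk R p ->
  exists2 d : R, 0 < d & forall q, near2 d p q -> bidisk R q.
Proof.
case=> h1 h2; exists (Num.min (1 - cabs p.1) (1 - cabs p.2)).
  by rewrite lt_min !subr_gt0 h1.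
move=> q [q1 q2]; move: q1 q2; rewrite !lt_min => /andP[q1 _] /andP[_ q2].
have := cabsD (q.1 - p.1) p.1; have := cabsD (q.2 - p.2) p.2.
by rewrite !subrK; split; lra.
Qed.

Lemma within_continuousP (A : set (C * C)) g : {within A, continuous g} ->
  forall p, A p -> forall e : R, 0 < e -> exists2 d : R, 0 < d &
    forall q, A q -> near2 d p q -> cabs (g q - g p) < e.
Proof.
move=> /subspace_continuousP hg p Ap e e0.
have e0' : (0 : C) < (e%:C)%C by rewrite ltcR.
have := hg p Ap; move/cvgrPdist_lt => /(_ _ e0').
rewrite near_withinE => /nbhs2P[d d0 hd].
exists d => // q Aq /hd /(_ Aq) /=; rewrite norm_lt_cabs cabs_distC //.
Qed.

Lemma closed_disk_compact : compact (closed_disk R).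
Proof.
pose K : set (R * R) := [set x | x.1 * x.1 + x.2 * x.2 <= 1].
pose phi (x : R * R) : C := (x.1 +i* x.2)%C.
have -> : closed_disk R = phi @` K.
  apply/seteqP; split=> [[a b] /= h|z [[a b] /= h <-]].
    exists (a, b) => //; rewrite /K /= -!expr2.
    have := cabs_sqr ((a +i* b)%C : C); move=> /= <-.
    by rewrite exprn_ile1 ?cabs_ge0.
  change (is_true (cabs ((a +i* b)%C : C) <= 1)).
  rewrite -(@ler_pXn2r _ 2) ?nnegrE ?cabs_ge0 //.
  by rewrite cabs_sqr /= expr1n !expr2.
apply: continuous_compact.
  apply: continuous_subspaceT => x; apply/cvgrPdist_lt => e e0.
  have [d d0 ->] := real_of_gt0 e0.
  apply: (filterS _ (nbhsx_ballx x (d / 2) _)); last by rewrite divr_gt0.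
  move=> y [/=]; rewrite -!ball_normE /= => y1 y2; rewrite norm_lt_cabs.
  apply: le_lt_trans (cabs_le_ReIm _) _ => /=.
  by move: (x) (y) y1 y2 => [a b] [c e'] /= y1 y2; lra.
apply: (@subclosed_compact _ _ (`[(-1 : R), 1]%classic `*` `[(-1 : R), 1]%classic)).
- rewrite (_ : K = (fun x : R * R => x.1 * x.1 + x.2 * x.2) @^-1` [set x | x <= 1]) //.
  apply: preimage_closed; last exact: closed_le.
  have c1 : continuous (fst : R * R -> R) by move=> ?; exact: cvg_fst.
  have c2 : continuous (snd : R * R -> R) by move=> ?; exact: cvg_snd.
  move=> x _; exact: (cvgD (cvgM (c1 x) (c1 x)) (cvgM (c2 x) (c2 x))).
- by apply: compact_setX; exact: segment_compact.
move=> [a b]; rewrite /K /= !in_itv /= -!ler_norml -!expr2 => h.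
split; rewrite -(@ler_pXn2r _ 2) ?nnegrE // expr1n real_normK ?num_real //.
  by apply: le_trans h; rewrite lerDl sqr_ge0.
by apply: le_trans h; rewrite lerDr sqr_ge0.
Qed.

Lemma closed_bidisk_compact : compact (closed_bidisk R).
Proof. exact: (compact_setX closed_disk_compact closed_disk_compact). Qed.

Lemma within_unif_continuous (A : set (C * C)) g : compact A ->
  {within A, continuous g} -> forall e : R, 0 < e -> exists2 d : R, 0 < d &
    forall p q, A p -> A q -> near2 d p q -> cabs (g q - g p) <= e.
Proof.
move=> cA gC e e0; apply: contrapT => H.
have /choice[u hu] : forall n : nat, exists pq : (C * C) * (C * C),
    [/\ A pq.1, A pq.2, near2 n.+1%:R^-1 pq.1 pq.2 & e < cabs (g pq.2 - g pq.1)].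
  move=> n; apply: contrapT => Hn; apply: H; exists n.+1%:R^-1; first by rewrite invr_gt0.
  move=> p q Ap Aq pq; rewrite leNgt; apply/negP => h; apply: Hn.
  by exists (p, q).
have [c [Ac clc]] := cA ((fun n => (u n).1) @ \oo) _
  (ltac:(by exists 0%N => // n _; case: (hu n))).
have e20 : 0 < e / 2 by rewrite divr_gt0.
have [d d0 hd] := within_continuousP gC Ac e20.
have d20 : 0 < d / 2 by rewrite divr_gt0.
have [N hN] : exists N : nat, forall n, (N <= n)%N -> n.+1%:R^-1 < d / 2.
  exists (Num.truncn (d / 2)^-1) => n hn.
  rewrite invf_plt ?posrE //; apply: lt_le_trans (truncnS_gt _) _.
  by rewrite ler_nat ltnS.
have [_ [[n /= hn <-] hc]] := clc [set (u n).1 | n in [set n | (N <= n)%N]]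
   [set q | near2 (d / 2) c q] (ltac:(by exists N => // n hn; exists n))
   (ltac:(by apply/nbhs2P; exists (d / 2))).
have [Ap Aq [pq1 pq2]] := hu n.
have {}pq1 := lt_trans pq1 (hN n hn); have {}pq2 := lt_trans pq2 (hN n hn).
have h1 : cabs (g (u n).1 - g c) < e / 2.
  by apply: hd => //; case: hc => ? ?; split; lra.
have h2 : cabs (g (u n).2 - g c) < e / 2.
  apply: hd => //; case: hc => hc1 hc2; split => /=.
    by apply: le_lt_trans (cabs_triangle _ (u n).1.1 _) _; lra.
  by apply: le_lt_trans (cabs_triangle _ (u n).1.2 _) _; lra.
have := cabs_triangle (g (u n).2) (g c) (g (u n).1).
by rewrite (cabs_distC (g c)); lra.
Qed.

(** Differentiability with prescribed partial derivatives, stated with real radii and the sum norm;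
    the derivatives appear as explicit values so that they can be compared in [young]. *)
Definition cdiff f p (a b : C) := forall e : R, 0 < e -> exists2 d : R, 0 < d &
  forall q, near2 d p q ->
  cabs (f q - f p - (a * (q.1 - p.1) + b * (q.2 - p.2))) <=
  e * (cabs (q.1 - p.1) + cabs (q.2 - p.2)).

Lemma differentiable_cdiff f p : differentiable f p ->
  cdiff f p (partial1 f p) (partial2 f p).
Proof.
move=> df e e0; have e0' : (0 : C) < (e%:C)%C by rewrite ltcR.
have [_ /eqaddoP /(_ _ e0')] := (diff_locallyP p f).1 df.
move=> /nbhs2P[d d0 hd]; exists d => // q [q1 q2].
have {hd} := hd (q - p); rewrite /near2 /= !subr0 => /(_ (conj q1 q2)).
rewrite /cst /= -[_ (q - p)]/(f (q - p + p) - (f p + 'd f p (q - p))) subrK.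
have -> : 'd f p (q - p) = partial1 f p * (q.1 - p.1) + partial2 f p * (q.2 - p.2).
  rewrite /partial1 /partial2 !deriveE //.
  have -> : q - p = (q.1 - p.1) *: ((1, 0) : C * C) + (q.2 - p.2) *: ((0, 1) : C * C).
    by apply/pair_equal_spec; rewrite /= !scaler0 !addr0 add0r /GRing.scale /= !mulr1.
  by rewrite linearD !linearZ /= /GRing.scale /= ![_ * 'd f p _]mulrC.
rewrite opprD addrA => h; rewrite -norm_le_cabs; apply: le_trans h _.
rewrite rmorphM; apply: ler_wpM2l; first exact: ltW.
rewrite rmorphD prod_normE /= -!cabsE.
by rewrite /Order.max; case: ifP => _; rewrite ?lerDl ?lerDr normr_ge0.
Qed.

Lemma partial_eq_on f g p : bidisk R p -> (forall q, bidisk R q -> f q = g q) ->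
  partial1 f p = partial1 g p /\ partial2 f p = partial2 g p.
Proof.
move=> /nbhs_bidisk[d d0 hd] fg.
by split; apply: near_eq_derive; apply/nbhs2P; exists d => // q /hd /fg.
Qed.

Lemma cdiff_eq_on f g p a b : bidisk R p -> (forall q, bidisk R q -> f q = g q) ->
  cdiff f p a b -> cdiff g p a b.
Proof.
move=> hp fg df e e0; have [d d0 hd] := df e e0.
have [d' d0' hd'] := nbhs_bidisk hp; exists (Num.min d d').
  by rewrite lt_min d0.
move=> q [q1 q2]; move: q1 q2; rewrite !lt_min => /andP[? ?] /andP[? ?].
by rewrite -!fg //; [apply: hd | apply: hd'].
Qed.

(** The derivative of a curve by an explicit estimate, since the normed structure of [Cplx R] is
    over the field [Cplx R] itself. *)
Definition rderiv (F : R -> C) x (d : C) := forall e : R, 0 < e ->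
  exists2 dl : R, 0 < dl & forall h, `|h| < dl ->
  cabs (F (x + h) - F x - (h%:C)%C * d) <= e * `|h|.

Lemma is_derive_of_bound (F : R -> R) x (d : R) :
  (forall e : R, 0 < e -> exists2 dl : R, 0 < dl & forall h, `|h| < dl ->
     `|F (x + h) - F x - h * d| <= e * `|h|) -> is_derive x 1 F d.
Proof.
move=> hF; have cv : h^-1 *: (F (h *: 1 + x) - F x) @[h --> 0^'] --> d.
  apply/cvgrPdist_le => e e0; have [dl dl0 hdl] := hF e e0.
  near=> h; have h0 : h != 0 by near: h; exact: nbhs_dnbhs_neq.
  have hlt : `|h| < dl.
    near: h; apply: dnbhs0_lt => //.
  rewrite /GRing.scale /= mulr1 -(ler_pM2r (_ : 0 < `|h|)) ?normr_gt0 //.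
  rewrite -normrM mulrBl [h^-1 * _]mulrC mulfVK // [h + x]addrC distrC [d * h]mulrC.
  exact: hdl.
by apply: DeriveDef; [apply/cvg_ex; exists d | exact: cvg_lim].
Unshelve. all: by end_near. Qed.

(** The mean value theorem is applied to the real part of the conjugate of [w] times [F], with
    [w = F b - F a]: its increment is [cabs w ^ 2], and one factor [cabs w] is then divided out. *)
Lemma mean_value_ineq (F F' : R -> C) (a b B : R) : a <= b ->
  (forall x, a <= x <= b -> rderiv F x (F' x)) ->
  (forall x, a <= x <= b -> cabs (F' x) <= B) ->
  cabs (F b - F a) <= B * (b - a).
Proof.
rewrite le_eqVlt => /predU1P[<- _ _|ltab dF hB].
  by rewrite !subrr cabs0 mulr0.
set w := F b - F a; pose phi x := complex.Re ((w^*)%C * F x).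
have cw : cabs (w^*%C : C) = cabs w.
  by case: (w) => u v; rewrite /cabs /= sqrrN.
have dphi x : a <= x <= b -> is_derive x 1 phi (complex.Re ((w^*)%C * F' x)).
  move=> hx; apply: is_derive_of_bound => e e0.
  have w0 : 0 < cabs w + 1 by rewrite ltr_wpDl ?cabs_ge0.
  have [dl dl0 hdl] := dF x hx (e / (cabs w + 1)) (divr_gt0 e0 w0).
  exists dl => // h /hdl hh; rewrite /phi.
  have -> : complex.Re (w^*%C * F (x + h)) - complex.Re (w^*%C * F x)
      - h * complex.Re (w^*%C * F' x) =
     complex.Re ((w^*%C : C) * (F (x + h) - F x - (h%:C)%C * F' x)).
    move: (w) (F (x + h)) (F x) (F' x) => [? ?] [? ?] [? ?] [? ?] /=; ring.
  apply: le_trans (Re_le_cabs _) _; rewrite cabsM cw.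
  apply: le_trans (ler_wpM2l (cabs_ge0 _) hh) _.
  rewrite mulrA ler_wpM2r // mulrCA; apply: ler_piMr; first exact: ltW.
  by rewrite ler_pdivrMr // mul1r lerDl.
have cphi : {within `[a, b], continuous phi}.
  apply: derivable_within_continuous => x; rewrite in_itv /= => /dphi.
  by case.
have [c cab E] := MVT ltab (fun x hx => dphi x (ltac:(by rewrite in_itv in hx; case/andP: hx => /ltW-> /ltW->))) cphi.
have {}cab : a <= c <= b by move: cab; rewrite in_itv => /andP[/ltW-> /ltW->].
have E2 : phi b - phi a = cabs w ^+ 2.
  rewrite cabs_sqr /phi /w; move: (F a) (F b) => [? ?] [? ?] /=; ring.
have [->|w0] := eqVneq (cabs w) 0.
  by rewrite mulr_ge0 ?subr_ge0 ?(ltW ltab) //; apply: le_trans (hB _ cab); exact: cabs_ge0.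
have {}w0 : 0 < cabs w by rewrite lt_neqAle eq_sym w0 cabs_ge0.
rewrite -(ler_pM2l w0) -expr2 -E2 E mulrA ler_wpM2r ?subr_ge0 ?(ltW ltab) //.
apply: le_trans (ler_norm _) _; apply: le_trans (Re_le_cabs _) _.
by rewrite cabsM cw ler_wpM2l ?cabs_ge0 // hB.
Qed.

Lemma rderiv_chain f p a b (g1 g2 : R -> C) x d1 d2 : p = (g1 x, g2 x) ->
  cdiff f p a b -> rderiv g1 x d1 -> rderiv g2 x d2 ->
  rderiv (fun t => f (g1 t, g2 t)) x (a * d1 + b * d2).
Proof.
move=> -> df dg1 dg2 e e0.
(* Since [e1 <= 1], the increments of [g1] and [g2] add up to at most [M * |h|]. Half of [e] pays
   for the remainder of [f] on such increments, the other half for the remainders of [g1] and [g2]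
   weighted by [A]. *)
pose M := cabs d1 + cabs d2 + 2; have M0 : 0 < M.
  by rewrite /M; have := cabs_ge0 d1; have := cabs_ge0 d2; lra.
have [d d0 hd] := df (e / (2 * M)) (ltac:(by rewrite divr_gt0 // mulr_gt0)).
pose A := cabs a + cabs b + 1; have A0 : 0 < A.
  by rewrite /A; have := cabs_ge0 a; have := cabs_ge0 b; lra.
pose e1 := Num.min 1 (e / (2 * A)); have e10 : 0 < e1.
  by rewrite lt_min ltr01 divr_gt0 // mulr_gt0.
have [l1 l10 hl1] := dg1 e1 e10; have [l2 l20 hl2] := dg2 e1 e10.
exists (Num.min (Num.min l1 l2) (d / M)).
  by rewrite !lt_min l10 l20 divr_gt0.
move=> h; rewrite !lt_min -andbA => /and3P[/hl1 h1 /hl2 h2 hM].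
have n0 : 0 <= `|h| by [].
have e1le : e1 <= 1 by rewrite ge_min lexx.
have e1le' : e1 * A <= e / 2.
  apply: le_trans (_ : e / (2 * A) * A <= _).
    by apply: ler_wpM2r; [exact: ltW | rewrite ge_min lexx orbT].
  by rewrite invfM mulrA mulfVK // gt_eqF.
have incr (y dd : C) : cabs (y - (h%:C)%C * dd) <= e1 * `|h| ->
    cabs y <= (cabs dd + 1) * `|h|.
  move=> hg; have := cabsD (y - (h%:C)%C * dd) ((h%:C)%C * dd).
  rewrite subrK cabsM cabs_real; nra.
have i1 := incr _ _ h1; have i2 := incr _ _ h2.
have hM' : M * `|h| < d by rewrite mulrC -ltr_pdivlMr.
have nr : near2 d (g1 x, g2 x) (g1 (x + h), g2 (x + h)).
  have c1 := cabs_ge0 d1; have c2 := cabs_ge0 d2.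
  by split=> /=; apply: le_lt_trans hM'; [apply: le_trans i1 _|apply: le_trans i2 _];
    rewrite ler_wpM2r // /M; lra.
have := hd _ nr => /=.
set X := f _ - f _; set u := g1 _ - g1 _; set v := g2 _ - g2 _ => hX.
have -> : X - (h%:C)%C * (a * d1 + b * d2) =
  (X - (a * u + b * v)) + (a * (u - (h%:C)%C * d1) + b * (v - (h%:C)%C * d2)) by ring.
apply: le_trans (cabsD _ _) _; rewrite [e]splitr mulrDl lerD //.
  apply: le_trans hX _; apply: le_trans (_ : e / (2 * M) * (M * `|h|) <= _).
    apply: ler_wpM2l; first by apply: ltW; rewrite divr_gt0 // mulr_gt0.
    by rewrite /M; lra.
  by rewrite mulrA invfM mulrA mulfVK // gt_eqF.
apply: le_trans (cabsD _ _) _; rewrite !cabsM.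
apply: le_trans (_ : e1 * A * `|h| <= _); last by rewrite ler_wpM2r.
have := cabs_ge0 a; have := cabs_ge0 b; rewrite /A -/u -/v in h1 h2 *.
have := ltW e10; nra.
Qed.

End Topology.

(** * Roots of unity *)

Section RootsOfUnity.
Variable R : realType.
Local Notation C := (Cplx R).

Lemma bound_of_is_derive (F : R -> R) (x d : R) : is_derive x 1 F d ->
  forall e : R, 0 < e -> exists2 dl : R, 0 < dl & forall h, `|h| < dl ->
     `|F (x + h) - F x - h * d| <= e * `|h|.
Proof.
move=> dF e e0; have [/derivable1_diffP df dE] := dF.
have [_ /eqaddoP /(_ _ e0)] := (diff_locallyP x F).1 df.
move=> /nbhs_ballP[dl /= dl0 hd]; exists dl => // h hh.
have {hd} := hd h; rewrite -ball_normE /= sub0r normrN => /(_ hh).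
rewrite /cst /= -[_ h]/(F (h + x) - (F x + 'd F x h)) addrC.
have -> : 'd F x h = h * d.
  by rewrite -{1}[h]mulr1 -[h * 1]/(h *: 1) linearZ /= -dE -deriveE.
by rewrite [h + x]addrC addrC opprD addrA.
Qed.

Lemma rderiv_expi x : rderiv (@expi R) x ('i%C * expi x).
Proof.
move=> e e0; have e20 : 0 < e / 2 by rewrite divr_gt0.
have [d1 d10 h1] := bound_of_is_derive (is_derive_cos x) e20.
have [d2 d20 h2] := bound_of_is_derive (is_derive_sin x) e20.
exists (Num.min d1 d2) => [|h]; first by rewrite lt_min d10.
rewrite lt_min => /andP[/h1 {}h1 /h2 {}h2].
apply: le_trans (cabs_le_ReIm _) _ => /=.
rewrite [e]splitr mulrDl; apply: lerD; [move: h1|move: h2];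
  congr (`|_| <= _); ring.
Qed.

Lemma cabs_expi_sub1 (h : R) : cabs (expi h - 1) <= `|h|.
Proof.
wlog h0 : h / 0 <= h.
  move=> H; case: (leP 0 h) => h0; first exact: H.
  have -> : expi h - 1 = - (expi h * (expi (- h) - 1)).
    by rewrite mulrBr -expiD subrr expi0 mulr1 opprB.
  by rewrite cabsN cabsM cabs_expi mul1r -normrN; apply: H; lra.
have := @mean_value_ineq R (@expi R) _ 0 h 1 h0 (fun x _ => rderiv_expi x).
rewrite expi0 subr0 mul1r ger0_norm //; apply => x _.
by rewrite cabsM cabs_expi mulr1 /cabs /= expr0n expr1n add0r sqrtr1.
Qed.

Lemma cabs_expi_sub1_half (h : R) : cabs (expi h - 1) ^+ 2 = 4 * sin (h / 2) ^+ 2.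
Proof.
have hE : h = (h / 2) *+ 2 by rewrite -mulr_natr divfK.
rewrite cabs_sqr /= {1 2}hE cos_mulr2n sin_mulr2n.
have := cos2Dsin2 (h / 2); set c := cos _; set s := sin _ => E.
have -> : c ^+ 2 = 1 - s ^+ 2 by rewrite -E; ring.
have -> : (c * s *+ 2 - 0) ^+ 2 = 4 * c ^+ 2 * s ^+ 2 by ring.
have -> : c ^+ 2 = 1 - s ^+ 2 by rewrite -E; ring.
ring.
Qed.

(** Here [sin x = x * cos c] with [c <= 1], and [2 - 2 * cos c = cabs (expi c - 1) ^ 2 <= 1]. *)
Lemma sin_ge_half (x : R) : 0 <= x <= 1 -> x / 2 <= sin x.
Proof.
move=> /andP[x0 x1].
have [c + ] := @MVT_segment R sin cos 0 x x0 (fun y _ => is_derive_sin y)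
  (ltac:(apply: continuous_subspaceT; exact: continuous_sin)).
rewrite in_itv /= => /andP[c0 c1]; rewrite sin0 !subr0 => ->.
rewrite mulrC ler_wpM2r //.
have := cabs_expi_sub1 c; rewrite ger0_norm // => hc.
have E : cabs (expi c - 1 : C) ^+ 2 = 2 - 2 * cos c.
  have /= -> := cabs_sqr (expi c - 1 : C); rewrite subr0.
  by have := cos2Dsin2 c; lra.
by have := cabs_ge0 (expi c - 1 : C); nra.
Qed.

Lemma expi_surj (z : C) : cabs z = 1 ->
  exists2 h : R, expi h = z & `|h| <= 4 * cabs (z - 1).
Proof.
case: z => a b hz; have := cabs_sqr ((a +i* b)%C : C); rewrite hz expr1n /= => E.
have ha : -1 <= a <= 1.
  by have := Re_le_cabs ((a +i* b)%C : C); rewrite hz ler_norml.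
pose t := acos a; have ct : cos t = a by rewrite acosK // in_itv.
have st : sin t = `|b|.
  rewrite sin_acos //; have -> : 1 - a ^+ 2 = b ^+ 2 by rewrite E; ring.
  exact: sqrtr_sqr.
have t0 : 0 <= t by exact: acos_ge0.
have tpi : t <= pi by exact: acos_lepi.
have [h hE ht] : exists2 h, expi h = (a +i* b)%C :> C & `|h| = t.
  case: (leP 0 b) => hb.
    by exists t; rewrite ?ger0_norm // /expi ct st ger0_norm.
  by exists (- t); rewrite ?normrN ?ger0_norm // /expi cosN sinN ct st ltr0_norm ?opprK.
exists h => //; suff : t <= 4 * cabs (expi h - 1 : C) by rewrite hE ht.
have cE : cabs (expi h - 1) ^+ 2 = 2 - 2 * a.
  rewrite hE cabs_sqr /= subr0; transitivity (a ^+ 2 + b ^+ 2 - 2 * a + 1); first by ring.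
  by rewrite -E; ring.
have := cabs_ge0 (expi h - 1 : C); have p2 := @pihalf_lt2 R; have pg := @pi_gt0 R.
(* For [t <= 2] the chord [2 sin (t / 2)] is at least [t / 2]. Otherwise [cos t <= 0], so the chord
   is at least [sqrt 2], while [t <= pi < 4]. *)
have [t2|t2] := leP t 2.
  have : cabs (expi h - 1) ^+ 2 = 4 * sin (t / 2) ^+ 2.
    rewrite cabs_expi_sub1_half -ht; congr (4 * _).
    case: (ger0P h) => _ //; by rewrite mulNr sinN sqrrN.
  have /sin_ge_half : 0 <= t / 2 <= 1 by apply/andP; split; lra.
  move=> *; nra.
have : 0 <= sin (t - pi / 2) by apply: sin_ge0_pi; apply/andP; split; lra.
have -> : sin (t - pi / 2) = - a.
  by rewrite -ct -{2}[t](subrK (pi / 2)) cosDpihalf opprK.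
move=> *; nra.
Qed.

Definition uroot M : C := expi (2 * pi / M%:R).

Lemma cabs_uroot M : cabs (uroot M) = 1.
Proof. exact: cabs_expi. Qed.

Lemma uroot_neq0 M : uroot M != 0.
Proof. by rewrite -cabs_gt0 cabs_uroot. Qed.

Lemma urootM M : (0 < M)%N -> uroot M ^+ M = 1.
Proof.
move=> M0; rewrite /uroot expiX mulrCA divff ?pnatr_eq0 -?lt0n // mulr1.
by rewrite mulrC -[2]/(2%:R) mulr_natr /expi cos2pi sin2pi.
Qed.

Lemma uroot_neq1 M j : (0 < j < M)%N -> uroot M ^+ j != 1.
Proof.
move=> /andP[j0 jM]; have M0 : 0 < M%:R :> R by rewrite ltr0n; lia.
rewrite /uroot expiX -subr_eq0 -cabs_eq0 -sqrf_eq0 cabs_expi_sub1_half.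
rewrite mulf_neq0 ?pnatr_eq0 // sqrf_eq0 gt_eqF // sin_gt0_pi //.
have -> : j%:R * (2 * pi / M%:R) / 2 = pi * (j%:R / M%:R) :> R by field; rewrite gt_eqF.
apply/andP; split; first by rewrite mulr_gt0 ?pi_gt0 // divr_gt0 // ltr0n.
by rewrite gtr_pMr ?pi_gt0 // ltr_pdivrMr // mul1r ltr_nat.
Qed.

Lemma uroot_sub1_le M : (0 < M)%N -> cabs (uroot M - 1) <= 8 / M%:R.
Proof.
move=> M0; apply: le_trans (cabs_expi_sub1 _) _.
rewrite ger0_norm ?divr_ge0 ?mulr_ge0 ?pi_ge0 //.
rewrite ler_wpM2r ?invr_ge0 //; have := @pihalf_lt2 R; lra.
Qed.

Lemma uroot_eq1 M j : (0 < M)%N -> (uroot M ^+ j == 1) = (M %| j)%N.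
Proof.
move=> M0; rewrite {1}(divn_eq j M) exprD mulnC exprM urootM // expr1n mul1r.
rewrite /dvdn; case: (posnP (j %% M)) => [->|h]; first by rewrite expr0 eqxx.
by rewrite (negPf (uroot_neq1 _)) ?h ?ltn_pmod //; case: (j %% M)%N h.
Qed.

Lemma sum_unity_root (x : C) M : x ^+ M = 1 -> x != 1 -> \sum_(s < M) x ^+ s = 0.
Proof.
move=> xM x1; have := subrX1 x M; rewrite xM subrr => /esym/eqP.
by rewrite mulf_eq0 subr_eq0 (negPf x1) => /eqP.
Qed.

Lemma uroot_sum M j : (0 < M)%N ->
  \sum_(s < M) (uroot M ^+ s) ^+ j = if (M %| j)%N then M%:R else 0.
Proof.
move=> M0; under eq_bigr => s _ do rewrite -exprM mulnC exprM.
case: ifP => hj.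
  have /eqP -> : uroot M ^+ j == 1 by rewrite uroot_eq1.
  by under eq_bigr => s _ do rewrite expr1n; rewrite sumr_const card_ord.
apply: sum_unity_root; first by rewrite -exprM mulnC exprM urootM // expr1n.
by rewrite uroot_eq1 // hj.
Qed.

Lemma uroot_orth M a b : (a < M)%N -> (b < M)%N ->
  \sum_(s < M) (uroot M ^+ s) ^+ a * (uroot M ^+ s) ^- b = (a == b)%:R * M%:R.
Proof.
move=> aM bM; have M0 : (0 < M)%N by exact: leq_ltn_trans bM.
have E (s : 'I_M) : (uroot M ^+ s) ^- b = (uroot M ^+ s) ^+ (M - b).
  apply: (mulIf (expf_neq0 b (expf_neq0 s (uroot_neq0 M)))).
  rewrite mulVf ?expf_neq0 ?uroot_neq0 // -exprD subnK ?(ltnW bM) //.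
  by rewrite -exprM mulnC exprM urootM // expr1n.
under eq_bigr => s _ do rewrite E -exprD.
rewrite uroot_sum //; case: eqVneq => [->|ne].
  by rewrite subnKC ?(ltnW bM) // dvdnn mul1r.
rewrite mul0r; case: dvdnP => // -[k kE].
case: k kE => [|[|k]] kE; move/eqP: ne; lia.
Qed.

(** [M] times the fundamental Lagrange polynomial of the [s]-th root of unity; by [uroot_kernelM] it
    is a truncation of the Cauchy kernel [w / (w - z)]. *)
Definition uroot_kernel M z s : C := \sum_(a < M) z ^+ a * (uroot M ^+ s) ^- a.

Lemma uroot_kernelM M z s : (0 < M)%N ->
  uroot_kernel M z s * (uroot M ^+ s - z) = uroot M ^+ s * (1 - z ^+ M).
Proof.
move=> M0; set w := uroot M ^+ s; have w0 : w != 0 by rewrite expf_neq0 ?uroot_neq0.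
have wM : w ^+ M = 1 by rewrite -exprM mulnC exprM urootM // expr1n.
have -> : uroot_kernel M z s = \sum_(a < M) (z / w) ^+ a.
  by apply: eq_bigr => a _; rewrite exprMn exprVn.
have -> : z ^+ M = (z / w) ^+ M by rewrite exprMn exprVn wM invr1 mulr1.
rewrite -[1 - _]opprB subrX1; set S := \sum_(_ < _) _.
have -> : w - z = - (w * (z / w - 1)) by rewrite mulrBr mulrCA divff // !mulr1 opprB.
ring.
Qed.

Lemma uroot_kernel_le M z s : cabs z <= 1 -> cabs (uroot_kernel M z s) <= M%:R.
Proof.
move=> hz; rewrite -[leRHS]mulr1; apply: cabs_sum_ord => a.
by rewrite cabsM cabsV !cabsX cabs_uroot !expr1n invr1 mulr1 exprn_ile1 ?cabs_ge0.
Qed.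

Lemma uroot_kernel_mono M z j : (j < M)%N ->
  \sum_(s < M) (uroot M ^+ s) ^+ j * uroot_kernel M z s = M%:R * z ^+ j.
Proof.
move=> jM; under eq_bigr => s _ do rewrite mulr_sumr.
rewrite exchange_big /= (bigD1 (Ordinal jM)) //= [X in _ + X]big1 ?addr0; last first.
  move=> a ne; transitivity (z ^+ a * \sum_(s < M) (uroot M ^+ s) ^+ j * (uroot M ^+ s) ^- a).
    by rewrite mulr_sumr; apply: eq_bigr => s _; rewrite mulrCA.
  by rewrite uroot_orth //; move: ne; rewrite -val_eqE eq_sym /= => /negPf ->; rewrite mul0r mulr0.
transitivity (z ^+ j * \sum_(s < M) (uroot M ^+ s) ^+ j * (uroot M ^+ s) ^- j).
  by rewrite mulr_sumr; apply: eq_bigr => s _; rewrite mulrCA.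
by rewrite uroot_orth // eqxx mul1r mulrC.
Qed.

Definition uroot_interp M (F : C -> C) z : C :=
  M%:R^-1 * \sum_(s < M) F (uroot M ^+ s) * uroot_kernel M z s.

Lemma uroot_interp_poly M (G : {poly C}) z : (size G <= M)%N -> (0 < M)%N ->
  uroot_interp M (horner G) z = G.[z].
Proof.
move=> sG M0; have Mn0 : M%:R != 0 :> C by rewrite pnatr_eq0 -lt0n.
apply: (mulfI Mn0); rewrite /uroot_interp mulVKf //.
under eq_bigr => s _ do rewrite (horner_coef_wide _ sG) mulr_suml.
rewrite exchange_big /= (horner_coef_wide _ sG) mulr_sumr; apply: eq_bigr => a _.
transitivity (G`_a * \sum_(s < M) (uroot M ^+ s) ^+ a * uroot_kernel M z s).
  by rewrite mulr_sumr; apply: eq_bigr => s _; rewrite mulrA.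
by rewrite uroot_kernel_mono // mulrCA.
Qed.

Lemma uroot_interp_le M (F : C -> C) z E : (0 < M)%N -> cabs z <= 1 ->
  (forall s, cabs (F (uroot M ^+ s)) <= E) ->
  cabs (uroot_interp M F z) <= M%:R * E.
Proof.
move=> M0 hz hF; have Mn0 : 0 < M%:R :> R by rewrite ltr0n.
rewrite /uroot_interp cabsM cabsV cabs_nat mulrC ler_pdivrMr //.
rewrite mulrAC -mulrA; apply: cabs_sum_ord => s; rewrite cabsM mulrC.
by apply: ler_pM; rewrite ?cabs_ge0 ?uroot_kernel_le.
Qed.

Lemma bernoulli_ge (d : R) k : 0 <= d -> 1 + k%:R * d <= (1 + d) ^+ k.
Proof.
move=> d0; elim: k => [|k IH]; first by rewrite mul0r addr0 expr0.
have k0 := ler0n R k; rewrite exprSr -natr1.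
by apply: le_trans (_ : (1 + k%:R * d) * (1 + d) <= _); [nra | rewrite ler_wpM2r //; lra].
Qed.

(** If [x = (1 + dl) E] with [dl > 0], Bernoulli's inequality gives
    [(1 + dl) ^ (2 k) >= (1 + k dl) ^ 2], which is quadratic in [k] and outgrows the linear
    factor. *)
Lemma le_of_pow_le (x E : R) d : 0 <= x -> 0 <= E ->
  (forall k, x ^+ k <= (k * d).+1%:R * E ^+ k) -> x <= E.
Proof.
move=> x0 E0 hx; rewrite leNgt; apply/negP => ltEx.
move: E0; rewrite le_eqVlt => /predU1P[E0|E0].
  by have := hx 1%N; rewrite -E0 !expr1 mulr0; lra.
pose dl := x / E - 1; have dl0 : 0 < dl.
  by rewrite /dl subr_gt0 ltr_pdivlMr // mul1r.
have xE : x = E * (1 + dl) by rewrite /dl; field; rewrite gt_eqF.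
pose k := (Num.truncn ((2 * d%:R + 1) / dl ^+ 2)).+1.
have kbig : 2 * d%:R + 1 < k%:R * dl ^+ 2.
  by rewrite -ltr_pdivrMr ?exprn_gt0 // truncnS_gt.
have k1 : 1 <= k%:R :> R by rewrite ler1n.
have := hx (k * 2)%N; rewrite xE exprMn mulrC ler_pM2r ?exprn_gt0 // exprM.
rewrite -natr1 !natrM.
have := bernoulli_ge k (ltW dl0); set y := (1 + dl) ^+ k => hy.
have k0 : 0 < k%:R :> R by lra.
have kdl : 0 <= k%:R * dl by rewrite mulr_ge0 // ltW.
have hy2 : (1 + k%:R * dl) ^+ 2 <= y ^+ 2 by rewrite lerXn2r ?nnegrE; lra.
by move: kbig; rewrite -(ltr_pM2l k0); lra.
Qed.

(* Interpolation at roots of unity loses a factor of the order of the degree;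
   applying it to the powers of [G] removes this factor. *)
Lemma poly_max_principle (G : {poly C}) E z : cabs z <= 1 ->
  (forall w, cabs w = 1 -> cabs G.[w] <= E) -> cabs G.[z] <= E.
Proof.
move=> hz hG; have E0 : 0 <= E by apply: le_trans (hG 1 (cabs1 R)); exact: cabs_ge0.
apply: (@le_of_pow_le _ _ (size G)); rewrite ?cabs_ge0 // => k.
rewrite -cabsX -horner_exp -(@uroot_interp_poly (k * size G).+1) //; last first.
  apply: leq_trans (size_poly_exp_leq _ _) _; rewrite ltnS mulnC leq_mul //.
  exact: leq_pred.
apply: uroot_interp_le => // s; rewrite horner_exp cabsX.
by rewrite lerXn2r ?nnegrE ?cabs_ge0 // hG // cabsX cabs_uroot expr1n.
Qed.

End RootsOfUnity.

(** * Polynomial density and the Jackson kernel *)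

Section Approximation.
Variable R : realType.
Local Notation C := (Cplx R).

Section RootInterpolationError.
Variables (F F' : C -> C) (B : R) (M : nat) (z : C).
Hypothesis M1 : (1 < M)%N.
Hypothesis hz : cabs z <= 1.
Hypothesis taylor : forall a b : C, cabs a <= 1 -> cabs b <= 1 ->
  cabs (F b - F a - F' a * (b - a)) <= B * cabs (b - a) ^+ 2.

Local Notation w s := (uroot R M ^+ s).
Local Notation path t s := (z + (t%:C)%C * (w s - z) : C).

Let B0 : 0 <= B.
Proof.
have := taylor (a := 0) (b := 1); rewrite cabs0 subr0 cabs1 => /(_ ler01 (lexx _)).
by rewrite expr1n !mulr1 => /(le_trans (cabs_ge0 _)).
Qed.

Let w1 s : cabs (w s) = 1.
Proof. by rewrite cabsX cabs_uroot expr1n. Qed.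

Let path_le1 (t : R) s : 0 <= t <= 1 -> cabs (path t s) <= 1.
Proof.
move=> /andP[t0 t1]; have -> : path t s = ((1 - t)%:C)%C * z + (t%:C)%C * w s.
  by rewrite rmorphB rmorph1; ring.
apply: le_trans (cabsD _ _) _; rewrite !cabsM !cabs_real w1 !ger0_norm ?subr_ge0 //.
have : (1 - t) * cabs z <= (1 - t) * 1 by rewrite ler_wpM2l // subr_ge0.
lra.
Qed.

(* The sum discretizes the integral of [F'(z + t (w - z)) dw] over the unit
   circle, which vanishes because the integrand is an exact derivative. *)
Let sum_derivative_le (t : R) : 0 <= t <= 1 ->
  cabs (\sum_(s < M) F' (path t s) * w s) <= M%:R * (B * cabs (uroot R M - 1)).
Proof.
move=> ht; have /andP[t0 t1] := ht; have M0 : (0 < M)%N by lia.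
have u0 : 0 <= cabs (uroot R M - 1) by exact: cabs_ge0.
have [tz|tz] := eqVneq t 0.
  suff -> : \sum_(s < M) F' (path t s) * w s = 0.
    by rewrite cabs0; apply: mulr_ge0 => //; exact: mulr_ge0.
  rewrite tz; under eq_bigr => s _ do rewrite rmorph0 mul0r addr0 -[w s]expr1.
  rewrite -mulr_sumr uroot_sum // ifF ?mulr0 //.
  by apply/negbTE; rewrite dvdn1; lia.
have {}tz : 0 < t by rewrite lt_neqAle eq_sym tz.
have tel : \sum_(s < M) (F (path t s.+1) - F (path t s)) = 0.
  rewrite -(big_mkord xpredT (fun s => F (path t s.+1) - F (path t s))).
  by rewrite telescope_sumr // urootM // expr0 subrr.
have u1 : 0 < cabs (uroot R M - 1).
  by rewrite cabs_gt0 subr_eq0 -[uroot R M]expr1 uroot_neq1.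
have step s : cabs (F (path t s.+1) - F (path t s) -
     F' (path t s) * w s * ((t%:C)%C * (uroot R M - 1))) <=
     B * (t * cabs (uroot R M - 1)) ^+ 2.
  have inc : path t s.+1 - path t s = (t%:C)%C * w s * (uroot R M - 1).
    by rewrite exprSr; ring.
  have -> : F' (path t s) * w s * ((t%:C)%C * (uroot R M - 1)) =
      F' (path t s) * (path t s.+1 - path t s) by rewrite inc; ring.
  apply: le_trans (taylor (path_le1 s ht) (path_le1 s.+1 ht)) _.
  by rewrite inc !cabsM w1 cabs_real (ger0_norm t0) mulr1.
rewrite -(ler_pM2r (mulr_gt0 tz u1)).
have -> : cabs (\sum_(s < M) F' (path t s) * w s) * (t * cabs (uroot R M - 1)) =
   cabs (\sum_(s < M) (F (path t s.+1) - F (path t s) -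
     F' (path t s) * w s * ((t%:C)%C * (uroot R M - 1)))).
  rewrite sumrB tel sub0r cabsN -mulr_suml !cabsM cabs_real (ger0_norm t0) //.
apply: le_trans (cabs_sum_ord step) _; rewrite -!mulrA ler_wpM2l // ler_wpM2l //.
rewrite expr2; set u := cabs _ in u0 u1 *; nra.
Qed.

(** A homotopy proof of Cauchy's formula: [Psi 0] is [F z] and [Psi 1] is the interpolant at [z]. In
    the variation of [Psi] the factor [w - z] meets the kernel and becomes [w (1 - z ^ M)] by
    [uroot_kernelM], which leaves the sum bounded by [sum_derivative_le]. *)
Let Psi (t : R) : C := M%:R^-1 * \sum_(s < M) F (path t s) * uroot_kernel M z s.

Let Psi_step (t h : R) : 0 <= t -> 0 <= h -> t + h <= 1 ->
  cabs (Psi (t + h) - Psi t) <= h * (2 * B * cabs (uroot R M - 1)) + 4 * B * M%:R * h ^+ 2.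
Proof.
move=> t0 h0 th; have M0 : 0 < M%:R :> R by rewrite ltr0n; lia.
have ht : 0 <= t <= 1 by apply/andP; split; lra.
have ht' : 0 <= t + h <= 1 by apply/andP; split; lra.
pose E s := F (path (t + h) s) - F (path t s) - F' (path t s) * ((h%:C)%C * (w s - z)).
have -> : Psi (t + h) - Psi t = M%:R^-1 * (\sum_(s < M) E s * uroot_kernel M z s +
    (h%:C)%C * (1 - z ^+ M) * \sum_(s < M) F' (path t s) * w s).
  rewrite /Psi -mulrBr -sumrB; congr (_ * _); rewrite mulr_sumr -big_split /=.
  apply: eq_bigr => s _; have := uroot_kernelM z s (ltnW M1); rewrite /E.
  set k := uroot_kernel _ _ _ => hk.
  transitivity ((F (path (t + h) s) - F (path t s) - F' (path t s) * ((h%:C)%C * (w s - z))) * k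
     + (h%:C)%C * F' (path t s) * (k * (w s - z))); first by ring.
  by rewrite hk; ring.
rewrite cabsM cabsV cabs_nat mulrC ler_pdivrMr //.
apply: le_trans (cabsD _ _) _; rewrite addrC mulrDl; apply: lerD.
  rewrite !cabsM cabs_real ger0_norm // -!mulrA ler_wpM2l //.
  have z2 : cabs (1 - z ^+ M) <= 2 by apply: cabs_sub_le2; rewrite ?cabs1 ?cabs_le1X.
  apply: le_trans (_ : 2 * (M%:R * (B * cabs (uroot R M - 1))) <= _).
    by apply: ler_pM; rewrite ?cabs_ge0 // sum_derivative_le.
  by rewrite [M%:R * _]mulrC -!mulrA.
have hE s : cabs (E s * uroot_kernel M z s) <= B * (h ^+ 2 * 4) * M%:R.
  rewrite cabsM; apply: ler_pM; rewrite ?cabs_ge0 ?uroot_kernel_le //.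
  have := taylor (path_le1 s ht) (path_le1 s ht').
  have -> : path (t + h) s - path t s = (h%:C)%C * (w s - z) by rewrite rmorphD; ring.
  move/le_trans; apply; rewrite ler_wpM2l // cabsM cabs_real exprMn real_normK ?num_real //.
  rewrite ler_wpM2l ?sqr_ge0 //; have : cabs (w s - z) <= 2 by rewrite cabs_sub_le2 // w1.
  have := cabs_ge0 (w s - z); nra.
apply: le_trans (cabs_sum_ord hE) _; rewrite le_eqVlt; apply/orP; left; apply/eqP; ring.
Qed.

Lemma uroot_interp_err : cabs (uroot_interp M F z - F z) <= 20 * B / M%:R.
Proof.
have M0 : (0 < M)%N by lia. have M0' : 0 < M%:R :> R by rewrite ltr0n.
have Mn0 : M%:R != 0 :> C by rewrite pnatr_eq0 -lt0n.
(* Over [q] steps the quadratic errors add up to [4 B M / q]; [q = M ^ 2] makes this [4 B / M], next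
   to at most [16 B / M] from the linear terms. *)
pose q := (M * M)%N; have q0 : 0 < q%:R :> R by rewrite ltr0n muln_gt0 M0.
have P1 : Psi 1 = uroot_interp M F z.
  rewrite /Psi /uroot_interp; congr (_ * _); apply: eq_bigr => s _.
  by congr (F _ * _); rewrite rmorph1; ring.
have P0 : Psi 0 = F z.
  rewrite /Psi; under eq_bigr => s _ do rewrite rmorph0 mul0r addr0.
  rewrite -mulr_sumr.
  have := @uroot_kernel_mono R M z 0 M0; under eq_bigr => s _ do rewrite expr0 mul1r.
  by move=> ->; rewrite expr0 mulr1 mulrCA mulVf // mulr1.
have := telescope_sumr (fun i => Psi (i%:R / q%:R)) (leq0n q).
rewrite mul0r divff ?gt_eqF // P1 P0 => <-; rewrite big_mkord.
apply: le_trans (cabs_sum_ord (a := q%:R^-1 * (2 * B * cabs (uroot R M - 1)) + 4 * B * M%:R * q%:R^-1 ^+ 2) _) _.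
  move=> i; rewrite -natr1 mulrDl mul1r; apply: Psi_step.
  - by rewrite divr_ge0.
  - by rewrite invr_ge0.
  by rewrite -[X in _ + X]mul1r -mulrDl ler_pdivrMr // mul1r natr1 ler_nat.
have hu := uroot_sub1_le R M0; set u := cabs _ in hu *.
have -> : q%:R * (q%:R^-1 * (2 * B * u) + 4 * B * M%:R * q%:R^-1 ^+ 2) = 2 * B * u + 4 * B / M%:R.
  by rewrite /q natrM; field; rewrite gt_eqF.
have : 2 * B * u <= 2 * B * (8 / M%:R) by rewrite ler_wpM2l // mulr_ge0.
lra.
Qed.

End RootInterpolationError.

Definition bipoly n1 n2 (c : nat -> nat -> C) (p : C * C) : C :=
  \sum_(a < n1) \sum_(b < n2) c a b * (p.1 ^+ a * p.2 ^+ b).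

Lemma bipoly_dense (f f1 f2 : C * C -> C) (B : R) :
  (forall u a b : C, cabs u <= 1 -> cabs a <= 1 -> cabs b <= 1 ->
    cabs (f (b, u) - f (a, u) - f1 (a, u) * (b - a)) <= B * cabs (b - a) ^+ 2) ->
  (forall u a b : C, cabs u <= 1 -> cabs a <= 1 -> cabs b <= 1 ->
    cabs (f (u, b) - f (u, a) - f2 (u, a) * (b - a)) <= B * cabs (b - a) ^+ 2) ->
  forall e, 0 < e -> exists n1 n2 c,
    forall p, closed_bidisk R p -> cabs (f p - bipoly n1 n2 c p) <= e.
Proof.
move=> T1 T2 e e0.
(* The outer interpolation may amplify the inner error [20 B / M2] by [M], hence [M2 = M ^ 2]; the
   two errors then total [40 B / M], which is at most [e]. *)
pose M := (Num.truncn (40 * `|B| / e)).+2; pose M2 := (M * M)%N.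
have M1 : (1 < M)%N by []. have M21 : (1 < M2)%N by rewrite /M2; lia.
have M0 : 0 < M%:R :> R by rewrite ltr0n.
have Me : 40 * `|B| / M%:R <= e.
  rewrite ler_pdivrMr // [e * _]mulrC -ler_pdivrMr //; apply/ltW.
  by apply: lt_le_trans (truncnS_gt _) _; rewrite ler_nat.
pose c a b := \sum_(s < M) \sum_(t < M2) M%:R^-1 * M2%:R^-1 *
   f (uroot R M ^+ s, uroot R M2 ^+ t) * ((uroot R M ^+ s) ^- a * (uroot R M2 ^+ t) ^- b).
exists M, M2, c => -[z u] [/= hz hu].
have -> : bipoly M M2 c (z, u) =
   uroot_interp M (fun x => uroot_interp M2 (fun y => f (x, y)) u) z.
  rewrite /bipoly /uroot_interp /uroot_kernel /c /= mulr_sumr.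
  rewrite [RHS](eq_bigr (fun s : 'I_M => \sum_(a < M) \sum_(b < M2) \sum_(t < M2)
     M%:R^-1 * M2%:R^-1 * f (uroot R M ^+ s, uroot R M2 ^+ t) *
     ((uroot R M ^+ s) ^- a * (uroot R M2 ^+ t) ^- b) * (z ^+ a * u ^+ b))).
    rewrite [RHS]exchange_big /=; apply: eq_bigr => a _.
    rewrite [RHS]exchange_big /=; apply: eq_bigr => b _.
    by rewrite mulr_suml; apply: eq_bigr => s _; rewrite mulr_suml.
  move=> s _; rewrite !mulr_sumr; apply: eq_bigr => a _.
  rewrite [RHS]exchange_big /= mulr_suml mulr_sumr; apply: eq_bigr => t _.
  rewrite mulr_sumr mulr_sumr mulr_suml mulr_sumr; apply: eq_bigr => b _.
  ring.
pose g x := uroot_interp M2 (fun y => f (x, y)) u.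
have lin : uroot_interp M g z - uroot_interp M (fun x => f (x, u)) z =
           uroot_interp M (fun x => g x - f (x, u)) z.
  by rewrite /uroot_interp -mulrBr -sumrB; congr (_ * _); apply: eq_bigr => s _; rewrite mulrBl.
have e1 := uroot_interp_err (F := fun x => f (x, u)) (F' := fun x => f1 (x, u)) M1 hz
   (fun a b => T1 u a b hu).
have e2 : cabs (uroot_interp M (fun x => g x - f (x, u)) z) <= M%:R * (20 * B / M2%:R).
  apply: uroot_interp_le => // s.
  apply: (uroot_interp_err (F := fun y => f (_, y)) (F' := fun y => f2 (_, y))) => // a b.
  by apply: T2; rewrite cabsX cabs_uroot expr1n.
have e2' : M%:R * (20 * B / M2%:R) = 20 * B / M%:R.
  by rewrite /M2 natrM; field; rewrite gt_eqF.
rewrite -/g cabs_distC; have -> : uroot_interp M g z - f (z, u) =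
   (uroot_interp M g z - uroot_interp M (fun x => f (x, u)) z) +
   (uroot_interp M (fun x => f (x, u)) z - f (z, u)) by ring.
apply: le_trans (cabsD _ _) _; rewrite lin; apply: le_trans Me.
have BM : 40 * B / M%:R <= 40 * `|B| / M%:R.
  by rewrite ler_wpM2r ?invr_ge0 ?ler_wpM2l // ?ler_norm ?ltW.
lra.
Qed.

Lemma bipoly_max_principle n1 n2 c E :
  (forall p, torus R p -> cabs (bipoly n1 n2 c p) <= E) ->
  forall p, closed_bidisk R p -> cabs (bipoly n1 n2 c p) <= E.
Proof.
move=> hE [z u] [/= hz hu].
pose G1 u : {poly C} := \sum_(a < n1) (\sum_(b < n2) c a b * u ^+ b) *: 'X^a.
have G1E x y : (G1 y).[x] = bipoly n1 n2 c (x, y).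
  rewrite horner_sum; apply: eq_bigr => a _; rewrite hornerZ hornerXn mulr_suml.
  by apply: eq_bigr => b _ /=; ring.
pose G2 x : {poly C} := \sum_(b < n2) (\sum_(a < n1) c a b * x ^+ a) *: 'X^b.
have G2E x y : (G2 x).[y] = bipoly n1 n2 c (x, y).
  rewrite horner_sum /bipoly exchange_big; apply: eq_bigr => b _.
  by rewrite hornerZ hornerXn mulr_suml; apply: eq_bigr => a _ /=; ring.
rewrite -G1E; apply: poly_max_principle => // x hx; rewrite G1E -G2E.
by apply: poly_max_principle => // y hy; rewrite G2E; apply: hE.
Qed.

Lemma conjc_unit (x : C) : cabs x = 1 -> (x^*)%C = x^-1 :> C.
Proof.
move=> hx; have x0 : x != 0 by rewrite -cabs_gt0 hx.
have := cabs_conj_sqr x; rewrite hx expr1n rmorph1 => E.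
by apply: (mulfI x0); rewrite divff // -E.
Qed.

(** The condition [d + j < M] excludes aliasing: the exponents [a + j] and [b] both stay below [M],
    so discrete orthogonality separates them. *)
Lemma sum_cabs_sqr_poly M (P : {poly C}) d j : (size P <= d.+1)%N -> (d + j < M)%N ->
  \sum_(s < M) ((cabs P.[uroot R M ^+ s] ^+ 2)%:C)%C * (uroot R M ^+ s) ^+ j =
  \sum_(a < d.+1) \sum_(b < d.+1) P`_a * (P`_b)^*%C * (((a + j)%N == b)%:R * M%:R).
Proof.
move=> sP dM.
transitivity (\sum_(s < M) \sum_(a < d.+1) \sum_(b < d.+1) P`_a * (P`_b)^*%C *
   ((uroot R M ^+ s) ^+ (a + j)%N * (uroot R M ^+ s) ^- b)).
  apply: eq_bigr => s _; set w := uroot R M ^+ s.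
  have hw : cabs w = 1 by rewrite cabsX cabs_uroot expr1n.
  rewrite cabs_conj_sqr (horner_coef_wide _ sP) rmorph_sum -mulrA mulr_suml.
  apply: eq_bigr => a _; rewrite mulr_suml mulr_sumr; apply: eq_bigr => b _.
  by rewrite rmorphM rmorphXn /= (conjc_unit hw) exprD exprVn; ring.
rewrite exchange_big /=; apply: eq_bigr => a _; rewrite exchange_big /=.
apply: eq_bigr => b _; rewrite -mulr_sumr uroot_orth //.
  by have := ltn_ord a; lia.
by have := ltn_ord b; lia.
Qed.

Lemma parseval M (P : {poly C}) d : (size P <= d.+1)%N -> (d < M)%N ->
  \sum_(s < M) cabs P.[uroot R M ^+ s] ^+ 2 = M%:R * \sum_(a < d.+1) cabs P`_a ^+ 2.
Proof.
move=> sP dM; apply: complexI; rewrite rmorph_sum rmorphM rmorph_sum rmorph_nat.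
have := @sum_cabs_sqr_poly M P d 0 sP (ltac:(by rewrite addn0)).
under eq_bigr => s _ do rewrite expr0 mulr1.
move=> ->; rewrite mulr_sumr; apply: eq_bigr => a _.
rewrite (bigD1 a) //= addn0 eqxx mul1r big1 ?addr0 => [|b ne].
  by rewrite cabs_conj_sqr; ring.
by move: ne; rewrite -val_eqE eq_sym /= => /negPf ->; rewrite mul0r mulr0.
Qed.

Definition ones_poly n : {poly C} := \sum_(i < n) 'X^i.

Lemma ones_polyM n (x : C) : (ones_poly n).[x] * (x - 1) = x ^+ n - 1.
Proof.
rewrite subrX1 mulrC horner_sum; congr (_ * _).
by apply: eq_bigr => i _; rewrite hornerXn.
Qed.

Lemma size_ones_poly n : (size (ones_poly n) <= n)%N.
Proof.
apply: leq_trans (size_sum _ _ _) _; apply/bigmax_leqP => i _.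
by rewrite size_polyXn.
Qed.

Lemma ones_poly1 n : (ones_poly n).[1] = n%:R.
Proof.
rewrite horner_sum (eq_bigr (fun=> 1)) ?sumr_const ?card_ord // => i _.
by rewrite hornerXn expr1n.
Qed.

Lemma coef_ones_poly n a : (ones_poly n)`_a = (a < n)%:R.
Proof.
rewrite coef_sum; case: ltnP => h.
  rewrite (bigD1 (Ordinal h)) //= coefXn eqxx big1 ?addr0 // => i.
  by rewrite -val_eqE coefXn eq_sym /= => /negPf ->.
by rewrite big1 // => i _; rewrite coefXn gtn_eqF //; exact: leq_trans h.
Qed.

(** Cauchy-Schwarz for the coefficients, obtained by expanding squares centred at
    [mu = a / (k + 1)]. *)
Lemma coef_sqr_ge (P : {poly C}) k (a : R) : (size P <= k.+1)%N -> a <= cabs P.[1] ->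
  0 <= a -> a ^+ 2 <= k.+1%:R * \sum_(i < k.+1) cabs P`_i ^+ 2.
Proof.
move=> sP aP a0; have k0 : 0 < k.+1%:R :> R by rewrite ltr0n.
have S : a <= \sum_(i < k.+1) cabs P`_i.
  apply: le_trans aP _; rewrite (horner_coef_wide _ sP).
  by apply: le_trans (cabs_sum _ _ _) _; apply: ler_sum => i _; rewrite expr1n mulr1.
pose mu := a / k.+1%:R; have mu0 : 0 <= mu by rewrite divr_ge0.
have : \sum_(i < k.+1) (2 * mu * cabs P`_i - mu ^+ 2) <= \sum_(i < k.+1) cabs P`_i ^+ 2.
  by apply: ler_sum => i _; have := sqr_ge0 (cabs P`_i - mu); nra.
rewrite sumrB -mulr_sumr sumr_const card_ord -[_ *+ _]mulr_natl.
set S1 := \sum_(_ < _) _ in S *; set S2 := \sum_(_ < _) _ => h.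
have E : k.+1%:R * mu = a by rewrite /mu mulrCA divff ?gt_eqF // mulr1.
have h2 : mu * a <= mu * S1 by rewrite ler_wpM2l.
have h3 : k.+1%:R * mu ^+ 2 <= S2 by rewrite -E in h2; lra.
have -> : a ^+ 2 = k.+1%:R * (k.+1%:R * mu ^+ 2) by rewrite -E; ring.
by rewrite ler_pM2l.
Qed.

(* The generalized Jackson kernel [|D|^(2 q.+1)], normalized on the [M]-th
   roots of unity.  Its moments follow from [|x - 1| |D(x)| = |x^n - 1| <= 2]. *)
Lemma jackson_kernel n q M J : (0 < n)%N -> (q.+1 * n.-1 + J < M)%N ->
  exists k : nat -> R, [/\ forall s, 0 <= k s, \sum_(s < M) k s = 1,
    \sum_(s < M) k s * cabs (uroot R M ^+ s - 1) ^+ (2 * q) <=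
      4 ^+ q * q.+1%:R / n%:R ^+ (2 * q)
  & forall j, (q.+1 * n.-1 < j)%N -> (j <= J)%N ->
    \sum_(s < M) ((k s)%:C)%C * (uroot R M ^+ s) ^+ j = 0].
Proof.
move=> n0 dM; set d := (q.+1 * n.-1)%N in dM *.
have n0' : 0 < n%:R :> R by rewrite ltr0n.
have M0 : 0 < M%:R :> R by rewrite ltr0n; lia.
have n1d : (n.-1 <= d)%N by rewrite /d mulSn leq_addr.
pose P := ones_poly n ^+ q.+1.
have sP : (size P <= d.+1)%N.
  apply: leq_trans (size_poly_exp_leq _ _) _; rewrite ltnS mulnC leq_mul //.
  by have := size_ones_poly n; lia.
have Pv x : cabs P.[x] = cabs (ones_poly n).[x] ^+ q.+1 by rewrite horner_exp cabsX.
pose Z := \sum_(s < M) cabs P.[uroot R M ^+ s] ^+ 2.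
(* The normalizer is bounded below through Parseval and [coef_sqr_ge], from the single value
   [P(1) = n ^ (q + 1)] and at most [(q + 1) n] coefficients. *)
have hZ : M%:R * n%:R ^+ (2 * q.+1) <= q.+1%:R * n%:R * Z.
  rewrite /Z (parseval sP) //; last by lia.
  rewrite mulrCA ler_pM2l // mulnC exprM.
  apply: le_trans (_ : d.+1%:R * \sum_(a < d.+1) cabs P`_a ^+ 2 <= _).
    by apply: coef_sqr_ge; rewrite ?exprn_ge0 // Pv ones_poly1 cabs_nat.
  apply: ler_wpM2r; first by apply: sumr_ge0 => a _; exact: sqr_ge0.
  by rewrite -natrM ler_nat /d; nia.
have Z0 : 0 < Z.
  have qn0 : 0 < q.+1%:R * n%:R :> R by rewrite mulr_gt0 // ltr0n.
  by rewrite -(pmulr_rgt0 _ qn0); apply: lt_le_trans hZ; rewrite mulr_gt0 // exprn_gt0.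
exists (fun s => cabs P.[uroot R M ^+ s] ^+ 2 / Z); split.
- by move=> s; rewrite divr_ge0 ?sqr_ge0 // ltW.
- by rewrite -mulr_suml divff // gt_eqF.
- under eq_bigr => s _ do rewrite mulrAC.
  rewrite -mulr_suml ler_pdivrMr //.
  have D2 : \sum_(s < M) cabs (ones_poly n).[uroot R M ^+ s] ^+ 2 = M%:R * n%:R.
    rewrite (@parseval M _ n.-1) ?prednK ?size_ones_poly //; last by lia.
    congr (_ * _); rewrite (eq_bigr (fun=> 1)) ?sumr_const ?card_ord //.
    by move=> a _; rewrite coef_ones_poly ltn_ord cabs1 expr1n.
  apply: le_trans (_ : 4 ^+ q * (M%:R * n%:R) <= _).
    rewrite -D2 mulr_sumr; apply: ler_sum => s _; set x := uroot R M ^+ s.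
    have x1 : cabs x <= 1 by rewrite cabsX cabs_uroot expr1n.
    have h : cabs (ones_poly n).[x] * cabs (x - 1) <= 2.
      rewrite -cabsM ones_polyM; apply: cabs_sub_le2; first exact: cabs_le1X.
      by rewrite cabs1.
    rewrite Pv -exprM mulnC exprM; set y := cabs _ in h *; set v := cabs (x - 1) in h *.
    have -> : y ^+ 2 ^+ q.+1 * v ^+ (2 * q) = ((y * v) ^+ 2) ^+ q * y ^+ 2.
      have -> : ((y * v) ^+ 2) ^+ q = (y ^+ 2) ^+ q * (v ^+ 2) ^+ q.
        by rewrite [(y * v) ^+ 2]exprMn [LHS]exprMn.
      by rewrite [v ^+ _]exprM [(y ^+ 2) ^+ q.+1]exprS; ring.
    rewrite ler_wpM2r ?sqr_ge0 // lerXn2r ?nnegrE ?sqr_ge0 //; try lra.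
    have : 0 <= y * v by rewrite mulr_ge0 ?cabs_ge0.
    by move: h; nra.
  set N := n%:R ^+ (2 * q); have N0 : 0 < N by rewrite exprn_gt0.
  have -> : 4 ^+ q * q.+1%:R / N * Z = 4 ^+ q * (q.+1%:R * Z / N).
    by rewrite -!mulrA [Z / _]mulrC.
  rewrite ler_wpM2l ?exprn_ge0 // ler_pdivlMr // -(ler_pM2r n0').
  have -> : M%:R * n%:R * N * n%:R = M%:R * n%:R ^+ (2 * q.+1).
    by rewrite mulnS exprD -/N; ring.
  by rewrite mulrAC.
move=> j dj jJ.
transitivity ((Z^-1%:C)%C * \sum_(s < M) ((cabs P.[uroot R M ^+ s] ^+ 2)%:C)%C * (uroot R M ^+ s) ^+ j).
  by rewrite mulr_sumr; apply: eq_bigr => s _; rewrite mulrA -rmorphM [Z^-1 * _]mulrC.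
rewrite (sum_cabs_sqr_poly sP); last by lia.
rewrite big1 ?mulr0 // => a _; rewrite big1 // => b _.
have -> : ((a + j)%N == b) = false by have := ltn_ord b; lia.
by rewrite mul0r mulr0.
Qed.

End Approximation.

(** * Smooth functions on the bidisk *)

Section Smoothness.
Variable R : realType.
Local Notation C := (Cplx R).

Definition uniform_on_bidisk (g : C * C -> C) := forall e : R, 0 < e ->
  exists2 d : R, 0 < d & forall p q, closed_bidisk R p -> closed_bidisk R q ->
    near2 d p q -> cabs (g q - g p) <= e.

Definition scale2 (r : C) (p : C * C) : C * C := (r * p.1, r * p.2).

Lemma cabs_scale_le1 (r : R) (x : C) : 0 <= r -> r <= 1 -> cabs x <= 1 ->
  cabs ((r%:C)%C * x) <= 1.
Proof.
move=> r0 r1 hx; rewrite cabsM cabs_real ger0_norm //.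
by rewrite mulr_ile1 ?cabs_ge0.
Qed.

Lemma cabs_scale_lt1 (r : R) (x : C) : 0 <= r -> r < 1 -> cabs x <= 1 ->
  cabs ((r%:C)%C * x) < 1.
Proof.
move=> r0 r1 hx; rewrite cabsM cabs_real ger0_norm //.
by have := cabs_ge0 x; nra.
Qed.

Lemma uniform_scale g : uniform_on_bidisk g -> forall e : R, 0 < e ->
  exists2 d : R, 0 < d & forall r : R, 0 <= r -> 1 - d < r -> r <= 1 ->
    forall p, closed_bidisk R p -> cabs (g (scale2 (r%:C)%C p) - g p) <= e.
Proof.
move=> gu e e0; have [d d0 hd] := gu e e0; exists d => // r r0 rd r1 p hp.
have inc (x : C) : cabs x <= 1 -> cabs ((r%:C)%C * x - x) < d.
  move=> hx; have -> : (r%:C)%C * x - x = - (((1 - r)%:C)%C * x).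
    by rewrite rmorphB rmorph1; ring.
  rewrite cabsN cabsM cabs_real ger0_norm ?subr_ge0 //.
  by have := cabs_ge0 x; nra.
case: hp => h1 h2; apply: hd => //; split=> /=; rewrite ?cabs_scale_le1 //; exact: inc.
Qed.

(** A chain of [N > 1 / d] steps along the segment from the origin to [p], each changing [g] by at
    most 1. *)
Lemma uniform_bounded g : uniform_on_bidisk g ->
  exists B : R, forall p, closed_bidisk R p -> cabs (g p) <= B.
Proof.
move=> gu; have [d d0 hd] := gu 1 ltr01.
pose N := (Num.truncn d^-1).+1; have N0 : 0 < N%:R :> R by rewrite ltr0n.
have Nd : N%:R^-1 < d by rewrite invf_plt ?posrE // truncnS_gt.
exists (cabs (g (0, 0)) + N%:R) => p hp.
have key k : (k <= N)%N ->
    cabs (g (scale2 ((k%:R / N%:R)%:C)%C p) - g (0, 0)) <= k%:R.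
  elim: k => [|k IH] hk.
    by rewrite mul0r rmorph0 /scale2 !mul0r subrr cabs0.
  have le1 j : (j <= N)%N -> closed_bidisk R (scale2 ((j%:R / N%:R)%:C)%C p).
    move=> hj; case: hp => h1 h2; have j0 : 0 <= j%:R / N%:R :> R by rewrite divr_ge0 // ltW.
    have j1 : j%:R / N%:R <= 1 :> R by rewrite ler_pdivrMr // mul1r ler_nat.
    by split; apply: cabs_scale_le1.
  rewrite [leRHS](_ : _ = 1 + k%:R); last by rewrite -natr1 addrC.
  apply: le_trans (cabs_triangle _ (g (scale2 ((k%:R / N%:R)%:C)%C p)) _) _.
  apply: lerD; last by apply: IH; exact: ltnW.
  apply: hd; try (apply: le1; lia).
  have inc (x : C) : cabs x <= 1 ->
      cabs (((k.+1%:R / N%:R)%:C)%C * x - ((k%:R / N%:R)%:C)%C * x) < d.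
    move=> hx; rewrite -mulrBl -rmorphB -mulrBl -natr1 addrC addKr mul1r.
    rewrite cabsM cabs_real ger0_norm ?invr_ge0 ?ltW //.
    have : 0 < N%:R^-1 :> R by rewrite invr_gt0.
    by have := cabs_ge0 x; nra.
  by case: hp => h1 h2; split; exact: inc.
have := key N (leqnn N); rewrite divff ?gt_eqF // rmorph1 /scale2 !mul1r -surjective_pairing.
have := cabsD (g p - g (0, 0)) (g (0, 0)); rewrite subrK; lra.
Qed.

Lemma uniform_of_continuous g : {within closed_bidisk R, continuous g} ->
  uniform_on_bidisk g.
Proof. exact: within_unif_continuous (@closed_bidisk_compact R). Qed.

Lemma uniformD g h : uniform_on_bidisk g -> uniform_on_bidisk h ->
  uniform_on_bidisk (fun p => g p + h p).
Proof.
move=> gu hu e e0; have e20 : 0 < e / 2 by rewrite divr_gt0.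
have [d1 d10 h1] := gu _ e20; have [d2 d20 h2] := hu _ e20.
exists (Num.min d1 d2); first by rewrite lt_min d10.
move=> p q hp hq [n1 n2]; move: n1 n2; rewrite !lt_min => /andP[? ?] /andP[? ?].
rewrite opprD addrACA; apply: le_trans (cabsD _ _) _; rewrite [e]splitr.
by apply: lerD; [apply: h1|apply: h2].
Qed.

Lemma uniformM g h : uniform_on_bidisk g -> uniform_on_bidisk h ->
  uniform_on_bidisk (fun p => g p * h p).
Proof.
move=> gu hu e e0.
have [B1 hB1] := uniform_bounded gu; have [B2 hB2] := uniform_bounded hu.
have z0 : closed_bidisk R (0, 0) by split; change (is_true (cabs (0 : C) <= 1)); rewrite cabs0.
have B10 := le_trans (cabs_ge0 _) (hB1 _ z0); have B20 := le_trans (cabs_ge0 _) (hB2 _ z0).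
pose W := B1 + B2 + 1; have W0 : 0 < W by rewrite /W; lra.
have e20 : 0 < e / W by rewrite divr_gt0.
have [d1 d10 h1] := gu _ e20; have [d2 d20 h2] := hu _ e20.
exists (Num.min d1 d2); first by rewrite lt_min d10.
move=> p q hp hq [n1 n2]; move: n1 n2; rewrite !lt_min => /andP[? ?] /andP[? ?].
have -> : g q * h q - g p * h p = (g q - g p) * h q + g p * (h q - h p) by ring.
apply: le_trans (cabsD _ _) _; rewrite !cabsM.
have c1 : cabs (g q - g p) <= e / W by apply: h1.
have c2 : cabs (h q - h p) <= e / W by apply: h2.
have := hB1 p hp; have := hB2 q hq; have := cabs_ge0 (h q); have := cabs_ge0 (g p).
have eW : e / W * W = e by rewrite divfK // gt_eqF.
have := cabs_ge0 (g q - g p); have := cabs_ge0 (h q - h p).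
rewrite -eW {2}/W; set x := e / W in e20 c1 c2 *; nra.
Qed.

Lemma uniform_fst : uniform_on_bidisk fst.
Proof. by move=> e e0; exists e => // p q _ _ [/ltW]. Qed.

Lemma uniform_snd : uniform_on_bidisk snd.
Proof. by move=> e e0; exists e => // p q _ _ [_ /ltW]. Qed.

Lemma rderiv_cst (c : C) x : rderiv (fun=> c) x 0.
Proof. by move=> e e0; exists 1 => // h _; rewrite subrr mulr0 subr0 cabs0 mulr_ge0 // ltW. Qed.

Lemma rderiv_scale (v : C) x : rderiv (fun t : R => (t%:C)%C * v) x v.
Proof.
move=> e e0; exists 1 => // h _; rewrite rmorphD.
by rewrite [X in cabs X](_ : _ = 0) ?cabs0 ?mulr_ge0 ?(ltW e0) //; ring.
Qed.

Lemma cdiffD p : cdiff (fun q => q.1 + q.2 : C) p 1 1.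
Proof.
move=> e e0; exists 1 => // q _.
rewrite [X in cabs X](_ : _ = 0) ?cabs0; last by ring.
by rewrite mulr_ge0 ?(ltW e0) // addr_ge0 ?cabs_ge0.
Qed.

Lemma cdiffM p : cdiff (fun q => q.1 * q.2 : C) p p.2 p.1.
Proof.
move=> e e0; exists e => // q [h1 h2].
rewrite [X in cabs X](_ : _ = (q.1 - p.1) * (q.2 - p.2)); last by ring.
have := cabs_ge0 (q.1 - p.1); have := cabs_ge0 (q.2 - p.2); rewrite cabsM; nra.
Qed.

Lemma rderivD (F G : R -> C) x d1 d2 : rderiv F x d1 -> rderiv G x d2 ->
  rderiv (fun t => F t + G t) x (d1 + d2).
Proof.
move=> dF dG; rewrite -[d1]mul1r -[d2]mul1r.
exact: (@rderiv_chain R (fun q => q.1 + q.2) (F x, G x) _ _ F G x d1 d2 erefl (cdiffD _)).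
Qed.

Lemma rderivM (F G : R -> C) x d1 d2 : rderiv F x d1 -> rderiv G x d2 ->
  rderiv (fun t => F t * G t) x (G x * d1 + F x * d2).
Proof.
move=> dF dG.
exact: (@rderiv_chain R (fun q => q.1 * q.2) (F x, G x) _ _ F G x d1 d2 erefl (cdiffM _)).
Qed.

Lemma rderivZ (c : C) (F : R -> C) x d : rderiv F x d ->
  rderiv (fun t => c * F t) x (c * d).
Proof. by move=> dF; have := rderivM (rderiv_cst c x) dF; rewrite mulr0 add0r. Qed.

Lemma rderivB (F G : R -> C) x d1 d2 : rderiv F x d1 -> rderiv G x d2 ->
  rderiv (fun t => F t - G t) x (d1 - d2).
Proof.
move=> dF dG e e0; have [dl dl0 h] := rderivD dF (rderivZ (-1) dG) e0.
by exists dl => // t /h; rewrite !mulN1r.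
Qed.

Lemma rderiv_line (a v : C) x : rderiv (fun t : R => a + (t%:C)%C * v) x v.
Proof. by have := rderivD (rderiv_cst a x) (rderiv_scale v x); rewrite add0r. Qed.

Lemma segment_lt1 (a b : C) (t : R) : cabs a < 1 -> cabs b < 1 -> 0 <= t <= 1 ->
  cabs (a + (t%:C)%C * (b - a)) < 1.
Proof.
move=> ha hb /andP[t0 t1].
have -> : a + (t%:C)%C * (b - a) = ((1 - t)%:C)%C * a + (t%:C)%C * b.
  by rewrite rmorphB rmorph1; ring.
apply: le_lt_trans (cabsD _ _) _; rewrite !cabsM !cabs_real !ger0_norm ?subr_ge0 //.
have [a1 b1] : 0 < 1 - cabs a /\ 0 < 1 - cabs b by rewrite !subr_gt0.
have [t2|t2] := leP t (1 / 2).
  have u0 : 0 < 1 - t by lra.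
  by have := mulr_gt0 u0 a1; have := mulr_ge0 t0 (ltW b1); lra.
have u0 : 0 <= 1 - t by lra.
have u1 : 0 < t by lra.
by have := mulr_ge0 u0 (ltW a1); have := mulr_gt0 u1 b1; lra.
Qed.

(** The mixed second difference is the increment over [[0, 1]] of a difference of [u] in the second
    variable. Its derivative involves [u1] at two points; the linear part of [u1] contributes
    [b h ^ 2], and the two remainders contribute [2 e h] and [e h], times [h]. *)
Lemma mixed_difference_bound (u u1 : C * C -> C) (h : R) (z w : C) (a b : C) (e : R) :
  0 <= h ->
  (forall t : R, 0 <= t <= 1 -> forall y : C, y = w \/ y = w + (h%:C)%C ->
     rderiv (fun s : R => u (z + (s%:C)%C * (h%:C)%C, y)) t
       ((h%:C)%C * u1 (z + (t%:C)%C * (h%:C)%C, y))) ->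
  (forall q, near2 (2 * h) (z, w) q -> cabs (u1 q - u1 (z, w) - (a * (q.1 - z) + b * (q.2 - w))) <=
     e * (cabs (q.1 - z) + cabs (q.2 - w))) ->
  0 < h -> 0 <= e ->
  cabs (u (z + (h%:C)%C, w + (h%:C)%C) - u (z + (h%:C)%C, w) - u (z, w + (h%:C)%C) + u (z, w)
    - b * (h%:C)%C ^+ 2) <= 3 * e * h ^+ 2.
Proof.
move=> h0 du cu h0' e0; set H := (h%:C)%C : C.
have cH : cabs H = h by rewrite cabs_real ger0_norm.
pose G (t : R) := u (z + (t%:C)%C * H, w + H) - u (z + (t%:C)%C * H, w) - (t%:C)%C * (b * H ^+ 2).
pose G' (t : R) := H * u1 (z + (t%:C)%C * H, w + H) - H * u1 (z + (t%:C)%C * H, w) - b * H ^+ 2.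
have dG t : 0 <= t <= 1 -> rderiv G t (G' t).
  move=> ht; apply: rderivB; last exact: rderiv_scale.
  by apply: rderivB; apply: du; [|right| |left].
have bG t : 0 <= t <= 1 -> cabs (G' t) <= 3 * e * h ^+ 2.
  move=> /andP[t0 t1].
  have ct : cabs ((t%:C)%C * H) <= h by rewrite cabsM cabs_real cH ger0_norm //; nra.
  have n1 : near2 (2 * h) (z, w) (z + (t%:C)%C * H, w + H).
    by split; rewrite /= addrAC subrr add0r ?cH; lra.
  have n2 : near2 (2 * h) (z, w) (z + (t%:C)%C * H, w).
    by split; rewrite /= ?subrr ?cabs0 ?[_ + _ - _]addrAC ?subrr ?add0r; lra.
  have := cu _ n1; have := cu _ n2; rewrite /= subrr cabs0 mulr0 !addr0.
  have -> : z + (t%:C)%C * H - z = (t%:C)%C * H by ring.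
  have -> : w + H - w = H by ring.
  set X := u1 (_, w + H); set Y := u1 (_, w); set V := u1 (z, w); rewrite cH => hY hX.
  have -> : G' t = H * ((X - V - (a * ((t%:C)%C * H) + b * H)) - (Y - V - a * ((t%:C)%C * H))).
    by rewrite /G' -/X -/Y; ring.
  rewrite cabsM cH; set P := X - _ - _ in hX *; set Q := Y - _ - _ in hY *.
  have ec : e * cabs ((t%:C)%C * H) <= e * h by rewrite ler_wpM2l.
  have : cabs (P - Q) <= 3 * e * h by apply: le_trans (cabsB P Q) _; lra.
  by rewrite -(ler_pM2l h0'); lra.
have := mean_value_ineq ler01 dG bG; rewrite subr0 mulr1; congr (cabs _ <= _).
by rewrite /G rmorph0 rmorph1 !mul0r !mul1r !addr0 subr0; ring.
Qed.

(** The mixed second difference is symmetric in the two variables, so after division by [h ^ 2] it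
    approximates both [b] and [c]. With [e = x / 12] the two errors total [x / 2], less than the
    supposed gap [x]. *)
Lemma young (u u1 u2 : C * C -> C) p a b c d : bidisk R p ->
  (forall q, bidisk R q -> cdiff u q (u1 q) (u2 q)) ->
  cdiff u1 p a b -> cdiff u2 p c d -> b = c.
Proof.
case: p => z w hp du d1 d2; apply/eqP; rewrite -subr_eq0 -cabs_eq0 eq_le cabs_ge0 andbT.
rewrite leNgt; apply/negP => bc0; set x := cabs _ in bc0.
have e0 : 0 < x / 12 by rewrite divr_gt0.
have [l0 l00 hl0] := nbhs_bidisk hp.
have [l1 l10 hl1] := d1 _ e0; have [l2 l20 hl2] := d2 _ e0.
pose h := Num.min l0 (Num.min l1 l2) / 2.
have h0 : 0 < h by rewrite divr_gt0 // !lt_min l00 l10.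
have [hh0 hh1 hh2] : [/\ 2 * h <= l0, 2 * h <= l1 & 2 * h <= l2].
  by rewrite /h mulrCA divff // mulr1 !ge_min !lexx ?orbT.
have cH : cabs ((h%:C)%C : C) = h by rewrite cabs_real ger0_norm // ltW.
have inB (s y : C) : cabs s <= h -> y = 0 \/ y = (h%:C)%C -> bidisk R (z + s, w + y).
  move=> hs hy; apply: hl0; split; rewrite /= addrAC subrr add0r; first lra.
  by case: hy => ->; rewrite ?cabs0 ?cH; lra.
have inB' (s y : C) : cabs s <= h -> y = 0 \/ y = (h%:C)%C -> bidisk R (z + y, w + s).
  move=> hs hy; apply: hl0; split; rewrite /= addrAC subrr add0r; last lra.
  by case: hy => ->; rewrite ?cabs0 ?cH; lra.
have ct (t : R) : 0 <= t <= 1 -> cabs ((t%:C)%C * (h%:C)%C : C) <= h.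
  by move=> /andP[t0 t1]; rewrite cabsM cH cabs_real ger0_norm //; nra.
have E1 := @mixed_difference_bound u u1 h z w a b (x / 12) (ltW h0).
have E2 := @mixed_difference_bound (fun q => u (q.2, q.1)) (fun q => u2 (q.2, q.1)) h w z d c (x / 12) (ltW h0).
have {}E1 : cabs (u (z + (h%:C)%C, w + (h%:C)%C) - u (z + (h%:C)%C, w) -
    u (z, w + (h%:C)%C) + u (z, w) - b * (h%:C)%C ^+ 2) <= 3 * (x / 12) * h ^+ 2.
  apply: E1 => // [t ht y hy|q [q1 q2]|]; last exact: ltW.
    have bq : bidisk R (z + (t%:C)%C * (h%:C)%C, y).
      case: hy => ->; last by apply: inB; [exact: ct | right].
      by rewrite -[w in (_, w)]addr0; apply: inB; [exact: ct | left].
    have := rderiv_chain erefl (du _ bq) (rderiv_line z (h%:C)%C t) (rderiv_cst y t).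
    by rewrite mulr0 addr0 [u1 _ * _]mulrC.
  by apply: hl1; split; lra.
have {}E2 : cabs (u (z + (h%:C)%C, w + (h%:C)%C) - u (z, w + (h%:C)%C) -
    u (z + (h%:C)%C, w) + u (z, w) - c * (h%:C)%C ^+ 2) <= 3 * (x / 12) * h ^+ 2.
  apply: E2 => // [t ht y hy|q [q1 q2]|]; last exact: ltW.
    have bq : bidisk R (y, w + (t%:C)%C * (h%:C)%C).
      case: hy => ->; last by apply: inB'; [exact: ct | right].
      by rewrite -[z in (z, _)]addr0; apply: inB'; [exact: ct | left].
    have := rderiv_chain erefl (du _ bq) (rderiv_cst y t) (rderiv_line w (h%:C)%C t).
    by rewrite mulr0 add0r [u2 _ * _]mulrC.
  have := hl2 (q.2, q.1); rewrite /near2 /= => /(_ (conj (lt_le_trans q2 hh2) (lt_le_trans q1 hh2))).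
  by rewrite [c * _ + _]addrC [cabs (q.2 - _) + _]addrC.
have : cabs ((b - c) * (h%:C)%C ^+ 2) <= x / 2 * h ^+ 2.
  have -> : (b - c) * (h%:C)%C ^+ 2 = (u (z + (h%:C)%C, w + (h%:C)%C) - u (z, w + (h%:C)%C) -
    u (z + (h%:C)%C, w) + u (z, w) - c * (h%:C)%C ^+ 2) - (u (z + (h%:C)%C, w + (h%:C)%C) - u (z + (h%:C)%C, w) -
    u (z, w + (h%:C)%C) + u (z, w) - b * (h%:C)%C ^+ 2) by ring.
  by apply: le_trans (cabsB _ _) _; lra.
rewrite cabsM cabsX cH ler_pM2r ?exprn_gt0 // -/x; lra.
Qed.

End Smoothness.

(** * Iterated finite differences of curves *)

Section FiniteDifferences.
Variable R : realType.
Local Notation C := (Cplx R).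

Definition fdiff (h : R) (F : R -> C) (x : R) : C := F (x + h) - F x.

Lemma rderiv_shift (F : R -> C) x h d : rderiv F (x + h) d ->
  rderiv (fun t => F (t + h)) x d.
Proof.
move=> dF e e0; have [dl dl0 hd] := dF e e0; exists dl => // t /hd.
by rewrite [x + h + t]addrAC.
Qed.

(** The innermost difference is applied to the whole sequence of derivatives; on the last one used,
    the mean value inequality trades it for one more derivative and a factor [|h|]. *)
Lemma iter_fdiff_bound n h (G : nat -> R -> C) W :
  (forall k x, (k < n)%N -> rderiv (G k) x (G k.+1 x)) ->
  (forall x, cabs (G n x) <= W) ->
  forall x, cabs (iter n (fdiff h) (G 0%N) x) <= `|h| ^+ n * W.
Proof.
elim: n G W => [|n IH] G W dG hG x; first by rewrite expr0 mul1r; exact: hG.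
rewrite iterSr exprSr -mulrA.
apply: (IH (fun k => fdiff h (G k))) => [k y hk|y].
  by apply: rderivB; [apply: rderiv_shift|]; apply: dG; exact: leqW.
have mvi a b : a <= b -> cabs (G n b - G n a) <= W * (b - a).
  by move=> hab; apply: (mean_value_ineq hab) => z _; [apply: dG|apply: hG].
rewrite /fdiff mulrC; case: (leP 0 h) => h0.
  have e : y + h - y = h by ring.
  by have := mvi y (y + h); rewrite e lerDl ger0_norm //; apply.
have e : y - (y + h) = - h by ring.
have := mvi (y + h) y; rewrite e gerDl ltr0_norm // cabs_distC; apply.
exact: ltW.
Qed.

Lemma iter_fdiff_lip n h (F G : R -> C) e : (forall x, cabs (F x - G x) <= e) ->
  forall x, cabs (iter n (fdiff h) F x - iter n (fdiff h) G x) <= 2 ^+ n * e.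
Proof.
elim: n F G e => [|n IH] F G e hFG x; first by rewrite expr0 mul1r; exact: hFG.
rewrite !iterSr exprSr -mulrA; apply: IH => y.
have -> : fdiff h F y - fdiff h G y = (F (y + h) - G (y + h)) - (F y - G y).
  by rewrite /fdiff; ring.
apply: le_trans (cabsB _ _) _; have := hFG y; have := hFG (y + h); lra.
Qed.

Lemma iter_fdiff_sum n h (I : finType) (c : I -> C) (F : I -> R -> C) x :
  iter n (fdiff h) (fun t => \sum_i c i * F i t) x =
  \sum_i c i * iter n (fdiff h) (F i) x.
Proof.
elim: n x => [//|n IH] x; rewrite iterS {1}/fdiff !IH -sumrB.
by apply: eq_bigr => i _; rewrite -mulrBr.
Qed.

Lemma iter_fdiff_expi n h j x :
  iter n (fdiff h) (fun t => expi t ^+ j) x = expi x ^+ j * (expi h ^+ j - 1) ^+ n.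
Proof.
elim: n x => [|n IH] x; first by rewrite mulr1.
by rewrite iterS {1}/fdiff !IH expiD exprMn exprS; ring.
Qed.

End FiniteDifferences.

(** * Differences of a function of the Lipschitz class along rotations *)

Section LipschitzClass.
Variables (R : realType) (m : nat) (gamma : R) (f : Cplx R * Cplx R -> Cplx R).
Local Notation C := (Cplx R).
Hypothesis gamma_gt0 : 0 < gamma.
Hypothesis gamma_le1 : gamma <= 1.
Hypothesis hf : Lipm m gamma f.

Definition rot (t : R) (p : C * C) : C * C := (expi t * p.1, expi t * p.2).

Lemma rot_bidisk t p : bidisk R p -> bidisk R (rot t p).
Proof. by case=> h1 h2; split; rewrite /= cabsM cabs_expi mul1r. Qed.

Lemma rot_closed t p : closed_bidisk R p -> closed_bidisk R (rot t p).
Proof. by case=> h1 h2; split; rewrite /= cabsM cabs_expi mul1r. Qed.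

Lemma rot_torus t p : torus R p -> torus R (rot t p).
Proof. by case=> h1 h2; split; rewrite /= cabsM cabs_expi mul1r. Qed.

Lemma partial_lip a : (a.1 + a.2 <= m)%N ->
  exists2 g, Lip gamma g & forall p, bidisk R p -> g p = partial a f p.
Proof. by case: hf => _; apply. Qed.

(** Total order [m] is included: the extensions in [Lip] are holomorphic inside, so the partial
    derivatives of order [m] are themselves differentiable there. *)
Lemma partial_cdiff a p : (a.1 + a.2 <= m)%N -> bidisk R p ->
  cdiff (partial a f) p (partial (a.1.+1, a.2) f p) (partial2 (partial a f) p).
Proof.
move=> ha hp; have [g [[dg _] _] gE] := partial_lip ha.
rewrite /partial /= -/(partial a f).
have [<- <-] := partial_eq_on hp gE.
by apply: (cdiff_eq_on hp gE); apply: differentiable_cdiff; exact: dg.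
Qed.

(** [partial] differentiates in the second variable first, so adding a derivative in that variable
    requires the symmetry of [young]. *)
Lemma partial2_partial a1 a2 p : (a1 + a2 < m)%N -> bidisk R p ->
  partial2 (partial (a1, a2) f) p = partial (a1, a2.+1) f p.
Proof.
elim: a1 p => [//|a1 IH] p hm hp.
have IH' q : bidisk R q -> partial2 (partial (a1, a2) f) q = partial (a1, a2.+1) f q.
  by apply: IH; lia.
have d1 := @partial_cdiff (a1.+1, a2) p (ltnW hm) hp.
have d2 : cdiff (partial2 (partial (a1, a2) f)) p
    (partial (a1.+1, a2.+1) f p) (partial2 (partial (a1, a2.+1) f) p).
  have hm' : (a1 + a2.+1 <= m)%N by lia.
  exact: cdiff_eq_on hp (fun q hq => esym (IH' q hq)) (@partial_cdiff (a1, a2.+1) p hm' hp).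
have hm' : (a1 + a2 <= m)%N by lia.
exact: young hp (fun q hq => @partial_cdiff (a1, a2) q hm' hq) d1 d2.
Qed.

Lemma partial_cdiff_next a p : (a.1 + a.2 < m)%N -> bidisk R p ->
  cdiff (partial a f) p (partial (a.1.+1, a.2) f p) (partial (a.1, a.2.+1) f p).
Proof.
case: a => a1 a2 ha hp; have := partial_cdiff (ltnW ha) hp.
by rewrite /= partial2_partial.
Qed.

(* The polynomial combinations of partial derivatives of order at most [j]
   produced by iterating the Euler operator [z1 d1 + z2 d2]. *)
Inductive euler_class : nat -> (C * C -> C) -> Prop :=
| euler_partial j a : (a.1 + a.2 <= j)%N -> euler_class j (partial a f)
| euler_add j u v : euler_class j u -> euler_class j v ->
    euler_class j (fun p => u p + v p)
| euler_mul1 j u : euler_class j u -> euler_class j (fun p => p.1 * u p)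
| euler_mul2 j u : euler_class j u -> euler_class j (fun p => p.2 * u p).

Lemma euler_classW j u : euler_class j u -> euler_class j.+1 u.
Proof.
elim=> [i a h|i v w _ hv _ hw|i v _ hv|i v _ hv].
- by apply: euler_partial; exact: leqW.
- exact: euler_add.
- exact: euler_mul1.
- exact: euler_mul2.
Qed.

Lemma rderiv_rot_coord (x : C) t : rderiv (fun s => expi s * x) t (expi t * ('i%C * x)).
Proof.
have := rderivM (rderiv_expi t) (rderiv_cst x t).
by rewrite mulr0 addr0; congr rderiv; ring.
Qed.

(** The velocity of the orbit of [p] is [i] times its position, so differentiation along the orbit
    is [i] times the Euler operator. *)
Lemma euler_class_rderiv j u : euler_class j u -> (j < m)%N ->
  exists2 v, euler_class j.+1 v & forall p, bidisk R p -> forall t,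
    rderiv (fun s => u (rot s p)) t ('i%C * v (rot t p)).
Proof.
elim=> {j u} [j a ha hj|j u v _ IHu _ IHv hj|j u hu IH hj|j u hu IH hj].
- exists (fun p => p.1 * partial (a.1.+1, a.2) f p + p.2 * partial (a.1, a.2.+1) f p).
    by apply: euler_add; [apply: euler_mul1|apply: euler_mul2]; apply: euler_partial => /=; lia.
  move=> p hp t; have hq := rot_bidisk t hp.
  have := rderiv_chain erefl (partial_cdiff_next (leq_ltn_trans ha hj) hq)
    (rderiv_rot_coord p.1 t) (rderiv_rot_coord p.2 t).
  by congr rderiv; rewrite /rot /=; ring.
- have [u' hu' du] := IHu hj; have [v' hv' dv] := IHv hj.
  exists (fun p => u' p + v' p); first exact: euler_add.
  by move=> p hp t; have := rderivD (du p hp t) (dv p hp t); rewrite -mulrDr.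
- have [u' hu' du] := IH hj; exists (fun p => p.1 * u p + p.1 * u' p).
    by apply: euler_add; apply: euler_mul1 => //; exact: euler_classW.
  move=> p hp t; have := rderivM (rderiv_rot_coord p.1 t) (du p hp t).
  by congr rderiv; rewrite /rot /=; ring.
have [u' hu' du] := IH hj; exists (fun p => p.2 * u p + p.2 * u' p).
  by apply: euler_add; apply: euler_mul2 => //; exact: euler_classW.
move=> p hp t; have := rderivM (rderiv_rot_coord p.2 t) (du p hp t).
by congr rderiv; rewrite /rot /=; ring.
Qed.

(** What is kept of [Lip] for the top derivative: the passage to radial limits and the estimate on
    the torus, both of which survive sums and products with the coordinates. *)
Definition lip_extension (u : C * C -> C) := exists g, [/\ uniform_on_bidisk g,
  exists2 L : R, 0 <= L & forall p h, torus R p ->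
    cabs (g (rot h p) - g p) <= L * `|h| `^ gamma
  & forall p, bidisk R p -> g p = u p].

Lemma torus_closed p : torus R p -> closed_bidisk R p.
Proof. by case=> h1 h2; split; rewrite ?h1 ?h2. Qed.

(** The chord is at most both [|h|] and 2; the first serves for [|h| <= 1], where [gamma <= 1] gives
    [|h| <= |h| ^ gamma], the second beyond. *)
Lemma cabs_expi_sub1_powR (h : R) : cabs (expi h - 1) <= 2 * `|h| `^ gamma.
Proof.
have h1 := cabs_expi_sub1 h; have p0 := powR_ge0 `|h| gamma.
have [hle|hgt] := leP `|h| 1.
  have : `|h| <= `|h| `^ gamma.
    have [->|h0] := eqVneq `|h| 0; first exact: powR_ge0.
    by apply: ger1_powR => //; rewrite hle lt_neqAle eq_sym h0 normr_ge0.
  lra.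
have : 1 <= `|h| `^ gamma.
  by rewrite -[leLHS](powRr0 `|h|); apply: ler_powR; exact: ltW.
have : cabs (expi h - 1) <= 2 by apply: cabs_sub_le2; rewrite ?cabs_expi ?cabs1.
lra.
Qed.

Lemma lip_extension_mul (pr : C * C -> C) u :
  (forall p h, pr (rot h p) = expi h * pr p) -> uniform_on_bidisk pr ->
  (forall p, torus R p -> cabs (pr p) = 1) ->
  lip_extension u -> lip_extension (fun p => pr p * u p).
Proof.
move=> prE pru pr1 [g [gu [L L0 hL] gE]]; have [B hB] := uniform_bounded gu.
exists (fun p => pr p * g p); split; first exact: uniformM.
  exists (L + 2 * `|B|); first by rewrite addr_ge0 // mulr_ge0.
  move=> p h hp; rewrite prE.
  have -> : expi h * pr p * g (rot h p) - pr p * g p =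
     pr p * (expi h * (g (rot h p) - g p) + (expi h - 1) * g p) by ring.
  rewrite cabsM pr1 // mul1r; apply: le_trans (cabsD _ _) _.
  rewrite cabsM cabs_expi mul1r [leRHS]mulrDl; apply: lerD; first exact: hL.
  rewrite cabsM mulrAC; apply: ler_pM; rewrite ?cabs_ge0 ?cabs_expi_sub1_powR //.
  by apply: le_trans (hB _ (torus_closed hp)) (ler_norm _).
by move=> p hp; rewrite gE.
Qed.

Lemma euler_class_lip j u : euler_class j u -> (j <= m)%N -> lip_extension u.
Proof.
elim=> {j u} [j a ha hj|j u v _ IHu _ IHv hj|j u _ IH hj|j u _ IH hj].
- have [g [[_ gc] [L L0 hL]] gE] := partial_lip (leq_trans ha hj).
  exists g; split=> //; first exact: uniform_of_continuous.
  by exists L; rewrite ?ltW // => p h hp; exact: hL.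
- have [g [gu [L L0 hL] gE]] := IHu hj; have [g' [gu' [L' L0' hL'] gE']] := IHv hj.
  exists (fun p => g p + g' p); split; first exact: uniformD.
    exists (L + L'); first exact: addr_ge0.
    move=> p h hp; rewrite opprD addrACA [leRHS]mulrDl; apply: le_trans (cabsD _ _) _.
    by apply: lerD; [apply: hL|apply: hL'].
  by move=> p hp; rewrite gE // gE'.
- apply: lip_extension_mul (IH hj) => //; first exact: uniform_fst.
  by move=> p [].
apply: lip_extension_mul (IH hj) => //; first exact: uniform_snd.
by move=> p [].
Qed.

Lemma euler_sequence : exists u : nat -> C * C -> C, [/\ u 0%N = f,
  forall k, (k < m)%N -> forall p, bidisk R p -> forall t,
    rderiv (fun s => u k (rot s p)) t ('i%C * u k.+1 (rot t p))
  & lip_extension (u m)].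
Proof.
suff H n : (n <= m)%N -> exists u : nat -> C * C -> C, [/\ u 0%N = f,
    forall k, (k < n)%N -> forall p, bidisk R p -> forall t,
      rderiv (fun s => u k (rot s p)) t ('i%C * u k.+1 (rot t p))
    & euler_class n (u n)].
  have [u [u0 du cu]] := H m (leqnn m); exists u; split=> //.
  exact: euler_class_lip cu _.
elim: n => [_|n IH hn].
  exists (fun=> f); split=> //; exact: (@euler_partial 0 (0, 0)%N).
have [u [u0 du cu]] := IH (ltnW hn); have [v cv dv] := euler_class_rderiv cu hn.
exists (fun k => if (k <= n)%N then u k else v); split=> //=; last by rewrite ltnn.
move=> k; rewrite ltnS => hk p hp t; rewrite hk.
case: ltnP => hkn; first exact: du.
have -> : k = n by lia.
exact: dv.
Qed.

Lemma cabs_i : cabs ('i%C : C) = 1.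
Proof. by rewrite /cabs /= expr0n expr1n add0r sqrtr1. Qed.

Lemma Lipm_uniform : uniform_on_bidisk f.
Proof. by apply: uniform_of_continuous; case: hf => -[]. Qed.

(** Of the [m + 1] differences, [m] are traded for derivatives and the last one meets the Lipschitz
    bound of order [gamma]. Derivatives are taken on the orbit of [q = r p], inside the bidisk, and
    compared with the torus at the cost of [e]. *)
Lemma iter_fdiff_torus : exists2 L : R, 0 <= L & forall p h, torus R p ->
  cabs (iter m.+1 (fdiff h) (fun t => f (rot t p)) 0) <= L * (`|h| ^+ m * `|h| `^ gamma).
Proof.
have [u [u0 du [g [gu [L L0 hL] gE]]]] := euler_sequence.
exists L => // p h hp; have cp := torus_closed hp.
set A := `|h| ^+ m; have A0 : 0 <= A by rewrite exprn_ge0.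
rewrite -/A; apply/ler_addgt0Pr => e e0.
(* Two displacements of [g] from the torus to radius [r], multiplied by [A], and one displacement of
   [f] under [m + 1] differences, cost [W * (e / W)] in all. *)
pose W := 2 * A + 2 ^+ m.+1; have W0 : 0 < W.
  by rewrite ltr_wpDl ?exprn_gt0 // mulr_ge0.
have eW : 0 < e / W by rewrite divr_gt0.
have [d1 d10 h1] := uniform_scale Lipm_uniform eW.
have [d2 d20 h2] := uniform_scale gu eW.
pose r : R := 1 - Num.min 1 (Num.min d1 d2) / 2.
have mn : 0 < Num.min 1 (Num.min d1 d2) <= 1.
  by rewrite !lt_min ltr01 d10 d20 ge_min lexx.
have [r0 r1 rd1 rd2] : [/\ 0 <= r, r < 1, 1 - d1 < r & 1 - d2 < r].
  have a1 : Num.min 1 (Num.min d1 d2) <= d1 by rewrite !ge_min lexx orbT.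
  have a2 : Num.min 1 (Num.min d1 d2) <= d2 by rewrite !ge_min lexx !orbT.
  by rewrite /r; case/andP: mn => ? ?; split; lra.
pose q := scale2 (r%:C)%C p.
have hq : bidisk R q by case: cp => c1 c2; split; apply: cabs_scale_lt1.
have rotq t : rot t q = scale2 (r%:C)%C (rot t p).
  by rewrite /q /rot /scale2 /=; congr (_, _); ring.
pose F k t := 'i%C ^+ k * u k (rot t q) : C.
have dF k x : (k < m)%N -> rderiv (F k) x (F k.+1 x).
  move=> hk; have := rderivZ ('i%C ^+ k) (du k hk q hq x).
  by congr rderiv; rewrite /F exprSr mulrA.
have hF x : cabs (fdiff h (F m) x) <= 2 * (e / W) + L * `|h| `^ gamma.
  rewrite /fdiff /F -mulrBr cabsM cabsX cabs_i expr1n mul1r.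
  rewrite -!gE; try exact: rot_bidisk.
  have -> : rot (x + h) q = scale2 (r%:C)%C (rot h (rot x p)).
    by rewrite rotq /rot /= expiD; congr scale2; congr (_, _); ring.
  rewrite rotq; have tx := rot_torus x hp.
  have := h2 r r0 rd2 (ltW r1) (rot h (rot x p)) (torus_closed (rot_torus h tx)).
  have := h2 r r0 rd2 (ltW r1) (rot x p) (torus_closed tx).
  have := hL (rot x p) h tx.
  set a := g (scale2 _ (rot h _)); set b := g (scale2 _ _); set c := g (rot h _); set d := g _.
  move=> i1 i2 i3; have -> : a - b = (a - c) + (c - d) - (b - d) by ring.
  apply: le_trans (cabsB _ _) _; have := cabsD (a - c) (c - d); lra.
have B1 : cabs (iter m (fdiff h) (fdiff h (F 0%N)) 0) <= A * (2 * (e / W) + L * `|h| `^ gamma).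
  apply: (@iter_fdiff_bound R m h (fun k => fdiff h (F k))) => // k x hk.
  by apply: rderivB; [apply: rderiv_shift|]; exact: dF.
have B2 := @iter_fdiff_lip R m.+1 h (fun t => f (rot t p)) (F 0%N) (e / W)
  (ltac:(move=> t; rewrite /F expr0 mul1r u0 rotq cabs_distC; apply: h1 => //; [exact: ltW | exact: rot_closed])) 0.
rewrite -iterSr in B1.
set X := iter _ _ _ _ in B2 *; set Y := iter _ _ _ _ in B1 B2 *.
have eWE : e / W * W = e by rewrite divfK // gt_eqF.
have := cabsD (X - Y) Y; rewrite subrK; rewrite -eWE {2}/W => h3; lra.
Qed.

End LipschitzClass.

(** * Second-order Taylor estimate along a segment *)

Section Taylor.
Variable R : realType.
Local Notation C := (Cplx R).

Lemma taylor_open (F F1 F2 : C -> C) B a b :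
  (forall t, 0 <= t <= 1 -> rderiv (fun s : R => F (a + (s%:C)%C * (b - a))) t
     ((b - a) * F1 (a + (t%:C)%C * (b - a)))) ->
  (forall t, 0 <= t <= 1 -> rderiv (fun s : R => F1 (a + (s%:C)%C * (b - a))) t
     ((b - a) * F2 (a + (t%:C)%C * (b - a)))) ->
  (forall t, 0 <= t <= 1 -> cabs (F2 (a + (t%:C)%C * (b - a))) <= B) ->
  cabs (F b - F a - F1 a * (b - a)) <= B * cabs (b - a) ^+ 2.
Proof.
move=> dF dF1 hF2; have B0 : 0 <= B.
  by apply: le_trans (hF2 0 _); rewrite ?cabs_ge0 // lexx ler01.
pose G (t : R) := F (a + (t%:C)%C * (b - a)) - (t%:C)%C * (F1 a * (b - a)).
have dG t : 0 <= t <= 1 ->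
    rderiv G t ((b - a) * F1 (a + (t%:C)%C * (b - a)) - F1 a * (b - a)).
  by move=> ht; apply: rderivB; [exact: dF | exact: rderiv_scale].
have bG t : 0 <= t <= 1 ->
    cabs ((b - a) * F1 (a + (t%:C)%C * (b - a)) - F1 a * (b - a)) <= B * cabs (b - a) ^+ 2.
  move=> /andP[t0 t1]; have := @mean_value_ineq R
    (fun s => F1 (a + (s%:C)%C * (b - a))) _ 0 t (B * cabs (b - a)) t0
    (fun s hs => dF1 s (ltac:(case/andP: hs => s0 s1; apply/andP; split; lra))).
  rewrite rmorph0 mul0r addr0 subr0 => h1.
  rewrite [F1 a * _]mulrC -mulrBr cabsM.
  have : cabs (F1 (a + (t%:C)%C * (b - a)) - F1 a) <= B * cabs (b - a) * t.
    apply: h1 => s /andP[s0 s1]; rewrite cabsM mulrC ler_wpM2r ?cabs_ge0 //.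
    by apply: hF2; apply/andP; split; lra.
  have c0 := cabs_ge0 (b - a); have Bc : 0 <= B * cabs (b - a) by rewrite mulr_ge0.
  move=> h2; have {}h2 : cabs (F1 (a + (t%:C)%C * (b - a)) - F1 a) <= B * cabs (b - a).
    by apply: le_trans h2 _; nra.
  by apply: le_trans (ler_wpM2l c0 h2) _; rewrite mulrCA expr2.
have := mean_value_ineq ler01 dG bG; rewrite subr0 mulr1; congr (cabs _ <= _).
have ab : a + (b - a) = b by ring.
by rewrite /G rmorph0 rmorph1 !mul0r !mul1r !addr0 subr0 ab; ring.
Qed.

End Taylor.

(** * The Jackson theorem on the bidisk *)

Section Jackson.
Variables (R : realType).
Local Notation C := (Cplx R).

(** Scaling by [r < 1] moves the three points inside, and uniform continuity absorbs the change. The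
    map [emb] puts the moving coordinate in either slot, so that one proof serves both variables. *)
Lemma taylor_closed (emb : C -> C -> C * C) (f f1 : C * C -> C) B :
  (forall x u, cabs x <= 1 -> cabs u <= 1 -> closed_bidisk R (emb x u)) ->
  (forall r x u, scale2 r (emb x u) = emb (r * x) (r * u)) ->
  0 <= B -> uniform_on_bidisk f -> uniform_on_bidisk f1 ->
  (forall u a b, cabs u < 1 -> cabs a < 1 -> cabs b < 1 ->
     cabs (f (emb b u) - f (emb a u) - f1 (emb a u) * (b - a)) <= B * cabs (b - a) ^+ 2) ->
  forall u a b, cabs u <= 1 -> cabs a <= 1 -> cabs b <= 1 ->
     cabs (f (emb b u) - f (emb a u) - f1 (emb a u) * (b - a)) <= B * cabs (b - a) ^+ 2.
Proof.
move=> embP embZ B0 fu f1u T u a b hu ha hb; apply/ler_addgt0Pr => e e0.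
have [B' hB'] := uniform_bounded f1u.
have B'0 : 0 <= B' by apply: le_trans (hB' _ (embP _ _ ha hu)); exact: cabs_ge0.
pose W := 4 + 2 * B'; have W0 : 0 < W by rewrite /W; lra.
have eW : 0 < e / W by rewrite divr_gt0.
have [d1 d10 h1] := uniform_scale fu eW; have [d2 d20 h2] := uniform_scale f1u eW.
pose mn := Num.min (Num.min 1 (e / W)) (Num.min d1 d2).
have mn0 : 0 < mn by rewrite !lt_min ltr01 eW d10 d20.
have [m1 me m2 m3] : [/\ mn <= 1, mn <= e / W, mn <= d1 & mn <= d2].
  by rewrite /mn !ge_min !lexx ?orbT.
pose r : R := 1 - mn / 2.
have [r0 r1 rd1 rd2] : [/\ 0 <= r, r < 1, 1 - d1 < r & 1 - d2 < r].
  by rewrite /r; split; lra.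
have ba : cabs (b - a) <= 2 by exact: cabs_sub_le2.
have ba0 := cabs_ge0 (b - a).
have := T _ _ _ (cabs_scale_lt1 r0 r1 hu) (cabs_scale_lt1 r0 r1 ha) (cabs_scale_lt1 r0 r1 hb).
rewrite -!embZ -mulrBr cabsM cabs_real ger0_norm // => hT.
have {}hT : cabs (f (scale2 (r%:C)%C (emb b u)) - f (scale2 (r%:C)%C (emb a u)) -
   f1 (scale2 (r%:C)%C (emb a u)) * ((r%:C)%C * (b - a))) <= B * cabs (b - a) ^+ 2.
  apply: le_trans hT _; rewrite ler_wpM2l // lerXn2r ?nnegrE ?mulr_ge0 //.
  by rewrite ler_piMl // ltW.
have i1 := h1 r r0 rd1 (ltW r1) _ (embP _ _ hb hu).
have i2 := h1 r r0 rd1 (ltW r1) _ (embP _ _ ha hu).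
have i3 := h2 r r0 rd2 (ltW r1) _ (embP _ _ ha hu).
have i4 := hB' _ (embP _ _ ha hu).
set fb' := f (scale2 _ (emb b u)) in hT i1; set fa' := f (scale2 _ (emb a u)) in hT i2.
set ga' := f1 (scale2 _ _) in hT i3; set fb := f (emb b u) in i1 *.
set fa := f (emb a u) in i2 *; set ga := f1 (emb a u) in i3 i4 *.
have -> : fb - fa - ga * (b - a) = (fb' - fa' - ga' * ((r%:C)%C * (b - a))) -
   ((fb' - fb) - (fa' - fa) - ((ga' - ga) * (r%:C)%C - ((1 - r)%:C)%C * ga) * (b - a)).
  have -> : ((1 - r)%:C)%C = 1 - (r%:C)%C :> C by exact: rmorphB.
  by clearbody r; ring.
apply: le_trans (cabsB _ _) _; apply: lerD => //.
apply: le_trans (cabsB _ _) _; have k1 := cabsB (fb' - fb) (fa' - fa).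
have k2 : cabs ((ga' - ga) * (r%:C)%C - ((1 - r)%:C)%C * ga) <= e / W + e / W * B'.
  apply: le_trans (cabsB _ _) _; rewrite !cabsM !cabs_real.
  rewrite (ger0_norm r0) [`|1 - r|]ger0_norm; last by rewrite subr_ge0 ltW.
  apply: lerD; first by have := cabs_ge0 (ga' - ga); nra.
  by apply: ler_pM => //; [rewrite subr_ge0 ltW | exact: cabs_ge0 | rewrite /r; lra].
have eWE : e / W * W = e by rewrite divfK // gt_eqF.
rewrite [X in _ + X]cabsM -eWE {2}/W.
set k := cabs _ in k2 *; have k0 : 0 <= k by exact: cabs_ge0.
have : k * cabs (b - a) <= (e / W + e / W * B') * 2 by apply: ler_pM.
lra.
Qed.

Variables (m : nat) (gamma : R) (f : C * C -> C).
Hypothesis gamma_gt0 : 0 < gamma.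
Hypothesis gamma_le1 : gamma <= 1.
Hypothesis hf : Lipm m gamma f.
Hypothesis m_ge2 : (2 <= m)%N.

Lemma partial_extension a : (a.1 + a.2 <= m)%N -> exists g B, [/\ uniform_on_bidisk g,
  0 <= B, forall p, closed_bidisk R p -> cabs (g p) <= B
  & forall p, bidisk R p -> g p = partial a f p].
Proof.
move=> ha; have [g [[_ gc] _] gE] := partial_lip hf ha.
have gu := uniform_of_continuous gc; have [B hB] := uniform_bounded gu.
exists g, `|B|; split=> // p hp; apply: le_trans (hB _ hp) (ler_norm _).
Qed.

Lemma bidisk_closed p : bidisk R p -> closed_bidisk R p.
Proof. by case=> /ltW h1 /ltW h2. Qed.

Lemma rderiv_partial1 a (x v u : C) t : (a.1 + a.2 <= m)%N ->
  bidisk R (x + (t%:C)%C * v, u) ->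
  rderiv (fun s : R => partial a f (x + (s%:C)%C * v, u)) t
    (v * partial (a.1.+1, a.2) f (x + (t%:C)%C * v, u)).
Proof.
move=> ha hq; have := partial_cdiff hf ha hq.
move: (partial a f) (partial (a.1.+1, a.2) f _) => g P dg.
have := rderiv_chain erefl dg (rderiv_line x v t) (rderiv_cst u t).
by rewrite mulr0 addr0 mulrC.
Qed.

Lemma rderiv_partial2 a (x v u : C) t : (a.1 + a.2 <= m)%N ->
  bidisk R (u, x + (t%:C)%C * v) ->
  rderiv (fun s : R => partial a f (u, x + (s%:C)%C * v)) t
    (v * partial2 (partial a f) (u, x + (t%:C)%C * v)).
Proof.
move=> ha hq; have := partial_cdiff hf ha hq.
move: (partial a f) (partial2 (partial a f) _) => g P dg.
have := rderiv_chain erefl dg (rderiv_cst u t) (rderiv_line x v t).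
by rewrite mulr0 add0r mulrC.
Qed.

Lemma taylor_first : exists f1 B, 0 <= B /\
  forall u a b : C, cabs u <= 1 -> cabs a <= 1 -> cabs b <= 1 ->
    cabs (f (b, u) - f (a, u) - f1 (a, u) * (b - a)) <= B * cabs (b - a) ^+ 2.
Proof.
have [f1 [_ [f1u _ _ f1E]]] := @partial_extension (1, 0)%N (ltnW m_ge2).
have [f2 [B [_ B0 hB f2E]]] := @partial_extension (2, 0)%N m_ge2.
exists f1, B; split=> //.
apply: (@taylor_closed (fun x u => (x, u))) => //; first exact: Lipm_uniform hf.
move=> u a b hu ha hb; rewrite f1E //.
apply: (@taylor_open R (fun x => f (x, u)) (fun x => partial (1, 0)%N f (x, u))
  (fun x => partial (2, 0)%N f (x, u))) => t ht.
- by apply: (@rderiv_partial1 (0, 0)%N) => //; split=> //; exact: segment_lt1.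
- by apply: (@rderiv_partial1 (1, 0)%N) => //; [exact: ltnW | split=> //; exact: segment_lt1].
have hq : bidisk R (a + (t%:C)%C * (b - a), u) by split=> //; exact: segment_lt1.
by rewrite -f2E //; apply: hB; exact: bidisk_closed.
Qed.

Lemma taylor_second : exists f1 B, 0 <= B /\
  forall u a b : C, cabs u <= 1 -> cabs a <= 1 -> cabs b <= 1 ->
    cabs (f (u, b) - f (u, a) - f1 (u, a) * (b - a)) <= B * cabs (b - a) ^+ 2.
Proof.
have [f1 [_ [f1u _ _ f1E]]] := @partial_extension (0, 1)%N (ltnW m_ge2).
have [f2 [B [_ B0 hB f2E]]] := @partial_extension (0, 2)%N m_ge2.
exists f1, B; split=> //.
apply: (@taylor_closed (fun x u => (u, x))) => //; first exact: Lipm_uniform hf.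
move=> u a b hu ha hb; rewrite f1E //.
apply: (@taylor_open R (fun x => f (u, x)) (fun x => partial (0, 1)%N f (u, x))
  (fun x => partial (0, 2)%N f (u, x))) => t ht.
- by apply: (@rderiv_partial2 (0, 0)%N) => //; split=> //; exact: segment_lt1.
- by apply: (@rderiv_partial2 (0, 1)%N) => //; [exact: ltnW | split=> //; exact: segment_lt1].
have hq : bidisk R (u, a + (t%:C)%C * (b - a)) by split=> //; exact: segment_lt1.
by rewrite -f2E //; apply: hB; exact: bidisk_closed.
Qed.

Lemma Lipm_bipoly_dense e : 0 < e -> exists n1 n2 c,
  forall p, closed_bidisk R p -> cabs (f p - bipoly n1 n2 c p) <= e.
Proof.
have [f1 [B1 [B10 T1]]] := taylor_first; have [f2 [B2 [B20 T2]]] := taylor_second.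
apply: (@bipoly_dense R f f1 f2 (B1 + B2)) => u a b hu ha hb.
  by apply: le_trans (T1 u a b hu ha hb) _; rewrite ler_wpM2r ?sqr_ge0 // lerDl.
by apply: le_trans (T2 u a b hu ha hb) _; rewrite ler_wpM2r ?sqr_ge0 // lerDr.
Qed.

Lemma bipoly_pair n1 n2 (c : nat -> nat -> C) p : bipoly n1 n2 c p =
  \sum_(ab : 'I_n1 * 'I_n2) c ab.1 ab.2 * (p.1 ^+ ab.1 * p.2 ^+ ab.2) :> C.
Proof. by rewrite /bipoly pair_bigA. Qed.

(** A rotation by [t] multiplies a monomial by [expi t] to its total degree, so differences act
    diagonally and through the total degree alone. *)
Lemma iter_fdiff_bipoly n1 n2 (c : nat -> nat -> C) p r h :
  iter r (fdiff h) (fun t => bipoly n1 n2 c (rot t p)) 0 =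
  bipoly n1 n2 (fun a b => (expi h ^+ (a + b) - 1) ^+ r * c a b) p.
Proof.
have -> : (fun t => bipoly n1 n2 c (rot t p)) = (fun t => \sum_(ab : 'I_n1 * 'I_n2)
    (c ab.1 ab.2 * (p.1 ^+ ab.1 * p.2 ^+ ab.2)) * (expi t ^+ (ab.1 + ab.2)%N)).
  apply/funext => t; rewrite bipoly_pair; apply: eq_bigr => ab _.
  by rewrite /= !exprMn exprD; ring.
rewrite iter_fdiff_sum bipoly_pair; apply: eq_bigr => ab _.
by rewrite iter_fdiff_expi expi0 expr1n; ring.
Qed.

Definition jackson_rate n : R := (n%:R ^+ m * n%:R `^ gamma)^-1.

Lemma jackson_rate_gt0 n : (0 < n)%N -> 0 < jackson_rate n.
Proof. by move=> n0; rewrite invr_gt0 mulr_gt0 ?exprn_gt0 ?powR_gt0 ?ltr0n. Qed.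

(** The kernel controls an even integral moment, whereas the modulus of smoothness has the real
    order [m + gamma]. With [y = n t], the bound [y ^ (m + gamma) <= 1 + y ^ (2 (m + 1))] reduces
    the second to the first. *)
Lemma holder_moment_le (h t : R) n : (0 < n)%N -> 0 <= h -> 0 <= t -> h <= 4 * t ->
  h ^+ m * h `^ gamma <=
  4 ^+ m.+1 * jackson_rate n * (1 + n%:R ^+ (2 * m.+1) * t ^+ (2 * m.+1)).
Proof.
move=> n0 h0 t0 ht; have n0' : 0 < n%:R :> R by rewrite ltr0n.
have t40 : 0 <= 4 * t by rewrite mulr_ge0.
apply: le_trans (_ : (4 * t) ^+ m * (4 * t) `^ gamma <= _).
  apply: ler_pM; rewrite ?exprn_ge0 ?powR_ge0 //; first by rewrite lerXn2r.
  by apply: ge0_ler_powR; rewrite ?nnegrE // ltW.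
rewrite powRM // exprMn mulrACA.
apply: le_trans (_ : 4 ^+ m.+1 * (t ^+ m * t `^ gamma) <= _).
  apply: ler_wpM2r; first by rewrite mulr_ge0 ?exprn_ge0 ?powR_ge0.
  by rewrite exprSr ler_wpM2l ?exprn_ge0 //; apply: ler1_powR => //; lra.
rewrite -[leRHS]mulrA ler_wpM2l ?exprn_ge0 // /jackson_rate.
rewrite [leRHS]mulrC ler_pdivlMr ?mulr_gt0 ?exprn_gt0 ?powR_gt0 //.
rewrite mulrACA -exprMn -powRM // -exprMn.
set y := t * n%:R; have y0 : 0 <= y by rewrite mulr_ge0 // ltW.
rewrite [n%:R * t]mulrC -/y.
have [y1|y1] := leP y 1.
  apply: le_trans (_ : 1 * 1 <= _); last by rewrite mulr1 lerDl exprn_ge0.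
  apply: ler_pM; rewrite ?exprn_ge0 ?powR_ge0 ?exprn_ile1 //.
  have := @ge0_ler_powR R gamma (ltW gamma_gt0) y 1; rewrite !nnegrE powR1.
  by apply.
apply: le_trans (_ : y ^+ m * y <= _).
  by rewrite ler_wpM2l ?exprn_ge0 //; apply: ler1_powR => //; exact: ltW.
rewrite -exprSr; apply: le_trans (_ : y ^+ (2 * m.+1) <= _); last by rewrite lerDr.
by rewrite ler_eXn2l //; lia.
Qed.

(* The approximant multiplies the coefficients of total degree [j] of a close
   polynomial by [kap j], and the error is a mean, weighted by the Jackson kernel,
   of the finite differences of order [m.+1] along the rotations
   [(z, w) |-> (expi h * z, expi h * w)]. *)
Lemma jackson_bidisk : exists2 K : R, 0 <= K & forall n, (0 < n)%N ->
  exists n1 n2 c,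
    (forall a b, (a < n1)%N -> (b < n2)%N -> (m.+2 * n.-1 < a + b)%N -> c a b = 0) /\
    forall p, closed_bidisk R p -> cabs (f p - bipoly n1 n2 c p) <= K * jackson_rate n.
Proof.
have [L L0 hL] := iter_fdiff_torus gamma_gt0 gamma_le1 hf.
(* [A] bounds the mean of [1 + (n t) ^ (2 (m + 1))] under the Jackson kernel with [q = m + 1]. *)
pose A : R := 1 + 4 ^+ m.+1 * m.+2%:R.
have A0 : 0 <= A by rewrite addr_ge0 // mulr_ge0 // exprn_ge0.
exists (1 + (L * (4 ^+ m.+1 * A) + 2 ^+ m.+1)).
  by rewrite !addr_ge0 ?exprn_ge0 // !mulr_ge0 ?exprn_ge0.
move=> n n0; set dl := jackson_rate n; have dl0 : 0 < dl by exact: jackson_rate_gt0.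
have n0' : 0 < n%:R :> R by rewrite ltr0n.
have [n1 [n2 [c hc]]] := Lipm_bipoly_dense dl0.
(* Expanding [(x ^ j - 1) ^ m.+1] for total degrees [j <= n1 + n2] gives exponents up to [J]; taking
   [M] above [d + J] lets the kernel annihilate those above [d]. *)
set d := (m.+2 * n.-1)%N; pose J := (m.+1 * (n1 + n2))%N; pose M := (d + J).+1.
have [k [k0 k1 kM kJ]] := @jackson_kernel R n m.+1 M J n0 (ltnSn _).
pose w s := uroot R M ^+ s; have w1 s : cabs (w s) = 1 by rewrite cabsX cabs_uroot expr1n.
(* The degrees [n1] and [n2] are uncontrolled; the multiplier performs the cut-off. For [j > d] the
   kernel kills every nonconstant term of the expansion, the constant term [(-1) ^ m.+1] remains,
   and [kap j = 0]. *)
pose kap j : C := 1 - (-1) ^+ m.+1 * \sum_(s < M) ((k s)%:C)%C * (w s ^+ j - 1) ^+ m.+1.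
have kap0 j : (d < j)%N -> (j <= n1 + n2)%N -> kap j = 0.
  move=> dj jJ; rewrite /kap.
  have -> : \sum_(s < M) ((k s)%:C)%C * (w s ^+ j - 1) ^+ m.+1 = (-1) ^+ m.+1.
    under eq_bigr => s _ do rewrite exprBn mulr_sumr.
    rewrite exchange_big /= big_ord_recr /= [X in X + _]big1 => [|i _].
      rewrite add0r subnn binn; under eq_bigr => s _ do rewrite expr1n expr0 !mulr1.
      by rewrite -mulr_suml -rmorph_sum k1 rmorph1 mul1r.
    transitivity (((-1) ^+ i *+ 'C(m.+1, i)) * \sum_(s < M) ((k s)%:C)%C * w s ^+ (j * (m.+1 - i))%N).
      rewrite mulr_sumr; apply: eq_bigr => s _.
      by rewrite expr1n mulr1 exprM -mulrnAl; ring.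
    rewrite kJ ?mulr0 //; last by rewrite mulnC leq_mul // leq_subr.
    by apply: leq_trans dj _; rewrite leq_pmulr // subn_gt0.
  by rewrite -exprMn mulrNN mulr1 expr1n subrr.
exists n1, n2, (fun a b => kap (a + b)%N * c a b); split.
  by move=> a b ha hb hab; rewrite kap0 ?mul0r //; lia.
(* The differences of [f] are estimated on the torus; since this combination is a polynomial,
   [bipoly_max_principle] carries the bound to the closed bidisk. *)
have torus_bound p : torus R p ->
    cabs (bipoly n1 n2 (fun a b => (1 - kap (a + b)%N) * c a b) p) <=
    (L * (4 ^+ m.+1 * A) + 2 ^+ m.+1) * dl.
  move=> hp.
  have [h hE hh] : exists2 h : nat -> R, forall s, expi (h s) = w s &
      forall s, `|h s| <= 4 * cabs (w s - 1).
    have [h hP] := choice (fun s => (let: ex_intro2 x a b := expi_surj (w1 s) in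
      ex_intro (fun x => expi x = w s /\ `|x| <= 4 * cabs (w s - 1)) x (conj a b))).
    by exists h => s; case: (hP s).
  have -> : bipoly n1 n2 (fun a b => (1 - kap (a + b)%N) * c a b) p =
      (-1) ^+ m.+1 * \sum_(s < M) ((k s)%:C)%C *
        iter m.+1 (fdiff (h s)) (fun t => bipoly n1 n2 c (rot t p)) 0.
    under eq_bigr => s _ do rewrite iter_fdiff_bipoly bipoly_pair mulr_sumr.
    rewrite exchange_big mulr_sumr bipoly_pair; apply: eq_bigr => ab _.
    rewrite /kap opprB addrC subrK -!mulrA; congr (_ * _).
    by rewrite mulr_suml; apply: eq_bigr => s _; rewrite hE !mulrA.
  rewrite cabsM cabsX cabsN cabs1 expr1n mul1r.
  apply: le_trans (cabs_sum _ _ _) _.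
  pose t s := cabs (w s - 1).
  apply: le_trans (_ : \sum_(s < M) (L * (4 ^+ m.+1 * dl) * (k s * (1 + n%:R ^+ (2 * m.+1) * t s ^+ (2 * m.+1))) +
      k s * (2 ^+ m.+1 * dl)) <= _).
    apply: ler_sum => s _; rewrite cabsM cabs_real ger0_norm //.
    have h1 := hL p (h s) hp.
    have h2 := holder_moment_le n0 (normr_ge0 (h s)) (cabs_ge0 (w s - 1)) (hh s).
    have h3 := @iter_fdiff_lip R m.+1 (h s) (fun t => bipoly n1 n2 c (rot t p))
      (fun t => f (rot t p)) dl (ltac:(by move=> x; rewrite cabs_distC; apply: hc; apply: rot_closed; exact: torus_closed)) 0.
    set X := iter _ _ _ _ in h3 *; set Y := iter _ _ _ _ in h1 h3.
    have h4 := cabsD (X - Y) Y; rewrite subrK in h4.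
    have h5 : cabs X <= L * (4 ^+ m.+1 * dl * (1 + n%:R ^+ (2 * m.+1) * t s ^+ (2 * m.+1))) + 2 ^+ m.+1 * dl.
      by have := ler_wpM2l L0 h2; rewrite -/dl -/(t s); lra.
    apply: le_trans (ler_wpM2l (k0 s) h5) _.
    by rewrite mulrDr lerD2r le_eqVlt; apply/orP; left; apply/eqP; ring.
  rewrite big_split /= -mulr_sumr -mulr_suml k1 mul1r mulrDl lerD2r.
  rewrite -!mulrA ler_wpM2l // ler_wpM2l ?exprn_ge0 // mulrC ler_wpM2r ?(ltW dl0) //.
  under eq_bigr => s _ do rewrite mulrDr mulr1 mulrCA.
  rewrite big_split /= k1 -mulr_sumr /A lerD2l mulrC -ler_pdivlMr ?exprn_gt0 //.
move=> p hp.
have E : f p - bipoly n1 n2 (fun a b => kap (a + b)%N * c a b) p =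
   (f p - bipoly n1 n2 c p) + bipoly n1 n2 (fun a b => (1 - kap (a + b)%N) * c a b) p.
  rewrite -addrA; congr (_ + _); rewrite !bipoly_pair -!sumrN -big_split /=.
  by apply: eq_bigr => ab _; ring.
rewrite E; apply: le_trans (cabsD _ _) _; rewrite [(1 + _) * _]mulrDl mul1r lerD ?hc //.
exact: bipoly_max_principle torus_bound _ hp.
Qed.

End Jackson.

(** * The interpolation error *)

Section Assembly.
Variable R : realType.
Local Notation C := (Cplx R).

Lemma bipoly_span N n1 n2 (c : nat -> nat -> C) :
  (forall a b, (a < n1)%N -> (b < n2)%N -> (graded_level N <= a + b)%N -> c a b = 0) ->
  poly2_span N (bipoly n1 n2 c).
Proof.
move=> hc; apply: poly2_span_sum => a; apply: poly2_span_sum => b.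
have [hab|hab] := ltnP (a + b) (graded_level N).
  by apply: poly2_spanZ; apply: poly2_span_mono; exact: graded_row_degree.
rewrite hc //; have [d hd] := poly2_span0 R N.
by exists d => p; rewrite -hd mul0r.
Qed.

Lemma leq_mul_trunc_div (s m : nat) : (0 < s)%N -> (s <= m.+2 * (s.-1 %/ m.+2).+1)%N.
Proof. by move=> s0; have := divn_eq s.-1 m.+2; have := ltn_pmod s.-1 (ltn0Sn m.+1); nia. Qed.

(** With [b = m + gamma - 3], the power [s ^ (m + gamma)] splits as [s ^ 3 * s ^ b]. The cube
    absorbs [1 + 4 s ^ 2 (s + 2) <= 13 s ^ 3], and [N <= (s + 1) ^ 2 <= (2 s) ^ 2] turns [s ^ b]
    into [N ^ (b / 2)] up to [2 ^ b], as [b] is positive. *)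
Lemma rate_conversion (m N s n : nat) (gamma : R) : (3 <= m)%N -> 0 < gamma ->
  (0 < s)%N -> (N <= s.+1 ^ 2)%N -> (0 < N)%N -> (s <= m.+2 * n)%N -> (0 < n)%N ->
  (1 + s%:R * (s%:R * (4 * s.+2%:R))) * (n%:R ^+ m * n%:R `^ gamma)^-1 <=
  13 * (m.+2%:R ^+ m * m.+2%:R `^ gamma) * 2 `^ (m%:R + gamma - 3) *
    (1 / N%:R `^ ((m%:R + gamma - 3) / 2)).
Proof.
move=> m3 g0 s0 hN N0 hs n0; set b := m%:R + gamma - 3.
have m3R : 3 <= m%:R :> R by rewrite ler_nat.
have b0 : 0 < b by rewrite /b; lra.
have s1 : 1 <= s%:R :> R by rewrite ler1n.
have sp : 0 < s%:R :> R by lra.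
have np : 0 < n%:R :> R by rewrite ltr0n.
have Np : 0 < N%:R :> R by rewrite ltr0n.
have m2p : 0 < m.+2%:R :> R by rewrite ltr0n.
have sp' := ltW sp; have np' := ltW np; have Np' := ltW Np; have m2p' := ltW m2p.
have b0' := ltW b0; have g0' := ltW g0.
pose P (x : R) := x ^+ m * x `^ gamma.
have P0 x : 0 < x -> 0 < P x by move=> x0; rewrite mulr_gt0 ?exprn_gt0 ?powR_gt0.
have PE x : 0 < x -> P x = x ^+ 3 * x `^ b.
  move=> x0; have x0' : x != 0 by rewrite gt_eqF.
  rewrite /P -!powR_mulrn ?(ltW x0) // -!powRD ?x0' ?implybT //; congr (_ `^ _).
  by rewrite /b; ring.
have H1 : 1 + s%:R * (s%:R * (4 * s.+2%:R)) <= 13 * s%:R ^+ 3 :> R.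
  have s2 : s.+2%:R = s%:R + 2 :> R by rewrite -addn2 natrD.
  by rewrite s2; nra.
have H2 : P s%:R <= P m.+2%:R * P n%:R.
  have hsn : s%:R <= m.+2%:R * n%:R :> R by rewrite -natrM ler_nat.
  apply: le_trans (_ : P (m.+2%:R * n%:R) <= _).
    apply: ler_pM; rewrite ?exprn_ge0 ?powR_ge0 //.
      by rewrite lerXn2r ?nnegrE ?mulr_ge0 //.
    by apply: ge0_ler_powR; rewrite ?nnegrE ?mulr_ge0 //.
  by rewrite /P exprMn powRM // mulrACA.
have H3 : N%:R `^ (b / 2) <= 2 `^ b * s%:R `^ b.
  rewrite -powRM //; have -> : 2 * s%:R = ((2 * s%:R) ^+ 2) `^ (2^-1) :> R.
    by rewrite powR12_sqrt ?sqr_ge0 // sqrtr_sqr ger0_norm // mulr_ge0 //.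
  rewrite -powRrM [2^-1 * b]mulrC; apply: ge0_ler_powR; rewrite ?nnegrE ?sqr_ge0 //.
    by rewrite divr_ge0.
  rewrite -natrM -natrX ler_nat; apply: leq_trans hN _.
  by rewrite leq_exp2r // mul2n -addnn -addn1 leq_add2l.
have Nb : 0 < N%:R `^ (b / 2) by rewrite powR_gt0.
have sb : 0 < s%:R `^ b by rewrite powR_gt0.
have bb : 0 < (2 : R) `^ b by rewrite powR_gt0.
rewrite -/(P n%:R) -/(P m.+2%:R) ler_pdivrMr ?P0 //.
apply: le_trans H1 _; rewrite div1r mulrAC ler_pdivlMr //.
have H4 := PE _ sp; have s3 : 0 < s%:R ^+ 3 :> R by rewrite exprn_gt0.
apply: le_trans (_ : 13 * s%:R ^+ 3 * (2 `^ b * s%:R `^ b) <= _).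
  by rewrite ler_pM2l // mulr_gt0.
have -> : 13 * s%:R ^+ 3 * (2 `^ b * s%:R `^ b) = 13 * 2 `^ b * P s%:R by rewrite H4; ring.
have -> : 13 * P m.+2%:R * 2 `^ b * P n%:R = 13 * 2 `^ b * (P m.+2%:R * P n%:R) by ring.
by rewrite ler_pM2l // mulr_gt0.
Qed.

End Assembly.

Unset Implicit Arguments.
Set Strict Implicit.
Set Printing Implicit Defensive.

Theorem corollary3 (R : realType) (m : nat) (gamma : R)
    (eta theta : nat -> Cplx R) :
  (3 <= m)%N -> 0 < gamma -> gamma <= 1 ->
  leja (closed_disk R) eta -> leja (closed_disk R) theta ->
  cabs (eta 0%N) = 1 -> cabs (theta 0%N) = 1 ->
  forall f : Cplx R * Cplx R -> Cplx R, Lipm m gamma f ->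
  exists K : R, \forall N \near \oo,
    (ereal_sup [set (cabs (f p -
        lagrange_interp (fun j : 'I_N => intertwining eta theta j) f p))%:E
      | p in closed_bidisk R]
     <= (K * (1 / N%:R `^ ((m%:R + gamma - 3%:R) / 2%:R)))%:E)%E.
Proof.
move=> m3 g0 g1 /leja_leja_disk hE /leja_leja_disk hT /hE{}hE /hT{}hT f hf.
have [K K0 hK] := jackson_bidisk g0 g1 hf (ltnW m3).
exists (13 * (m.+2%:R ^+ m * m.+2%:R `^ gamma) * 2 `^ (m%:R + gamma - 3) * K).
exists 2%N => // N /= hN; apply: ge_ereal_sup => _ [p hp <-]; rewrite lee_fin.
set s := graded_level N; have hs := graded_level_sqr N; rewrite -/s in hs.
have s0 : (0 < s)%N by case: (s) hs => // hs; move: (leq_trans hN hs).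
(* The largest order for which [(m + 2) (n - 1) <= s - 1]: the approximant has degree below [s],
   hence lies in the span, and still [s <= (m + 2) n]. *)
pose n := (s.-1 %/ m.+2).+1.
have [n1 [n2 [c [hc hP]]]] := hK n (ltn0Sn _).
have spanP : poly2_span N (bipoly n1 n2 c).
  apply: bipoly_span => a b ha hb; rewrite -/s => hab; apply: hc => //.
  apply: leq_trans hab; rewrite /n /= mulnC.
  by apply: leq_ltn_trans (leq_trunc_div _ _) _; rewrite prednK.
apply: le_trans (interp_error hE hT hp spanP hP) _.
have := rate_conversion m3 g0 s0 hs (ltnW hN) (leq_mul_trunc_div m s0) (ltn0Sn _).
rewrite -/n /stair_norm -/s -/(jackson_rate m gamma n) => h.
have := ler_wpM2l K0 h; rewrite mulrCA => /le_trans; apply.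
by rewrite le_eqVlt; apply/orP; left; apply/eqP; ring.
Qed.
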